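(* Let $H$, $V$, $A$, $B$, $P$, $Q$, $R$ be as in the context, and suppose that $f\in L^2_{\rm loc}(\mathbb{R},H)$ is causal. Choose $T_0$ so that ${\rm supp}\,f\subset[T_0,\infty)$. Then there exists a unique causal weak solution $u\in C^0(\mathbb{R},H)$ of $$Au'+Pu+Bu+R[u]=f$$ with ${\rm supp}\,u\subset[T_0,\infty)$. For every $T\ge T_0$ there exists $C_{T_0,T}\ge0$, depending on $T_0$, $T$, $C_*$, $C^*$, $\|B\|_{\mathcal{B}(H)}$ and $\|Q\|_{L^1(\mathbb{R},\mathcal{B}(H))}$, such that for any $t\le T$, $$\|u(t)\|_H^2\le C_{T_0,T}\int_{-\infty}^t\|f(s)\|^2\,ds .$$
   Context: $H$ is a separable real Hilbert space with inner product $\langle\cdot,\cdot\rangle$ and norm $\|\cdot\|=\|\cdot\|_H$. $V\subset H$ is a dense subspace, itself a separable Hilbert space with norm $\|\cdot\|_V$ defining a stronger topology than that induced by $H$. $\mathcal{B}(H)$ is the space of bounded linear operators on $H$ with the operator norm, and $\mathcal{B}_{\rm symm}(H)$ its subspace of self-adjoint operators. Assumptions: - $A\in\mathcal{B}_{\rm symm}(H)$ with $C_*I\le A\le C^*I$, $0<C_*\le C^*$; - $B\in\mathcal{B}(H)$; - $Q\in L^1(\mathbb{R},\mathcal{B}_{\rm symm}(H))\cap C^0(\mathbb{R}_+,\mathcal{B}(H))$ with $Q(t)=0$ for $t<0$ ($\mathbb{R}_+=[0,\infty)$); - $P$ is a skew-adjoint operator on $H$ with domain $V$, whose graph norm is equivalent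 to $\|\cdot\|_V$. $L^2_+(\mathbb{R},H)=\{v\in L^2_{\rm loc}(\mathbb{R},H): v\in L^2((-\infty,T],H)\text{ for each }T\in\mathbb{R}\}$. For $u\in L^2_+(\mathbb{R},H)$, $R[u](t)=\int Q(t-s)u(s)\,ds$; the formal adjoint is $R^*[\phi](t)=\int Q(s-t)\phi(s)\,ds$. A function $u\in L^2_{\rm loc}(\mathbb{R},H)$ is causal if ${\rm supp}\,u\subset[T,\infty)$ for some $T\in\mathbb{R}$. A weak solution of $Au'+Pu+Bu+R[u]=f$ is a $u\in L^2_+(\mathbb{R},H)$ such that for all $\phi\in C_0^\infty(\mathbb{R},V)$, $$\int\langle u(t),(A\phi'+P\phi-B^*\phi-R^*[\phi])(t)\rangle\,dt=-\int\langle f(t),\phi(t)\rangle\,dt .$$ *)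

(* Defs.v *)
From HB Require Import structures.
From mathcomp Require Import all_boot all_order all_algebra.
From mathcomp Require Import all_classical all_reals all_analysis.
Set Implicit Arguments.
Unset Strict Implicit.
Unset Printing Implicit Defensive.
Import Order.TTheory GRing.Theory Num.Theory.
Import numFieldNormedType.Exports.
Local Open Scope classical_set_scope.
Local Open Scope ring_scope.

(* The norm of a Hilbert space is the one of the underlying complete normed
   module, and the inner product is required to induce it. *)
HB.mixin Record CompleteNormedModule_isHilbert (R : realType) H
    of CompleteNormedModule R H := {
  inner : {dot H for (@idfun R)} ;
  inner_norm : forall x : H, inner x x = `|x| ^+ 2
}.

#[short(type="hilbertType")]
HB.structure Definition Hilbert (R : realType) :=
  {H of CompleteNormedModule R H & CompleteNormedModule_isHilbert R H}.

Notation "''[' x , y ]" := (inner x y)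
  (format "''[' x ,  y ]") : ring_scope.

Definition separable (T : topologicalType) :=
  exists2 S : set T, countable S & dense S.

Section Operators.
Context (R : realType) (H : hilbertType R).

Definition bounded_op (L : H -> H) := bounded_near L (nbhs (0 : H)).

Definition opnorm (L : H -> H) : R :=
  sup [set `|L x| | x in [set x : H | `|x| <= 1]].

Definition symmetric_op (L : H -> H) := forall x y : H, '[L x, y] = '[x, L y].

(* Existence (for bounded linear L) is the Riesz representation theorem. *)
Definition adjoint (L : H -> H) (y : H) : H :=
  get [set z | forall x : H, '[L x, y] = '[x, z]].

(* Graph of the adjoint of the unbounded, densely defined operator with
   graph G. *)
Definition adjoint_graph (G : set (H * H)) : set (H * H) :=
  [set xy | forall uv, G uv -> '[uv.2, xy.1] = '[uv.1, xy.2]].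

End Operators.

(* An unbounded operator on H with domain V is given as a linear map
   P : V -> H together with the inclusion j : V -> H of its domain. *)
Section UnboundedOperator.
Context (R : realType) (H V : hilbertType R) (j P : V -> H).

(* P^* = - P, including equality of the domains. *)
Definition skew_adjoint :=
  adjoint_graph (range (fun v => (j v, P v))) = range (fun v => (j v, - P v)).

Definition graph_norm (v : V) : R := Num.sqrt (`|j v| ^+ 2 + `|P v| ^+ 2).

Definition graph_norm_equiv := exists c C : R,
  [/\ 0 < c, 0 < C & forall v : V, c * `|v| <= graph_norm v <= C * `|v|].

End UnboundedOperator.

Section VectorValued.
Context (R : realType) (H : hilbertType R).
Local Notation mu := (@lebesgue_measure R).
Implicit Types (u v f s : R -> H).

(* For separable H, Borel measurability coincides with strong measurability. *)
Definition borel_fun u :=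
  measurable_fun setT (u : R -> g_sigma_algebraType (@open H)).

Definition simple_integrable s :=
  [/\ borel_fun s, finite_set (range s) &
      (\int[mu]_t `|s t|%:E < +oo)%E].

(* The possibly infinite measure of s @^-1` [set 0] contributes 0. *)
Definition simple_integral s : H :=
  \sum_(x \in range s) fine (mu (s @^-1` [set x])) *: x.

Definition is_bochner_integral f (w : H) :=
  borel_fun f /\
  exists s_ : nat -> R -> H,
    [/\ forall n, simple_integrable (s_ n),
        (\int[mu]_t `|f t - s_ n t|%:E)%E @[n --> \oo] --> 0%E &
        simple_integral (s_ n) @[n --> \oo] --> w].

Definition bochner f : H := get [set w | is_bochner_integral f w].

Definition L2loc u :=
  borel_fun u /\
  forall K : set R, compact K -> (\int[mu]_(t in K) (`|u t| ^+ 2)%:E < +oo)%E.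

Definition L2plus u :=
  L2loc u /\
  forall T : R, (\int[mu]_(t in `]-oo, T]) (`|u t| ^+ 2)%:E < +oo)%E.

(* Support of the almost-everywhere class of u: the complement of the largest
   open set on which u vanishes almost everywhere. *)
Definition esupp u : set R :=
  [set t : R | forall e : R, 0 < e ->
     ~ {ae mu, forall s : R, ball t e s -> u s = 0}].

Definition causal u := exists T : R, esupp u `<=` `[T, +oo[.

Definition test_function (phi : R -> H) :=
  (forall n t, derivable (derive1n n phi) t 1) /\
  compact (closure [set t | phi t != 0]).

Implicit Type Q : R -> H -> H.

Definition op_continuous_on (D : set R) Q := forall t, D t ->
  opnorm (Q s \- Q t) @[s --> within D (nbhs t)] --> (0 : R).

(* Kernels are moreover assumed to vanish on ]-oo, 0[ and to be norm
   continuous on [0, +oo[, so their strong measurability is automatic and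
   membership in L^1 amounts to integrability of the operator norm. *)
Definition op_L1 Q :=
  mu.-integrable setT (fun t => (opnorm (Q t))%:E).

Definition op_L1norm Q : R := \int[mu]_t opnorm (Q t).

(* Formal adjoint of the memory operator R[u](t) = \int Q(t - s) u(s) ds. *)
Definition memory_adjoint Q (phi : R -> H) (t : R) : H :=
  bochner (fun s : R => Q (s - t) (phi s)).

End VectorValued.

(* Weak solutions of A u' + P u + B u + R[u] = f. *)
Definition weak_solution (R : realType) (H V : hilbertType R)
    (j P : V -> H) (A B : H -> H) (Q : R -> H -> H) (f u : R -> H) :=
  L2plus u /\
  forall phi : R -> V, test_function phi ->
    \int[lebesgue_measure]_t
      '[u t, A (j (derive1 phi t)) + P (phi t) - adjoint B (j (phi t))
             - memory_adjoint Q (j \o phi) t]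
    = - \int[lebesgue_measure]_t '[f t, j (phi t)].

(* Main.v *)
(* In the inner product <x, y>_A = <A x, y> the operator G = - A^-1 P is
   skew-adjoint; the bounded operators G (1 - h^2 G^2)^-1, given by Lax-Milgram on
   V, generate isometry groups which converge as h tends to 0 to a group S with
   generator G.  The equation becomes the fixed point problem u = z, where
     z(t) = S(t) \int_(-oo, t] S(-s) A^-1 (f - B u - R[u])(s) ds,
   and on causal functions this map is a contraction for the weight
   exp(l (t - T0)) with l large, which gives existence together with
   |u(t)| <= C \int_(-oo, t] |f|.
   Uniqueness: if w is the difference of two weak solutions and z the mild solution
   with right-hand side - B w - R[w], then d = w - z is a causal weak solution of
   A d' + P d = 0.  Testing with products of a scalar bump and v in V, and
   integrating twice in time, Z = \int d and Y = \int Z satisfy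
   <A Z, j v> = <Y, P v> for all v.  Hence Y lies in the domain V and A Y' = - P Y,
   so that <A Y, Y> is constant, Y = 0 and d = 0; then w = z is a fixed point of
   the contraction with f = 0, whence w = 0. *)
Require Import Defs.
From HB Require Import structures.
From mathcomp Require Import all_boot all_order all_algebra.
From mathcomp Require Import all_classical all_reals all_analysis.
From mathcomp Require Import measurable_realfun ring lra.
Set Implicit Arguments.
Unset Strict Implicit.
Unset Printing Implicit Defensive.
Import Order.TTheory GRing.Theory Num.Theory.
Import numFieldNormedType.Exports.
Local Open Scope classical_set_scope.
Local Open Scope ring_scope.

(** * Hilbert spaces and bounded operators *)

(** Vector integrals are weak integrals, defined by Riesz representation, so that estimates, Fubini
    exchanges and differentiation become statements about real integrals; separability makes norms
    measurable. The Bochner integral enters the problem only through [memory_adjoint], where it is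
    identified with the weak one. The approximants are [G (1 - h^2 G^2)^-1] rather than
    [G (1 - h G)^-1] because they stay skew: their flows preserve [<A x, x>] for both signs of time,
    so the limit is a group, and the variational problem behind them is symmetric, so that a
    minimisation solves it. A weak solution is merely locally square integrable, with no values in
    [V] and no time derivative, so it cannot be paired with itself; the two time integrations supply
    both. Test functions need compact support, which primitives lack; subtracting a translate pushed
    back to where the solution vanishes repairs this. *)

Section InnerProduct.
Context {R : realType} {H : hilbertType R}.
Implicit Types (x y z : H) (a : R).

Lemma innerC x y : '[x, y] = '[y, x].
Proof. by rewrite (@hermitian_subproof _ _ _ _ (@inner R H)) /= expr0 mul1r. Qed.

Lemma innerDl x y z : '[x + y, z] = '[x, z] + '[y, z].
Proof. exact: (linearDl (@inner R H)). Qed.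

Lemma innerBl x y z : '[x - y, z] = '[x, z] - '[y, z].
Proof. exact: (linearBl (@inner R H)). Qed.

Lemma innerNl x z : '[- x, z] = - '[x, z].
Proof. exact: (linearNl (@inner R H)). Qed.

Lemma innerZl a x z : '[a *: x, z] = a * '[x, z].
Proof. exact: (linearZl_LR (@inner R H)). Qed.

Lemma inner0l z : '[0 : H, z] = 0.
Proof. exact: (linear0l (@inner R H)). Qed.

Lemma innerDr x y z : '[x, y + z] = '[x, y] + '[x, z].
Proof. by rewrite !(innerC x) innerDl. Qed.

Lemma innerBr x y z : '[x, y - z] = '[x, y] - '[x, z].
Proof. by rewrite !(innerC x) innerBl. Qed.

Lemma innerNr x z : '[x, - z] = - '[x, z].
Proof. by rewrite !(innerC x) innerNl. Qed.

Lemma innerZr a x z : '[x, a *: z] = a * '[x, z].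
Proof. by rewrite !(innerC x) innerZl. Qed.

Lemma inner0r z : '[z, 0 : H] = 0.
Proof. by rewrite innerC inner0l. Qed.

Definition innerE := (innerDl, innerDr, innerBl, innerBr, innerNl, innerNr,
  innerZl, innerZr, inner0l, inner0r).

Lemma inner_ge0 x : 0 <= '[x, x].
Proof. by rewrite inner_norm exprn_ge0. Qed.

Lemma inner_eq0 x : '[x, x] = 0 -> x = 0.
Proof. by rewrite inner_norm => /eqP; rewrite expf_eq0 /= normr_eq0 => /eqP. Qed.

(** Cauchy-Schwarz: the square of [|y| x - |x| y] is nonnegative, and dividing its expansion by
    [|x| |y|] gives the bound. *)
Lemma inner_le_norm x y : '[x, y] <= `|x| * `|y|.
Proof.
have [->|x0] := eqVneq x 0; first by rewrite inner0l normr0 mul0r.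
have [->|y0] := eqVneq y 0; first by rewrite inner0r normr0 mulr0.
have nx : 0 < `|x| by rewrite normr_gt0.
have ny : 0 < `|y| by rewrite normr_gt0.
have := inner_ge0 (`|y| *: x - `|x| *: y).
rewrite !innerE (innerC y x) !inner_norm => h.
rewrite -(ler_pM2l (mulr_gt0 nx ny)); nra.
Qed.

Lemma abs_inner_le x y : `|'[x, y]| <= `|x| * `|y|.
Proof.
rewrite ler_norml inner_le_norm andbT lerNl -innerNl.
by rewrite (le_trans (inner_le_norm _ _))// normrN.
Qed.

Lemma inner_ext x y : (forall z, '[z, x] = '[z, y]) -> x = y.
Proof.
move=> h; apply/subr0_eq/inner_eq0.
by rewrite innerBr h subrr.
Qed.

(** Duality form of the norm, the way to estimate vectors known only through their inner products,
    such as weak integrals. *)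
Lemma norm_le_inner x a : 0 <= a -> (forall z, '[z, x] <= `|z| * a) -> `|x| <= a.
Proof.
move=> a0 h; have [->|x0] := eqVneq x 0; first by rewrite normr0.
rewrite -(@ler_pM2l _ `|x|) ?normr_gt0//.
by have := h x; rewrite inner_norm expr2.
Qed.

Lemma normD2 x y : `|x + y| ^+ 2 = `|x| ^+ 2 + 2 * '[x, y] + `|y| ^+ 2.
Proof. by rewrite -!inner_norm !innerE (innerC y x); ring. Qed.

Lemma normB2 x y : `|x - y| ^+ 2 = `|x| ^+ 2 - 2 * '[x, y] + `|y| ^+ 2.
Proof. by rewrite -!inner_norm !innerE (innerC y x); ring. Qed.

Lemma inner_polar x y : '[x, y] = 4^-1 * (`|x + y| ^+ 2 - `|x - y| ^+ 2).
Proof. by rewrite normD2 normB2; field. Qed.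

Lemma cvg_inner (T : Type) (F : set_system T) {FF : Filter F} (f g : T -> H) x y :
  f t @[t --> F] --> x -> g t @[t --> F] --> y ->
  '[f t, g t] @[t --> F] --> ('[x, y] : R).
Proof.
move=> fx gy; rewrite inner_polar.
under eq_fun do rewrite inner_polar.
apply: cvgMr; apply: cvgB; rewrite expr2; under eq_fun do rewrite expr2.
  by apply: cvgM; apply: cvg_norm; apply: cvgD.
by apply: cvgM; apply: cvg_norm; apply: cvgB.
Qed.

Lemma continuous_inner (T : topologicalType) (f g : T -> H) :
  continuous f -> continuous g -> continuous (fun t => '[f t, g t] : R).
Proof. by move=> cf cg t; apply: cvg_inner; [exact: cf|exact: cg]. Qed.

End InnerProduct.

Section BoundedOperators.
Context {R : realType} {U W : normedModType R}.

Lemma bounded_nearP (L : {linear U -> W}) : bounded_near L (nbhs (0 : U)) ->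
  exists2 K : R, 0 < K & forall x, `|L x| <= K * `|x|.
Proof.
move=> /linear_boundedP/pinfty_ex_gt0[K K0 hK]; exists K => //.
Qed.

Lemma lipschitz_linear_continuous (L : {linear U -> W}) (K : R) :
  (forall x, `|L x| <= K * `|x|) -> continuous L.
Proof.
move=> hK; apply/linear_bounded_continuous/linear_boundedP.
near=> r => x; apply: (le_trans (hK x)); apply: ler_wpM2r => //.
Unshelve. all: by end_near. Qed.

End BoundedOperators.

Section OperatorNorm.
Context {R : realType} {H : hilbertType R}.
Implicit Types (L : {linear H -> H}).

Lemma opnorm_has_sup L : bounded_op L ->
  has_sup [set `|L x| | x in [set x : H | `|x| <= 1]].
Proof.
move=> /bounded_nearP[K K0 hK]; split.
  by exists `|L 0|, 0; rewrite //= normr0.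
exists K => _ [x /= x1 <-]; apply: (le_trans (hK x)).
by rewrite ler_piMr// ltW.
Qed.

Lemma opnorm_ge0 L : bounded_op L -> 0 <= opnorm L.
Proof.
move=> /opnorm_has_sup/sup_upper_bound; apply; exists 0; rewrite /= ?normr0//.
by rewrite linear0 normr0.
Qed.

Lemma le_opnorm L x : bounded_op L -> `|L x| <= opnorm L * `|x|.
Proof.
move=> bL; have [->|x0] := eqVneq x 0; first by rewrite linear0 !normr0 mulr0.
have nx : 0 < `|x| by rewrite normr_gt0.
rewrite -ler_pdivrMr//; apply: (sup_upper_bound (opnorm_has_sup bL)).
exists (`|x|^-1 *: x); rewrite ?linearZ/= normrZ normfV normr_id 1?mulrC//.
by rewrite divff// gt_eqF.
Qed.

Lemma opnorm_le L (K : R) : 0 <= K -> (forall x, `|L x| <= K * `|x|) -> opnorm L <= K.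
Proof.
move=> K0 hK; apply: ge_sup; first by exists `|L 0|, 0; rewrite //= normr0.
by move=> _ [x /= x1 <-]; apply: (le_trans (hK x)); rewrite ler_piMr.
Qed.

End OperatorNorm.

(** * Symmetric Lax-Milgram and Riesz representation *)

Section LaxMilgram.
Context {R : realType} {V : hilbertType R}.
Variables (a : V -> V -> R) (l : V -> R) (c Ca Cl : R).
Hypothesis aDr : forall u v w, a u (v + w) = a u v + a u w.
Hypothesis aZr : forall k u v, a u (k *: v) = k * a u v.
Hypothesis aC : forall u v, a u v = a v u.
Hypothesis c0 : 0 < c.
Hypothesis coer : forall v, c * `|v| ^+ 2 <= a v v.
Hypothesis bnd : forall v, a v v <= Ca * `|v| ^+ 2.
Hypothesis lD : forall v w, l (v + w) = l v + l w.
Hypothesis lZ : forall k v, l (k *: v) = k * l v.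
Hypothesis lb : forall v, `|l v| <= Cl * `|v|.

Let J v := a v v - 2 * l v.

Let J_lb v : - (Cl ^+ 2 / c) <= J v.
Proof.
have h1 := coer v; have h2 := lb v.
have h3 := ler_norm (l v).
have -> : - (Cl ^+ 2 / c) = - c * (Cl / c) ^+ 2.
  by field; rewrite gt_eqF.
have : 0 <= c * (`|v| - Cl / c) ^+ 2 by rewrite mulr_ge0 ?sqr_ge0// ltW.
have -> : c * (`|v| - Cl / c) ^+ 2 = c * `|v| ^+ 2 - 2 * Cl * `|v| + c * (Cl / c) ^+ 2.
  by field; rewrite gt_eqF.
rewrite /J; lra.
Qed.

Let aDl u v w : a (v + w) u = a v u + a w u.
Proof. by rewrite aC aDr !(aC u). Qed.
Let aZl k u v : a (k *: v) u = k * a v u.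
Proof. by rewrite aC aZr (aC u). Qed.

Let J_mid v w : J (2^-1 *: (v + w)) =
  2^-1 * (J v + J w) - 4^-1 * a (v - w) (v - w).
Proof.
rewrite /J -(scaleN1r w) !(aZl, aZr, aDl, aDr, lZ, lD) (aC w v); field. by [].
Qed.

(* The solution minimises the energy [J]; a minimising sequence is Cauchy by the
   parallelogram identity. *)
Lemma lax_milgram : exists v, forall w, a v w = l w.
Proof.
pose S := range J; pose m := inf S.
have hS : has_inf S.
  split; first by exists (J 0), 0.
  by exists (- (Cl ^+ 2 / c)) => _ [v _ <-]; exact: J_lb.
have mJ v : m <= J v by apply: (inf_lbound hS.2); exists v.
have hv n : exists v, J v < m + n.+1%:R^-1.
  have [|_ [v _ <-] h] := @inf_adherent _ S n.+1%:R^-1 _ hS; last by exists v.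
  by rewrite invr_gt0.
pose u n := sval (cid (hv n)).
have hu n : J (u n) < m + n.+1%:R^-1 := svalP (cid (hv n)).
have ucau n k : c * `|u n - u k| ^+ 2 <= 2 * (n.+1%:R^-1 + k.+1%:R^-1).
  apply: (le_trans (coer _)).
  have := J_mid (u n) (u k); have := hu n; have := hu k.
  have := mJ (2^-1 *: (u n + u k)).
  move: (J _) (J (u n)) (J (u k)) (a _ _) => A1 A2 A3 A4.
  move: n.+1%:R^-1 k.+1%:R^-1 => r1 r2; lra.
have ucvg : cvgn u.
  apply/cauchy_cvgP/cauchy_exP => e e0.
  pose N := Num.truncn (4 / (c * e ^+ 2)).
  exists (u N); suff : \forall n \near \oo, `|u N - u n| < e by rewrite -ball_normE.
  near=> n; rewrite -(@ltr_pXn2r _ 2)// ?nnegrE ?(ltW e0)//.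
  rewrite -(ltr_pM2l c0); apply: (le_lt_trans (ucau _ _)).
  have Nn : (N <= n)%N by near: n; exists N.
  have e20 : 0 < c * e ^+ 2 by rewrite mulr_gt0// exprn_gt0.
  have hN : N.+1%:R^-1 < c * e ^+ 2 / 4.
    rewrite -[ltRHS]invrK ltf_pV2 ?posrE ?invr_gt0 ?divr_gt0// invf_div.
    by rewrite truncnS_gt.
  have hn : n.+1%:R^-1 <= N.+1%:R^-1 :> R by rewrite lef_pV2 ?posrE// ler_nat.
  move: hN hn; move: (c * _) (N.+1%:R^-1) (n.+1%:R^-1) => r0 r1 r2; lra.
have [v uv] : exists v : V, u n @[n --> \oo] --> v by exists (limn u).
exists v => w; pose g := a w w + 1.
have aww : 0 <= a w w by apply: le_trans (coer w); rewrite mulr_ge0 ?sqr_ge0// ltW.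
have g0 : 0 < g by rewrite /g; lra.
(* Discriminant inequality, taken at [t = - b / g]. Using [g = a w w + 1] in place of [a w w] avoids
   a division by zero. *)
have quad (p b r : R) : 0 <= r -> r < g ->
    (forall t, - p <= 2 * t * b + t ^+ 2 * r) -> b ^+ 2 <= g * p.
  move=> r0 rg /(_ (- b / g)) h.
  have e1 : g * (2 * (- b / g) * b + (- b / g) ^+ 2 * r) = - 2 * b ^+ 2 + b ^+ 2 * (r / g).
    by field; rewrite gt_eqF.
  have rg1 : r / g <= 1 by rewrite ler_pdivrMr// mul1r ltW.
  have h2 : b ^+ 2 * (r / g) <= b ^+ 2 by rewrite ler_piMr ?sqr_ge0.
  by move: h; rewrite -(ler_pM2l g0) e1; lra.
have Jbound n : (a (u n) w - l w) ^+ 2 <= g * n.+1%:R^-1.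
  apply: (quad _ _ (a w w)) => //; first by rewrite /g ltrDl.
  move=> t; have := mJ (u n + t *: w); have := hu n.
  by rewrite /J !(aDl, aDr, aZl, aZr, lD, lZ) (aC w (u n)); move: (n.+1%:R^-1) => r; lra.
have Abound d : (a d w) ^+ 2 <= g * (Ca * `|d| ^+ 2).
  apply: (quad _ _ (a w w)) => //; first by rewrite /g ltrDl.
  move=> t; apply: (@le_trans _ _ (- a d d)); first by rewrite lerN2.
  have : 0 <= a (d + t *: w) (d + t *: w).
    by apply: le_trans (coer _); rewrite mulr_ge0 ?sqr_ge0// ltW.
  by rewrite !(aDl, aDr, aZl, aZr) (aC w d); lra.
apply/eqP; rewrite -subr_eq0 -sqrf_eq0 eq_le sqr_ge0 andbT.
apply/ler_addgt0Pr => e e0; rewrite add0r.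
have uv2 : 2 * g * (Ca * `|v - u n| ^+ 2 + n.+1%:R^-1) @[n --> \oo] --> (0 : R).
  rewrite [X in _ --> X](_ : _ = 2 * g * (Ca * 0 ^+ 2 + 0)); last by ring.
  apply: cvgMr; apply: cvgD; last exact: cvg_harmonic.
  apply: cvgMr; rewrite expr2; under eq_fun do rewrite expr2.
  have uv0 : `|v - u n| @[n --> \oo] --> (0 : R).
    by apply/norm_cvg0P; rewrite -[X in _ --> X](subrr v); apply: cvgB => //; exact: cvg_cst.
  by apply: cvgM.
have [n _ hn] := cvgr0_norm_le _ uv2 _ e0.
apply: (le_trans _ (le_trans (ler_norm _) (hn n (leqnn n)))) => /=.
have -> : a v w - l w = a (v - u n) w + (a (u n) w - l w).
  by rewrite -(scaleN1r (u n)) aDl aZl; ring.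
have := Jbound n; have := Abound (v - u n).
set A1 := a (v - u n) w; set A2 := a (u n) w - l w.
have := sqr_ge0 (A1 - A2); move: (n.+1%:R^-1) (`|v - u n| ^+ 2) => r d; lra.
Unshelve. all: by end_near. Qed.

End LaxMilgram.

Section Riesz.
Context {R : realType} {H : hilbertType R}.

(** The inner product is itself a coercive symmetric form, with both constants equal to 1. *)
Lemma riesz (l : H -> R) (C : R) :
  (forall x y, l (x + y) = l x + l y) -> (forall k x, l (k *: x) = k * l x) ->
  (forall x, `|l x| <= C * `|x|) -> exists z, forall x, '[x, z] = l x.
Proof.
move=> lD lZ lb.
have [] := @lax_milgram R H (@inner R H) l 1 1 C _ _ _ _ _ _ lD lZ lb.
- exact: innerDr.
- exact: innerZr.
- exact: innerC.
- exact: ltr01.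
- by move=> v; rewrite inner_norm mul1r.
- by move=> v; rewrite inner_norm mul1r.
- by move=> z hz; exists z => x; rewrite innerC.
Qed.

(** Riesz representation makes the set behind [adjoint] nonempty, so that [get] returns one of its
    elements. *)
Lemma adjointP (L : {linear H -> H}) x y : bounded_op L ->
  '[x, adjoint L y] = '[L x, y].
Proof.
move=> /bounded_nearP[K K0 hK]; rewrite /adjoint; set S := [set z | _].
suff : S (get S) by move=> ->.
apply: getPex; have [] := @riesz (fun x => '[L x, y]) (K * `|y|) _ _ _.
- by move=> u v; rewrite linearD innerDl.
- by move=> k u; rewrite linearZ innerZl.
- move=> u; apply: (le_trans (abs_inner_le _ _)).
  by rewrite mulrAC ler_wpM2r.
- by move=> z hz; exists z => u; rewrite hz.
Qed.

End Riesz.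

(** * Calculus for Hilbert space valued functions *)

Section Calculus.
Context {R : realType} {H : hilbertType R}.
Implicit Types (X Y : R -> H) (t s : R).

Lemma is_derive_cvgP (W : normedModType R) (X : R -> W) t (y : W) :
  is_derive t 1 X y <-> h^-1 *: (X (h + t) - X t) @[h --> 0^'] --> y.
Proof.
have E : (fun h : R => h^-1 *: ((X \o shift t) (h *: 1) - X t)) =
    (fun h => h^-1 *: (X (h + t) - X t)).
  by apply/funext => h /=; rewrite [h *: 1]mulr1.
split=> [[dX <-]|hX].
  by move: dX; rewrite /derivable /derive E => /cvg_ex[l hl]; rewrite (cvg_lim _ hl).
apply: DeriveDef; first by rewrite /derivable E; apply/cvg_ex; exists y.
by rewrite /derive E; apply/cvg_lim.
Qed.

(** Division-free form of differentiability, whose remainder bound survives limits of sequences of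
    functions. *)
Lemma is_derive_epsP (W : normedModType R) (X : R -> W) t (y : W) :
  is_derive t 1 X y <-> forall e : R, 0 < e ->
    \forall s \near t, `|X s - X t - (s - t) *: y| <= e * `|s - t|.
Proof.
rewrite is_derive_cvgP; split => [/cvgrPdist_le hX e e0|hX].
  have := hX e e0; rewrite near_withinE near_nbhs => /nbhs_ballP[d/= d0 hd].
  apply/nbhs_ballP; exists d => // s /=; rewrite /ball/= => ts.
  have [->|st] := eqVneq s t; first by rewrite !subrr scale0r subrr !normr0 mulr0.
  have st0 : s - t != 0 by rewrite subr_eq0.
  have := hd (s - t); rewrite /= /ball/= sub0r normrN distrC ts => /(_ isT st0).
  rewrite subrK => h.
  rewrite (_ : X s - X t - _ = (s - t) *: ((s - t)^-1 *: (X s - X t) - y)).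
    by rewrite normrZ (distrC t s) mulrC ler_wpM2r// distrC.
  by rewrite scalerBr scalerA mulfV// scale1r.
apply/cvgrPdist_le => e e0; have := hX e e0 => /nbhs_ballP[d/= d0 hd].
rewrite near_withinE; apply/nbhs_ballP; exists d => // h /=; rewrite /ball/=.
rewrite sub0r normrN => hd0 h0.
have := hd (h + t); rewrite /ball/= opprD addrCA subrr addr0 normrN => /(_ hd0).
rewrite addrK => hle.
rewrite (_ : y - _ = - (h^-1 *: (X (h + t) - X t - h *: y))).
  by rewrite normrN normrZ normfV mulrC ler_pdivrMr ?normr_gt0.
by rewrite [in RHS]scalerBr scalerA mulVf// scale1r opprB.
Qed.

Lemma is_derive_continuous (W : normedModType R) (X : R -> W) t (y : W) :
  is_derive t 1 X y -> {for t, continuous X}.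
Proof.
by move=> [dX _]; apply/differentiable_continuous; rewrite -derivable1_diffP.
Qed.

Lemma is_derive_inner X Y t (x y : H) : is_derive t 1 X x -> is_derive t 1 Y y ->
  is_derive t 1 (fun s => '[X s, Y s] : R) ('[x, Y t] + '[X t, y]).
Proof.
move=> dX dY; have cY := is_derive_continuous dY.
move/is_derive_cvgP : dX => dX; move/is_derive_cvgP : dY => dY.
apply/is_derive_cvgP.
rewrite (_ : (fun h : R => _) = (fun h => '[h^-1 *: (X (h + t) - X t), Y (h + t)]
    + '[X t, h^-1 *: (Y (h + t) - Y t)])); last first.
  by apply/funext => h; rewrite !innerE/= /GRing.scale/=; ring.
apply: cvgD; apply: cvg_inner => //; last exact: cvg_cst.
have ht : h + t @[h --> 0^'] --> t.
  rewrite -[X in _ --> X]add0r; apply: cvgD; last exact: cvg_cst.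
  exact: nbhs_dnbhs.
exact: (cvg_comp _ _ ht cY).
Qed.

Lemma is_derive_innerr (x : H) Y t (y : H) : is_derive t 1 Y y ->
  is_derive t 1 (fun s => '[x, Y s] : R) '[x, y].
Proof.
move=> dY; have := @is_derive_inner (cst x) Y t 0 y (is_derive_cst _ _ _) dY.
by rewrite inner0l add0r.
Qed.

Lemma is_derive_lip (W W' : normedModType R) (L : {linear W -> W'}) (X : R -> W) t (y : W) :
  continuous L -> is_derive t 1 X y -> is_derive t 1 (L \o X) (L y).
Proof.
move=> cL /is_derive_cvgP dX; apply/is_derive_cvgP.
under eq_fun do rewrite /= -linearB -linearZ.
exact: (cvg_comp _ _ dX (cL _)).
Qed.

Lemma MVT_dist (f df : R -> R) (t0 t : R) :
  (forall s, `|s - t0| <= `|t - t0| -> is_derive s 1 f (df s)) ->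
  exists2 s, `|s - t0| <= `|t - t0| & f t - f t0 = df s * (t - t0).
Proof.
move=> dfs; have [tt|tt] := leP t0 t.
  have sub s : s \in `[t0, t]%R -> `|s - t0| <= `|t - t0|.
    rewrite in_itv/= => /andP[s1 s2].
    by rewrite !ger0_norm ?subr_ge0// lerB.
  have [||s st e] := @MVT_segment R f df t0 t tt.
  - by move=> x xt; apply/dfs/sub; apply: subset_itv_oo_cc xt.
  - by apply: derivable_within_continuous => x /sub/dfs[].
  - by exists s => //; exact: sub.
have sub s : s \in `[t, t0]%R -> `|s - t0| <= `|t - t0|.
  rewrite in_itv/= => /andP[s1 s2].
  by rewrite !ler0_norm ?subr_le0 ?(ltW tt)// lerN2 lerB.
have [||s st e] := @MVT_segment R f df t t0 (ltW tt).
- by move=> x xt; apply/dfs/sub; apply: subset_itv_oo_cc xt.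
- by apply: derivable_within_continuous => x /sub/dfs[].
- by exists s; [exact: sub|rewrite -opprB e -mulrN opprB].
Qed.

(** Testing with the remainder [D] itself reduces the vector inequality to the scalar mean value
    theorem. *)
Lemma mean_value_weak X Y (t0 t e : R) (c : H) : 0 <= e ->
  (forall s x, `|s - t0| <= `|t - t0| ->
     is_derive s 1 (fun s => '[x, X s] : R) '[x, Y s]) ->
  (forall s, `|s - t0| <= `|t - t0| -> `|Y s - c| <= e) ->
  `|X t - X t0 - (t - t0) *: c| <= e * `|t - t0|.
Proof.
move=> e0 dX Yc; set D := X t - _ - _.
have [|s st hs] := @MVT_dist (fun s => '[D, X s] - s * '[D, c])
    (fun s => '[D, Y s] - '[D, c]) t0 t.
  move=> s st; apply: is_deriveB; first exact: dX.
  rewrite -[X in is_derive _ _ _ X]mul1r.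
  rewrite (_ : (fun _ => _) = (fun s => '[D, c] * id s)); last by apply/funext => ?; rewrite mulrC.
  by apply: is_derive_eq; rewrite /GRing.scale/= mulr1 mul1r.
have DD : '[D, D] = '[D, Y s - c] * (t - t0).
  rewrite innerBr -hs {2}/D !innerE; ring.
have [D0|D0] := eqVneq D 0; first by rewrite D0 normr0 mulr_ge0.
rewrite -(@ler_pM2l _ `|D|) ?normr_gt0//.
have -> : `|D| * `|D| = `|'[D, D]| by rewrite ger0_norm ?inner_ge0// inner_norm expr2.
rewrite DD normrM mulrA ler_wpM2r//.
by apply: (le_trans (abs_inner_le _ _)); rewrite ler_wpM2l// Yc.
Qed.

Lemma mean_value X Y (t0 t e : R) (c : H) : 0 <= e ->
  (forall s, `|s - t0| <= `|t - t0| -> is_derive s 1 X (Y s)) ->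
  (forall s, `|s - t0| <= `|t - t0| -> `|Y s - c| <= e) ->
  `|X t - X t0 - (t - t0) *: c| <= e * `|t - t0|.
Proof.
move=> e0 dX; apply: mean_value_weak => // s x st.
by apply: is_derive_innerr; exact: dX.
Qed.

(** The weak mean value bound with [c = Y t] holds uniformly in the test vector, so a continuous
    weak derivative is a norm derivative. Weak integrals are differentiated this way. *)
Lemma weak_is_derive X Y : continuous Y ->
  (forall s x, is_derive s 1 (fun s => '[x, X s] : R) '[x, Y s]) ->
  forall t, is_derive t 1 X (Y t).
Proof.
move=> cY dX t; apply/is_derive_epsP => e e0.
have /cvgrPdist_le/(_ e e0)/nbhs_ballP[d/= d0 hd] := cY t.
apply/nbhs_ballP; exists d => // s /=; rewrite /ball/= => ts.
apply: mean_value_weak (ltW e0) _ _ => //; last first.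
  move=> r rs; rewrite distrC; apply: hd; rewrite /ball/= distrC.
  by apply: le_lt_trans rs _; rewrite distrC.
Qed.

Lemma cvg_norm_le (W : normedModType R) (u : nat -> W) (l : W) (e : R) :
  u n @[n --> \oo] --> l -> (\forall n \near \oo, `|u n| <= e) -> `|l| <= e.
Proof.
move=> ul ue; have nl : `|u n| @[n --> \oo] --> `|l| by exact: cvg_norm.
by rewrite -(cvg_lim _ nl)//; apply: limr_le => //; exact: cvgP nl.
Qed.

(** For fixed [s] the mean value remainder of [X_ n] is at most [e |s - t|] for large [n], and this
    closed bound passes to the pointwise limit. *)
Lemma is_derive_limit (X_ Y_ : nat -> R -> H) X Y :
  (forall n t, is_derive t 1 (X_ n) (Y_ n t)) ->
  (forall t, X_ n t @[n --> \oo] --> X t) ->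
  (forall T e, 0 < e -> \forall n \near \oo, forall t, `|t| <= T -> `|Y_ n t - Y t| <= e) ->
  continuous Y -> forall t, is_derive t 1 X (Y t).
Proof.
move=> dX cX cYn cY t; apply/is_derive_epsP => e e0.
have e20 : 0 < e / 2 by rewrite divr_gt0.
have /cvgrPdist_le/(_ _ e20)/nbhs_ballP[d/= d0 hd] := cY t.
apply/nbhs_ballP; exists d => // s /=; rewrite /ball/= => ts.
have h1 : \forall n \near \oo, `|X_ n s - X_ n t - (s - t) *: Y t| <= e * `|s - t|.
  near=> n; apply: (@mean_value _ (Y_ n)) (ltW e0) _ _ => // r rs.
  rewrite (_ : _ - _ = (Y_ n r - Y r) + (Y r - Y t)); last by rewrite addrA subrK.
  rewrite (le_trans (ler_normD _ _))// [leRHS](splitr e) lerD//; last first.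
    rewrite distrC; apply: hd; rewrite /ball/= distrC.
    by apply: le_lt_trans rs _; rewrite distrC.
  have rT : `|r| <= `|t| + d.
    have -> : r = t + (r - t) by rewrite addrC subrK.
    rewrite (le_trans (ler_normD _ _))// lerD2l.
    by apply: (le_trans rs); rewrite distrC ltW.
  by move: r rT {rs}; near: n; exact: cYn.
have h2 : (X_ n s - X_ n t - (s - t) *: Y t) @[n --> \oo] --> X s - X t - (s - t) *: Y t.
  by apply: cvgB; [apply: cvgB; exact: cX|exact: cvg_cst].
exact: cvg_norm_le h2 h1.
Unshelve. all: by end_near. Qed.

Lemma is_derive_opparg (W : normedModType R) (X : R -> W) t (y : W) :
  is_derive (- t) 1 X y -> is_derive t 1 (X \o -%R) (- y).
Proof.
move=> dX; apply/is_derive_epsP => e e0.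
move/is_derive_epsP: dX => /(_ e e0)/nbhs_ballP[d/= d0 hd].
apply/nbhs_ballP; exists d => // r; rewrite /ball/= => sr.
have := hd (- r); rewrite /ball/= -opprD normrN => /(_ sr).
have -> : - r - - t = - (r - t) by rewrite opprB opprK addrC.
by rewrite normrN scaleNr scalerN.
Qed.

Lemma is_derive_subarg (W : normedModType R) (X : R -> W) t a (y : W) :
  is_derive (t - a) 1 X y -> is_derive t 1 (fun s => X (s - a)) y.
Proof.
move=> /is_derive_cvgP dX; apply/is_derive_cvgP.
by under eq_fun do rewrite -addrA.
Qed.

(** For positive times [<x, X t> - |x| (N / l) e^(l t)] is nonincreasing; negative times follow by
    reflection. The gain [1 / l] turns a Lipschitz bound into a contraction. *)
Lemma exp_growth X Y (l N : R) (T : R) : 0 < l -> 0 <= N -> X 0 = 0 ->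
  (forall t, is_derive t 1 X (Y t)) ->
  (forall t, `|t| <= T -> `|Y t| <= N * expR (l * `|t|)) ->
  forall t, `|t| <= T -> `|X t| <= N / l * expR (l * `|t|).
Proof.
move=> l0 N0 X0.
wlog suff : X Y X0 / (forall t, is_derive t 1 X (Y t)) ->
  (forall t, `|t| <= T -> `|Y t| <= N * expR (l * `|t|)) ->
  forall t, 0 <= t -> t <= T -> `|X t| <= N / l * expR (l * t).
  move=> Hw dX hY t tT; have [t0|t0] := leP 0 t.
    by rewrite ger0_norm//; apply: (Hw X Y) => //; rewrite -(ger0_norm t0).
  rewrite ltr0_norm//.
  rewrite -[X t](_ : (X \o -%R) (- t) = _); last by rewrite /= opprK.
  apply: (Hw _ (fun s => - Y (- s))) => //=.
  - by rewrite oppr0.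
  - by move=> s; exact: is_derive_opparg.
  - by move=> s sT; rewrite normrN -(normrN s) hY// normrN.
  - by rewrite oppr_ge0 ltW.
  - by rewrite -ltr0_norm.
move=> dX hY t t0 tT; apply: norm_le_inner; first by rewrite mulr_ge0 ?expR_ge0// divr_ge0// ltW.
move=> x.
pose f s := '[x, X s] - `|x| * (N / l) * expR (l * s).
have df s : is_derive s 1 f ('[x, Y s] - `|x| * (N / l) * (expR (l * s) * l)).
  apply: is_deriveB; first exact: is_derive_innerr.
  apply: is_deriveZ; apply: (@is_derive1_comp _ expR ( *%R l)).
  rewrite -[X in is_derive _ _ _ X]mulr1; exact: is_deriveZ.
have : f t <= f 0.
  apply: (@ler0_derive1_nincr _ f 0 T) => //.
  - move=> s; rewrite in_itv/= => /andP[s0 sT].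
    rewrite derive1E derive_val subr_le0.
    apply: (le_trans (inner_le_norm _ _)); rewrite -!mulrA ler_wpM2l//.
    have := hY s; rewrite gtr0_norm// => /(_ (ltW sT)).
    by rewrite [expR _ * l]mulrC mulKf ?gt_eqF.
  - by apply: derivable_within_continuous => s _; have [] := df s.
rewrite /f X0 inner0r mulr0 expR0 mulr1 sub0r lerBlDl => /le_trans; apply.
by rewrite [leRHS]mulrA lerBlDr lerDl !mulr_ge0// invr_ge0 ltW.
Qed.

End Calculus.

(** * Fixed points of maps that contract in a weighted norm on each set of a cover of the line *)

Section Volterra.
Context {R : realType} {H : hilbertType R}.
Variables (Phi : (R -> H) -> R -> H) (I : R -> set R) (w : R -> R).
Hypothesis Icover : forall t, exists T, nbhs (t : R) (I T).
Hypothesis w0 : forall t, 0 <= w t.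
Hypothesis wI : forall T, exists W, forall t, I T t -> w t <= W.
Hypothesis Phi_cont : forall u, continuous u -> continuous (Phi u).
Hypothesis Phi_contr : forall T u v (M : R), continuous u -> continuous v -> 0 <= M ->
  (forall t, I T t -> `|u t - v t| <= M * w t) ->
  forall t, I T t -> `|Phi u t - Phi v t| <= M / 2 * w t.

(** Each application of [Phi] halves the weighted distance of two fixed points, provided it is
    finite to begin with. *)
Lemma volterra_unique (u v : R -> H) T (M : R) : continuous u -> continuous v -> 0 <= M ->
  Phi u = u -> Phi v = v -> (forall t, I T t -> `|u t - v t| <= M * w t) ->
  forall t, I T t -> u t = v t.
Proof.
move=> cu cv M0 fu fv uv t It; apply/eqP; rewrite -subr_eq0 -normr_eq0 eq_le normr_ge0 andbT.
have h n : forall t, I T t -> `|u t - v t| <= M / 2 ^+ n * w t.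
  elim: n => [s Is|n IH s Is]; first by rewrite expr0 divr1 uv.
  rewrite -fu -fv exprSr invfM mulrA; apply: (Phi_contr cu cv _ IH) => //.
  by rewrite divr_ge0// exprn_ge0.
have h2 : M / 2 ^+ n * w t @[n --> \oo] --> (0 : R).
  rewrite -(mul0r (w t)); apply: cvgMl; rewrite -(mulr0 M); apply: cvgMr.
  by under eq_fun do rewrite -exprVn; apply: cvg_expr; rewrite ger0_norm ?invf_lt1 ?invr_ge0// ltr1n.
by rewrite -(cvg_lim _ h2)//; apply: limr_ge; [exact: cvgP h2|exists 0%N => // n _; exact: h].
Qed.

Hypothesis Phi0 : forall T, exists2 M : R, 0 <= M & forall t, I T t -> `|Phi (cst 0) t| <= M * w t.

(** Picard iteration from 0: on each [I T] the iterates converge uniformly, whence continuity, and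
    the geometric series gives the factor 2. The sets are [|t| <= T] for the differential equation
    and [t <= T] for the mild problem. *)
Lemma volterra_exists : exists u : R -> H, [/\ continuous u, Phi u = u &
  forall T (M : R), 0 <= M -> (forall t, I T t -> `|Phi (cst 0) t| <= M * w t) ->
  forall t, I T t -> `|u t| <= 2 * M * w t].
Proof.
pose U n := iter n Phi (cst 0).
have cU n : continuous (U n).
  by elim: n => [|n IH]; [exact: cst_continuous|exact: Phi_cont].
have step T M : 0 <= M -> (forall t, I T t -> `|Phi (cst 0) t| <= M * w t) ->
    forall n t, I T t -> `|U n.+1 t - U n t| <= M / 2 ^+ n * w t.
  move=> M0 hM; elim=> [t It|n IH t It].
    by rewrite expr0 divr1 /U/= /cst subr0 hM.
  rewrite exprSr invfM mulrA; apply: (Phi_contr (cU n.+1) (cU n) _ IH) => //.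
  by rewrite divr_ge0// exprn_ge0.
(* Keeping the exact partial sum [1 - 2^-k] of the geometric series makes the induction close. *)
have diff T M : 0 <= M -> (forall t, I T t -> `|Phi (cst 0) t| <= M * w t) ->
    forall n k t, I T t -> `|U (n + k)%N t - U n t| <= 2 * M / 2 ^+ n * w t * (1 - 2^-1 ^+ k).
  move=> M0 hM n; elim=> [t It|k IH t It].
    by rewrite addn0 !subrr normr0 mulr0.
  rewrite (_ : _ - _ = (U (n + k).+1 t - U (n + k)%N t) + (U (n + k)%N t - U n t)); last first.
    by rewrite addnS addrA subrK.
  rewrite (le_trans (ler_normD _ _))//.
  apply: le_trans (lerD (step _ _ M0 hM _ _ It) (IH _ It)) _.
  rewrite exprD exprS exprVn le_eqVlt; apply/orP; left; apply/eqP.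
  field. by rewrite !expf_neq0.
have diff' T M : 0 <= M -> (forall t, I T t -> `|Phi (cst 0) t| <= M * w t) ->
    forall n k t, (n <= k)%N -> I T t -> `|U k t - U n t| <= 2 * M / 2 ^+ n * w t.
  move=> M0 hM n k t nk It; rewrite -(subnKC nk).
  apply: (le_trans (diff _ _ M0 hM _ _ _ It)); rewrite ler_piMr//.
  by rewrite !mulr_ge0// invr_ge0 exprn_ge0.
have geo (a : R) : a / 2 ^+ n @[n --> \oo] --> (0 : R).
  rewrite -(mulr0 a); apply: cvgMr.
  by under eq_fun do rewrite -exprVn; apply: cvg_expr; rewrite ger0_norm ?invf_lt1 ?invr_ge0// ltr1n.
have small T e : 0 < e -> exists n0 : nat, forall n k t, (n0 <= n)%N -> (n <= k)%N -> I T t ->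
    `|U k t - U n t| <= e.
  move=> e0; have [M M0 hM] := Phi0 T; have [W hW] := wI T.
  have [n0 _ hn] := cvgr0_norm_le _ (geo (2 * M * W)) _ e0.
  exists n0 => n k t n0n nk It; apply: (le_trans (diff' _ _ M0 hM _ _ _ nk It)).
  apply: le_trans (le_trans (ler_norm _) (hn n n0n)) => /=.
  rewrite mulrAC ler_wpM2r ?invr_ge0 ?exprn_ge0//.
  by rewrite ler_wpM2l ?mulr_ge0// hW.
have Ucvg t : cvg (U n t @[n --> \oo]).
  have [T /nbhs_singleton It] := Icover t.
  apply/cauchy_cvgP/cauchy_exP => e e0.
  have e20 : 0 < e / 2 by rewrite divr_gt0.
  have [n0 hn0] := small T _ e20.
  exists (U n0 t); suff : \forall n \near \oo, `|U n0 t - U n t| < e by rewrite -ball_normE.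
  exists n0 => // n /= n0n; rewrite distrC (le_lt_trans (hn0 _ _ _ (leqnn _) n0n It))//.
  by rewrite ltr_pdivrMr// ltr_pMr// ltr1n.
pose u t := limn (U ^~ t).
have Uu t : U n t @[n --> \oo] --> u t by exact: Ucvg.
have lim_le n0 n t (e : R) : (forall k, (n0 <= k)%N -> `|U k t - U n t| <= e) -> `|u t - U n t| <= e.
  move=> h; have h2 : U k t - U n t @[k --> \oo] --> u t - U n t.
    by apply: cvgB; [exact: Uu|exact: cvg_cst].
  by apply: cvg_norm_le h2 _; exists n0.
have cu : continuous u.
  move=> t; have [T IT] := Icover t; apply/cvgrPdist_le => e e0.
  have e30 : 0 < e / 3 by rewrite divr_gt0.
  have [n0 hn0] := small T _ e30.
  have hu s : I T s -> `|u s - U n0 s| <= e / 3.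
    by move=> Is; apply: (lim_le n0) => k n0k; apply: hn0.
  have It := nbhs_singleton IT; have /cvgrPdist_le/(_ _ e30) := cU n0 t.
  apply: filterS2 IT => s Is ts.
  rewrite (_ : _ - _ = (u t - U n0 t) + (U n0 t - U n0 s) - (u s - U n0 s)).
    rewrite (_ : e = e / 3 + e / 3 + e / 3); last by field.
    rewrite (le_trans (ler_normB _ _))// lerD ?hu//.
    by rewrite (le_trans (ler_normD _ _))// lerD ?hu.
  by rewrite [in RHS]addrA subrK opprB addrA subrK.
have fu : Phi u = u.
  apply/funext => t; have [T /nbhs_singleton It] := Icover t.
  have [M M0 hM] := Phi0 T.
  have hu n s : I T s -> `|u s - U n s| <= 2 * M / 2 ^+ n * w s.
    by move=> Is; apply: (lim_le n) => k nk; apply: diff' hM _ _ _ nk Is.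
  apply/eqP; rewrite -subr_eq0 -normr_eq0 eq_le normr_ge0 andbT.
  apply/ler_addgt0Pr => e e0; rewrite add0r.
  have [n0 _ hn] := cvgr0_norm_le _ (geo (2 * M * w t)) _ e0.
  apply: le_trans (le_trans (ler_norm _) (hn n0 (leqnn _))) => /=.
  rewrite (_ : _ - _ = (Phi u t - Phi (U n0) t) - (u t - U n0.+1 t)); last first.
    by rewrite opprB addrA subrK.
  rewrite (le_trans (ler_normB _ _))//.
  have h1 : 0 <= 2 * M / 2 ^+ n0 by rewrite !mulr_ge0// invr_ge0 exprn_ge0.
  apply: (le_trans (lerD (Phi_contr cu (cU n0) h1 (hu n0) It) (hu n0.+1 _ It))).
  rewrite exprS invfM le_eqVlt; apply/orP; left; apply/eqP; field.
  by rewrite expf_neq0.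
exists u; split=> // T M M0 hM t It.
rewrite -[u t]subr0; apply: (lim_le 0%N 0%N) => k _.
by have := diff' _ _ M0 hM 0%N k t (leq0n _) It; rewrite expr0 divr1.
Qed.

End Volterra.

(** * Weak measurability and weak integrals *)

Section DenseSequence.
Context {R : realType} {H : hilbertType R}.

Lemma separable_seq : separable H -> exists d : nat -> H,
  forall (x : H) (e : R), 0 < e -> exists n, `|x - d n| < e.
Proof.
move=> [S /countable_injP[f finj] dS].
(* Codes that are not attained receive the dummy value 0. *)
pose d n := xget 0 [set y | S y /\ f y = n].
exists d => x e e0.
have [|z [bz Sz]] := dS (ball x e) _ (ball_open x e).
  by exists x; exact: ballxx.
exists (f z); rewrite /d; case: xgetP => [y _ [Sy fyz]|/(_ z)]; last by case.
by move: bz; rewrite -(finj _ _ (mem_set Sy) (mem_set Sz) fyz) -ball_normE.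
Qed.

End DenseSequence.

Section WeakMeasurability.
Context {d : measure_display} {T : measurableType d} {R : realType} {H : hilbertType R}.
Implicit Types F G : T -> H.

(** Weak measurability involves real functions only; on the line and for separable [H] it agrees
    with [borel_fun], by [borel_wmeas] and [wmeas_borel]. *)
Definition wmeas F := forall x : H, measurable_fun setT (fun t => '[x, F t] : R).

Lemma wmeas_cst (x : H) : wmeas (fun=> x).
Proof. by move=> y; exact: measurable_cst. Qed.

Lemma wmeasD F G : wmeas F -> wmeas G -> wmeas (fun t => F t + G t).
Proof.
move=> mF mG x; under eq_fun do rewrite innerDr.
exact: (measurable_funD (mF x) (mG x)).
Qed.

Lemma wmeasB F G : wmeas F -> wmeas G -> wmeas (fun t => F t - G t).
Proof.
move=> mF mG x; under eq_fun do rewrite innerBr.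
exact: (measurable_funB (mF x) (mG x)).
Qed.

Lemma wmeas_if (b : T -> bool) F G : measurable_fun setT b -> wmeas F -> wmeas G ->
  wmeas (fun t => if b t then F t else G t).
Proof.
move=> mb mF mG x.
rewrite (_ : (fun _ => _) = (fun t => if b t then '[x, F t] else '[x, G t])).
  exact: measurable_fun_ifT.
by apply/funext => t; case: ifP.
Qed.

Lemma wmeas_norm F : separable H -> wmeas F -> measurable_fun setT (fun t => `|F t|).
Proof.
move=> /separable_seq[D hD] mF _.
apply: (measurability _ (RGenOInfty.measurableE R)) => //.
move=> /= _ [_ [r ->] <-]; rewrite setTI preimage_itvoy.
have [r0|r0] := leP 0 r; last first.
  rewrite [X in measurable X](_ : _ = setT) //; apply/seteqP; split=> // t _ /=.
  exact: lt_le_trans r0 _.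
rewrite [X in measurable X](_ : _ =
  \bigcup_n [set t | r ^+ 2 + `|D n| ^+ 2 < 2 * '[D n, F t]]); last first.
  apply/seteqP; split => t /=.
    move=> rF; pose e := (`|F t| ^+ 2 - r ^+ 2).
    have e0 : 0 < e by rewrite subr_gt0 ltrXn2r// ?gt_eqF.
    have se0 : 0 < Num.sqrt e by rewrite sqrtr_gt0.
    have [n hn] := hD (F t) _ se0; exists n => //=.
    have : `|F t - D n| ^+ 2 < e.
      by rewrite -[ltRHS]sqr_sqrtr ?ltW// ltrXn2r// sqrtr_ge0.
    by rewrite normB2 innerC /e; lra.
  move=> [n _ /=]; have := sqr_ge0 `|F t - D n|; rewrite normB2 innerC => h1 h2.
  by rewrite -(@ltr_pXn2r _ 2)// ?nnegrE//; lra.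
apply: bigcupT_measurable => n.
rewrite (_ : [set _ | _] = setT `&` (fun t => '[D n, F t]) @^-1` `](r ^+ 2 + `|D n| ^+ 2) / 2, +oo[).
  by apply: mF.
by rewrite setTI; apply/seteqP; split=> t /=; rewrite in_itv/= andbT ltr_pdivrMr// mulrC.
Qed.

Lemma wmeas_inner F G : separable H -> wmeas F -> wmeas G ->
  measurable_fun setT (fun t => '[F t, G t] : R).
Proof.
move=> sH mF mG; under eq_fun do rewrite inner_polar.
apply: measurable_funM => //.
apply: measurable_funB; apply: measurable_funX.
  exact: wmeas_norm (wmeasD mF mG).
exact: wmeas_norm (wmeasB mF mG).
Qed.

End WeakMeasurability.

Section WeakMeasurabilityComp.
Context {d d' : measure_display} {T : measurableType d} {T' : measurableType d'}.
Context {R : realType} {H : hilbertType R}.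

Lemma wmeas_comp (g : T -> T') (F : T' -> H) : measurable_fun setT g -> wmeas F ->
  wmeas (F \o g).
Proof. by move=> mg mF x; exact: (measurableT_comp (mF x) mg). Qed.

(** Symmetry moves [L t] onto the test vector, which leaves the inner product of two weakly
    measurable functions. *)
Lemma wmeas_operator (L : T -> H -> H) (F : T -> H) : separable H ->
  (forall t x y, '[x, L t y] = '[L t x, y]) -> (forall x, wmeas (L ^~ x)) ->
  wmeas F -> wmeas (fun t => L t (F t)).
Proof.
move=> sH Lsym mL mF x; under eq_fun do rewrite Lsym.
exact: wmeas_inner.
Qed.

Lemma wmeas_bounded (L : {linear H -> H}) (F : T -> H) : bounded_op L ->
  wmeas F -> wmeas (fun t => L (F t)).
Proof.
move=> bL mF x; under eq_fun do rewrite innerC -adjointP// innerC.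
exact: mF.
Qed.

End WeakMeasurabilityComp.

Section Borel.
Context {R : realType} {H : hilbertType R}.
Implicit Types F : R -> H.

Lemma wmeas_continuous F : continuous F -> wmeas F.
Proof.
move=> cF x; apply: continuous_measurable_fun.
by apply: continuous_inner => //; exact: cst_continuous.
Qed.

Lemma borel_wmeas F : borel_fun F -> wmeas F.
Proof.
move=> mF x; apply: (measurability _ (RGenOInfty.measurableE R)) => //.
move=> /= _ [_ [r ->] <-]; rewrite setTI preimage_itvoy.
rewrite (_ : [set _ | _] = setT `&` F @^-1` [set y | r < '[x, y]]); last by rewrite setTI.
apply: mF => //; apply: sub_sigma_algebra.
rewrite (_ : [set _ | _] = (fun y : H => '[x, y]) @^-1` [set s | r < s])//.
apply: open_comp; last exact: open_gt.
by move=> y _; apply: cvg_inner; [exact: cvg_cst|exact: cvg_id].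
Qed.

(** An open set is the union of those balls inside it whose centres lie in a dense sequence and
    whose radii are [1 / (m + 1)]; the preimage of a ball is read off from a norm. *)
Lemma wmeas_borel F : separable H -> wmeas F -> borel_fun F.
Proof.
move=> sH mF; have [D hD] := separable_seq sH.
rewrite /borel_fun => _; apply: (@measurability _ _ _ (g_sigma_algebraType (@open H)) _ _ (@open H) erefl) => //.
move=> /= _ [U oU <-]; rewrite setTI.
rewrite (_ : _ @^-1` _ = \bigcup_n \bigcup_m
  (if `[< ball (D n) m.+1%:R^-1 `<=` U >] then
   [set t | `|F t - D n| < m.+1%:R^-1] else set0)); last first.
  apply/seteqP; split=> t /=.
    move=> Ut; have /nbhs_ballP[e/= e0 eU] : nbhs (F t) U by apply: open_nbhs_nbhs.
    have e20 : 0 < e / 2 by rewrite divr_gt0.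
    have [m _ hm] := near_infty_natSinv_lt (PosNum e20).
    have := hm m (leqnn m) => /= me.
    have m0 : 0 < m.+1%:R^-1 :> R by rewrite invr_gt0.
    have [n hn] := hD (F t) _ m0; exists n => //; exists m => //.
    case: asboolP => //= -[] y; rewrite -ball_normE/= => hy; apply: eU.
    rewrite -ball_normE/= (_ : _ - y = (F t - D n) + (D n - y)); last by rewrite addrA subrK.
    by rewrite (le_lt_trans (ler_normD _ _))// [ltRHS]splitr ltrD// (lt_trans _ me).
  move=> [n _ [m _]]; case: asboolP => //= h ht; apply: h.
  by rewrite -ball_normE/= distrC.
apply: bigcupT_measurable => n; apply: bigcupT_measurable => m.
case: ifP => [_|_]; last exact: measurable0.
rewrite (_ : [set _ | _] = setT `&` (fun t => `|F t - D n|) @^-1` `]-oo, m.+1%:R^-1[).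
  by apply: (wmeas_norm sH (wmeasB mF (wmeas_cst _))).
by rewrite setTI; apply/seteqP; split=> t /=; rewrite in_itv.
Qed.

End Borel.

(** * Lebesgue integrals of real functions *)

Section RealIntegrals.
Context {R : realType}.
Local Notation mu := (@lebesgue_measure R).
Local Notation intg D f := (mu.-integrable D (EFin \o f)).
Implicit Types (f g : R -> R) (D : set R).

Lemma ae_sub (P Q : R -> Prop) : (forall t, P t -> Q t) ->
  {ae mu, forall t, P t} -> {ae mu, forall t, Q t}.
Proof. by move=> PQ; apply: filterS; first exact: (ae_filter_ringOfSetsType mu). Qed.

Lemma ae_and (P Q : R -> Prop) : {ae mu, forall t, P t} ->
  {ae mu, forall t, Q t} -> {ae mu, forall t, P t /\ Q t}.
Proof. by move=> aP aQ; apply: filterI => //; first exact: (ae_filter_ringOfSetsType mu). Qed.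

Lemma ae_all (P : nat -> R -> Prop) : (forall n, {ae mu, forall t, P n t}) ->
  {ae mu, forall t, forall n, P n t}.
Proof.
move=> aP; have /negligible_bigcup := aP.
apply: negligibleS => t /= /existsNP[n Pn].
by exists n.
Qed.

Lemma intg_le D f g : measurable D -> measurable_fun setT f ->
  (forall t, D t -> `|f t| <= g t) -> intg D g -> intg D f.
Proof.
move=> mD mf fg; apply: le_integrable => //.
  by apply/measurable_EFinP; exact: measurable_funTS.
by move=> t Dt /=; rewrite lee_fin (le_trans (fg _ Dt))// ler_norm.
Qed.

Lemma intgZ D (k : R) f : measurable D -> intg D f -> intg D (fun t => k * f t).
Proof. by move=> mD fi; have := @integrableZl _ _ _ mu D mD k _ fi. Qed.

Lemma intgD D f g : measurable D -> intg D f -> intg D g -> intg D (fun t => f t + g t).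
Proof. by move=> mD fi gi; have := @integrableD _ _ _ mu D mD _ _ fi gi. Qed.

Lemma intgB D f g : measurable D -> intg D f -> intg D g -> intg D (fun t => f t - g t).
Proof. by move=> mD fi gi; have := @integrableB _ _ _ mu D mD _ _ fi gi. Qed.

Lemma le_Rintegral_norm D f g : measurable D -> intg D f -> intg D g ->
  (forall t, D t -> `|f t| <= g t) ->
  `|\int[mu]_(t in D) f t| <= \int[mu]_(t in D) g t.
Proof.
move=> mD fi gi fg; apply: (le_trans (@le_normr_Rintegral _ _ _ mu D f mD fi)).
by apply: le_Rintegral => //; exact: integrable_norm.
Qed.

Lemma intg_continuous f a b : continuous f -> intg `[a, b] f.
Proof.
move=> cf; apply: continuous_compact_integrable; first exact: segment_compact.
exact: continuous_subspaceT.
Qed.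

Lemma Rintegral_ae_eq D f g : measurable D -> measurable_fun setT f ->
  measurable_fun setT g -> {ae mu, forall t, D t -> f t = g t} ->
  \int[mu]_(t in D) f t = \int[mu]_(t in D) g t.
Proof.
move=> mD mf mg fg; rewrite /Rintegral; congr fine; apply: ae_eq_integral => //.
- by apply/measurable_EFinP; exact: measurable_funTS.
- by apply/measurable_EFinP; exact: measurable_funTS.
- by apply: ae_sub fg => t /= h Dt; rewrite h.
Qed.

Lemma Rintegral_Ny_sub f s t : s <= t -> intg `]-oo, t] f ->
  \int[mu]_(x in `]-oo, t]) f x - \int[mu]_(x in `]-oo, s]) f x =
  \int[mu]_(x in `]s, t]) f x.
Proof. by move=> st fi; apply: Rintegral_itvB => //; rewrite bnd_simp. Qed.

Lemma continuous_Rintegral_Ny f : (forall t, intg `]-oo, t] f) ->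
  continuous (fun t => \int[mu]_(x in `]-oo, t]) f x).
Proof.
move=> fi t; pose a := t - 1; pose b := t + 1.
have ab : a < b by rewrite /a /b; lra.
have fab : intg `[a, b] f.
  by apply: integrableS (fi b) => // x /=; rewrite !in_itv/= => /andP[].
have /(continuous_within_itvP _ ab)[h _ _] := parameterized_integral_continuous (ltW ab) fab.
have ht : {for t, continuous (fun x => \int[mu]_(x in `]-oo, a]) f x + parameterized_integral mu a x f)}.
  apply: continuousD; first exact: cvg_cst.
  by apply: h; rewrite in_itv/= /a /b; lra.
have E : \forall x \near t, \int[mu]_(x in `]-oo, a]) f x + parameterized_integral mu a x f
    = \int[mu]_(y in `]-oo, x]) f y.
  have : \forall x \near t, x \in `]a, b[ by apply: near_in_itvoo; rewrite in_itv/= /a /b; lra.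
  apply: filterS => x /=; rewrite in_itv/= => /andP[ax xb].
  rewrite /parameterized_integral -(Rintegral_itv_obnd_cbnd (r := a)); last first.
    by apply: integrableS (fi b) => // y /=; rewrite !in_itv/= => /andP[_ yx]; rewrite (le_trans yx)// ltW.
  by rewrite -Rintegral_Ny_sub ?(ltW ax)// addrC subrK.
rewrite /continuous_at -(nbhs_singleton E).
by apply: cvg_trans ht; exact: near_eq_cvg.
Qed.

Lemma Rintegral_FTC f (F : R -> R) (a b : R) : a <= b -> continuous f ->
  (forall t : R, is_derive t 1 F (f t)) -> \int[mu]_(t in `[a, b]) f t = F b - F a.
Proof.
rewrite le_eqVlt => /predU1P[<-|ab] cf dF.
  by rewrite set_itv1 Rintegral_set1 subrr.
have cF t : {for t, continuous F} by exact: is_derive_continuous (dF t).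
rewrite /Rintegral (continuous_FTC2 (f := f) (F := F) ab)//.
- exact: continuous_subspaceT.
- split; first by move=> x _; case: (dF x).
  + exact: cvg_at_right_filter (cF a).
  + exact: cvg_at_left_filter (cF b).
- by move=> x _; rewrite derive1E; case: (dF x).
Qed.

(** The integral from 0 to [t] with its sign: for [t > 0] the second interval is empty, for [t < 0]
    the first. *)
Definition primitive f t := \int[mu]_(s in `[0, t]) f s - \int[mu]_(s in `[t, 0]) f s.

Lemma is_derive_primitive f : continuous f -> forall t : R, is_derive t 1 (primitive f) (f t).
Proof.
(* Integrating from [- N], strictly to the left of 0 and of [t], gives one formula valid near [t]
   for either sign. *)
move=> cf t; pose N : R := `|t| + 1.
have N0 : 0 < N by rewrite /N ltr_pwDr.
have tN : - N < t by rewrite ltrNl /N (le_lt_trans (ler_norm _))// normrN ltrDl.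
pose G x := \int[mu]_(s in `[- N, x]) f s.
have ii a b : intg `[a, b] f by exact: intg_continuous.
have [dG G'] : derivable G t 1 /\ derive1 G t = f t.
  apply: (continuous_FTC1_closed (u := t + 1)) => //; first by rewrite ltrDl.
  exact: cf.
have dG2 : is_derive t 1 (fun x => G x - G 0) (f t).
  rewrite -[f t]subr0; apply: is_deriveB.
  by apply: DeriveDef; [exact: dG|rewrite -derive1E; exact: G'].
apply: near_eq_is_derive dG2.
have : \forall x \near t, x \in `]-N, +oo[.
  by apply: near_in_itvoy; rewrite in_itv/= tN.
apply: filterS => x /=; rewrite in_itv/= andbT => Nx.
have subd u v : - N <= u -> u <= v -> G v - G u = \int[mu]_(s in `[u, v]) f s.
  move=> Nu uv; rewrite /G Rintegral_itvB ?bnd_simp// Rintegral_itv_obnd_cbnd//.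
  by apply: integrableS (ii u v) => // y /=; rewrite !in_itv/= => /andP[/ltW -> ->].
rewrite /primitive; have [x0|x0] := leP 0 x.
  rewrite subd// ?oppr_le0 ?(ltW N0)//.
  move: x0; rewrite le_eqVlt => /predU1P[<-|x0]; first by rewrite set_itv1 !Rintegral_set1 subr0.
  by rewrite [in X in _ - X]set_itv_ge ?bnd_simp -?ltNge// Rintegral_set0 subr0.
rewrite -opprB subd ?(ltW x0) ?(ltW Nx)//.
by rewrite [in X in X - _]set_itv_ge ?bnd_simp -?ltNge// Rintegral_set0 sub0r.
Qed.

(** The product majorant makes every section integrable, not only almost every one, so the [fine]
    hidden in the inner real integrals can be removed pointwise. *)
Lemma Rintegral_fubini (F : R -> R -> R) (a b : R -> R) :
  measurable_fun setT (fun p : R * R => F p.1 p.2) ->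
  intg setT a -> intg setT b -> (forall s t, `|F s t| <= a s * b t) ->
  \int[mu]_s \int[mu]_t F s t = \int[mu]_t \int[mu]_s F s t.
Proof.
move=> mF ia ib hF.
have mFs s : measurable_fun setT (F s).
  exact: (measurableT_comp mF (pair1_measurable s)).
have mFt t : measurable_fun setT (F^~ t).
  exact: (measurableT_comp mF (pair2_measurable t)).
have iFs s : intg setT (F s).
  apply: (@intg_le _ _ (fun t => a s * b t)) => //.
  exact: intgZ.
have iFt t : intg setT (F^~ t).
  apply: (@intg_le _ _ (fun s => b t * a s)) => //.
    by move=> s _; rewrite mulrC.
  exact: intgZ.
have iF : (mu \x mu)%E.-integrable setT (fun p => (F p.1 p.2)%:E).
  apply/integrable12ltyP; first exact/measurable_EFinP.
  pose B := \int[mu]_t b t.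
  apply: (@le_lt_trans _ _ (\int[mu]_s (B * a s)%:E)%E); last first.
    by apply: integrable_lty => //; exact: intgZ.
  apply: ge0_le_integral => //=.
  - by move=> s _; exact: integral_ge0.
  - apply: (@measurable_fun_fubini_tonelli_F _ _ _ _ _ mu (fun p => `|(F p.1 p.2)%:E|%E)) => //.
    by apply: measurableT_comp => //; exact/measurable_EFinP.
  - by apply/measurable_EFinP; apply: measurable_funM => //; apply/measurable_EFinP; exact: measurable_int ia.
  - move=> s _; have iab : intg setT (fun t => a s * b t) by exact: intgZ.
    rewrite (_ : (B * a s)%:E = \int[mu]_t (a s * b t)%:E)%E.
      apply: ge0_le_integral => //=.
      + by apply/measurable_EFinP; apply: measurableT_comp (mFs s).
      + exact: measurable_int iab.
      + by move=> t _; rewrite lee_fin.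
    rewrite /B mulrC -RintegralZl// /Rintegral fineK//.
    exact: integrable_fin_num.
rewrite /Rintegral.
have h1 s : (fine (\int[mu]_t (F s t)%:E))%:E = (\int[mu]_t (F s t)%:E)%E.
  by rewrite fineK//; apply: integrable_fin_num => //; exact: iFs.
have h2 t : (fine (\int[mu]_s (F s t)%:E))%:E = (\int[mu]_s (F s t)%:E)%E.
  by rewrite fineK//; apply: integrable_fin_num => //; exact: iFt.
under eq_integral do rewrite h1.
under [in RHS]eq_integral do rewrite h2.
by rewrite (Fubini iF).
Qed.

End RealIntegrals.

(** * Weak integrals of vector functions *)

Section WeakIntegral.
Context {R : realType} {H : hilbertType R}.
Local Notation mu := (@lebesgue_measure R).
Local Notation intg D f := (mu.-integrable D (EFin \o f)).
Implicit Types (F G : R -> H) (D : set R).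

(** The Pettis integral; for integrable [|F|] a representing vector exists by [riesz]. *)
Definition wint D F : H :=
  get [set w | forall x, '[x, w] = \int[mu]_(t in D) '[x, F t]].

Lemma intg_inner D F x : measurable D -> wmeas F -> intg D (fun t => `|F t|) ->
  intg D (fun t => '[x, F t]).
Proof.
move=> mD mF iF; apply: (@intg_le _ _ _ (fun t => `|x| * `|F t|)) => //.
  by move=> t _; exact: abs_inner_le.
exact: intgZ.
Qed.

Lemma wintP D F : measurable D -> wmeas F -> intg D (fun t => `|F t|) ->
  forall x, '[x, wint D F] = \int[mu]_(t in D) '[x, F t].
Proof.
move=> mD mF iF; rewrite /wint; set S := [set w | _].
suff : S (get S) by [].
have ii x := intg_inner x mD mF iF.
apply: getPex; have [] := @riesz R H (fun x => \int[mu]_(t in D) '[x, F t])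
  (\int[mu]_(t in D) `|F t|).
- by move=> x y; rewrite -RintegralD//; apply: eq_Rintegral => t _; rewrite innerDl.
- by move=> k x; rewrite -RintegralZl//; apply: eq_Rintegral => t _; rewrite innerZl.
- move=> x; rewrite mulrC -RintegralZl//.
  apply: le_Rintegral_norm => //; first exact: intgZ.
  by move=> t _; exact: abs_inner_le.
- by move=> z hz; exists z.
Qed.

Lemma norm_wint_le D F : measurable D -> wmeas F -> intg D (fun t => `|F t|) ->
  `|wint D F| <= \int[mu]_(t in D) `|F t|.
Proof.
move=> mD mF iF; apply: norm_le_inner; first exact: Rintegral_ge0.
move=> x; rewrite wintP// -RintegralZl//; apply: le_Rintegral => //.
- exact: intg_inner.
- exact: intgZ.
- by move=> t _; exact: inner_le_norm.
Qed.

Lemma intg_normB D F G : separable H -> measurable D -> wmeas F -> wmeas G ->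
  intg D (fun t => `|F t|) -> intg D (fun t => `|G t|) ->
  intg D (fun t => `|F t - G t|).
Proof.
move=> sH mD mF mG iF iG.
apply: (@intg_le _ _ _ (fun t => `|F t| + `|G t|)) => //.
- by apply: wmeas_norm => //; exact: wmeasB.
- by move=> t _; rewrite normr_id ler_normB.
- exact: intgD.
Qed.

Lemma wintB D F G : separable H -> measurable D -> wmeas F -> wmeas G ->
  intg D (fun t => `|F t|) -> intg D (fun t => `|G t|) ->
  wint D (fun t => F t - G t) = wint D F - wint D G.
Proof.
move=> sH mD mF mG iF iG; apply: inner_ext => x.
rewrite innerBr !wintP//; last 2 first.
- exact: wmeasB.
- exact: intg_normB.
by rewrite -RintegralB ?intg_inner//; apply: eq_Rintegral => t _; rewrite innerBr.
Qed.

Lemma wint_ae_eq D F G : measurable D -> wmeas F -> wmeas G ->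
  {ae mu, forall t, D t -> F t = G t} -> wint D F = wint D G.
Proof.
move=> mD mF mG FG; rewrite /wint; congr get; apply/seteqP.
have E x : \int[mu]_(t in D) '[x, F t] = \int[mu]_(t in D) '[x, G t].
  by apply: Rintegral_ae_eq => //; apply: ae_sub FG => t h Dt; rewrite h.
by split=> w /= h x; rewrite h E.
Qed.

(** Integrability on every past half-line is what the mild formula and the memory term require. *)
Definition pastL1 F := wmeas F /\ forall t, intg `]-oo, t] (fun s => `|F s|).

(** The norm of an increment is at most the increment of the real function [t |-> \int_(-oo, t]
    |F|], which is continuous. *)
Lemma continuous_wint F : pastL1 F -> continuous (fun t => wint `]-oo, t] F).
Proof.
move=> [mF iF] t.
have sub s r : s <= r -> `|wint `]-oo, r] F - wint `]-oo, s] F| <=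
    \int[mu]_(x in `]-oo, r]) `|F x| - \int[mu]_(x in `]-oo, s]) `|F x|.
  move=> sr; rewrite Rintegral_Ny_sub//.
  have iFsr : intg `]s, r] (fun s => `|F s|).
    by apply: integrableS (iF r) => // y /=; rewrite !in_itv/= => /andP[].
  apply: norm_le_inner; first exact: Rintegral_ge0.
  move=> x; rewrite innerBr !wintP// Rintegral_Ny_sub ?intg_inner//.
  rewrite -RintegralZl//; apply: le_Rintegral => //.
  - exact: intg_inner.
  - exact: intgZ.
  - by move=> y _; exact: inner_le_norm.
apply/cvgrPdist_le => e e0.
have /cvgrPdist_le/(_ e e0) := @continuous_Rintegral_Ny R _ iF t.
apply: filterS => s; have [st|st] := leP s t => h.
  by rewrite (le_trans (sub _ _ st))// (le_trans (ler_norm _)).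
by rewrite distrC (le_trans (sub _ _ (ltW st)))// (le_trans (ler_norm _))// distrC.
Qed.

Definition vprimitive F t := wint `[0, t] F - wint `[t, 0] F.

Lemma is_derive_vprimitive F : continuous F ->
  forall t : R, is_derive t 1 (vprimitive F) (F t).
Proof.
move=> cF; apply: weak_is_derive => // t x.
have mF : wmeas F by exact: wmeas_continuous.
have iF a b : intg `[a, b] (fun s => `|F s|).
  apply: intg_continuous => s; apply: cvg_norm; exact: cF.
under eq_fun do rewrite innerBr !wintP//.
apply: is_derive_primitive; apply: continuous_inner => //; exact: cst_continuous.
Qed.

Lemma vprimitive0 F : vprimitive F 0 = 0.
Proof. by rewrite /vprimitive subrr. Qed.

End WeakIntegral.

(** * The unitary group generated by a skew-adjoint operator *)

Section LinearODE.
Context {R : realType} {H : hilbertType R}.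
Variables (L : H -> H) (K : R).
Hypothesis K0 : 0 < K.
Hypothesis LB : forall x y, L (x - y) = L x - L y.
Hypothesis Lb : forall x, `|L x| <= K * `|x|.

Lemma lipschitz_continuous : continuous L.
Proof.
move=> x; apply/cvgrPdist_le => e e0.
have eK : 0 < e / K by rewrite divr_gt0.
apply/nbhs_ballP; exists (e / K) => // y; rewrite -ball_normE/= => /ltW xy.
by rewrite -LB (le_trans (Lb _))// mulrC -ler_pdivlMr.
Qed.

(** The integral equation is a Volterra problem: the Lipschitz constant [K] against the growth rate
    [2 K] of the weight [e^(2 K |t|)] gives the contraction factor 1/2. *)
Lemma linear_ode x : exists X : R -> H, X 0 = x /\ forall t : R, is_derive t 1 X (L (X t)).
Proof.
pose Phi (u : R -> H) t := x + vprimitive (L \o u) t.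
have cL (u : R -> H) : continuous u -> continuous (L \o u).
  by move=> cu t; apply: continuous_comp; [exact: cu|exact: lipschitz_continuous].
have dPhi (u : R -> H) : continuous u -> forall t : R, is_derive t 1 (Phi u) (L (u t)).
  move=> cu t; rewrite -[L (u t)]add0r; apply: is_deriveD.
  exact: (is_derive_vprimitive (cL _ cu)).
have Phi0 (u : R -> H) : Phi u 0 = x by rewrite /Phi vprimitive0 addr0.
have l0 : 0 < 2 * K by rewrite mulr_gt0.
have [||||||u [cu fu _]] := @volterra_exists R H Phi (fun T => [set t | `|t| <= T])
    (fun t => expR (2 * K * `|t|)).
- move=> t; exists (`|t| + 1); apply/nbhs_ballP; exists 1 => //= s; rewrite /ball/= => ts.
  rewrite -[s](subrK t) addrC (le_trans (ler_normD _ _))// lerD2l distrC; exact: ltW.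
- by move=> t; exact: expR_ge0.
- move=> T; exists (expR (2 * K * T)) => t /= tT.
  by rewrite ler_expR ler_pM2l.
- by move=> u cu t; exact: is_derive_continuous (dPhi u cu t).
- move=> T u v M cu cv M0 uv t /= tT.
  have -> : M / 2 = K * M / (2 * K) by field; rewrite gt_eqF.
  apply: (@exp_growth _ _ (fun t => Phi u t - Phi v t) (fun t => L (u t) - L (v t)) _ _ T) => //.
  + by rewrite mulr_ge0// ltW.
  + by rewrite !Phi0 subrr.
  + by move=> s; apply: is_deriveB; exact: dPhi.
  + move=> s sT; rewrite -LB (le_trans (Lb _))// -mulrA ler_pM2l//.
    exact: uv.
- move=> T.
  have cP : continuous (Phi (cst 0)).
    by move=> t; apply: is_derive_continuous (dPhi (cst 0) (@cst_continuous _ _ _) t).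
  have [T0|T0] := leP 0 T; last first.
    by exists 0 => // t /= tT; have := le_trans (normr_ge0 t) tT; rewrite leNgt T0.
  have cnP : continuous (fun t => `|Phi (cst 0) t|) by move=> t; apply: cvg_norm; exact: cP.
  have [||s sT hs] := @EVT_max R (fun t => `|Phi (cst 0) t|) (- T) T.
  - by rewrite (le_trans _ T0)// oppr_le0.
  - exact: continuous_subspaceT.
  exists (`|Phi (cst 0) s|) => // t /= tT.
  apply: (le_trans (hs t _)); first by rewrite in_itv/= -ler_norml.
  rewrite ler_peMr//; apply: le_trans (expR_ge1Dx _).
  by rewrite lerDl mulr_ge0// ltW.
exists u; split; first by rewrite -fu Phi0.
by move=> t; have := dPhi u cu t; rewrite fu.
Qed.

End LinearODE.

(** * Flows of bounded skew operators and their limit *)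

Section UnitaryGroup.
Context {R : realType} {H : hilbertType R} {V : Type}.
Variables (A : {linear H -> H}) (c C : R).
Hypothesis bA : bounded_op A.
Hypothesis sA : symmetric_op A.
Hypothesis c0 : 0 < c.
Hypothesis cC : c <= C.
Hypothesis Acoer : forall x : H, c * '[x, x] <= '[A x, x] <= C * '[x, x].

Lemma formC x y : '[A x, y] = '[A y, x].
Proof. by rewrite sA innerC. Qed.

Lemma form_ge0 x : 0 <= '[A x, x].
Proof.
have /andP[h _] := Acoer x; apply: le_trans h.
by rewrite mulr_ge0 ?inner_ge0// ltW.
Qed.

Lemma form_eq0 x : '[A x, x] = 0 -> x = 0.
Proof.
have /andP[h _] := Acoer x => h0; apply: inner_eq0; apply/eqP.
rewrite eq_le inner_ge0 andbT.
by rewrite -(@pmulr_rle0 _ c)// -h0.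
Qed.

Lemma form_amgm x y : 2 * '[A x, y] <= '[A x, x] + '[A y, y].
Proof.
have := form_ge0 (x - y); rewrite (linearB A) !innerE (formC y x); lra.
Qed.

Lemma continuous_form : continuous A.
Proof. by have [K _ hK] := bounded_nearP bA; exact: lipschitz_linear_continuous hK. Qed.

Lemma is_derive_form (X Y : R -> H) (t : R) (x y : H) :
  is_derive t 1 X x -> is_derive t 1 Y y ->
  is_derive t 1 (fun s => '[A (X s), Y s] : R) ('[A x, Y t] + '[A (X t), y]).
Proof.
move=> dX dY.
exact: (is_derive_inner (is_derive_lip continuous_form dX) dY).
Qed.

(* With [N x = '[A x, x]], [exp (- t) * (N (w t) + d)] is nonincreasing for [t >= 0]. *)
Lemma energy_growth (L : H -> H) (w r : R -> H) (d : R) :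
  (forall x, '[A (L x), x] = 0) -> 0 <= d ->
  (forall t : R, is_derive t 1 w (L (w t) + r t)) -> w 0 = 0 ->
  (forall t, '[A (r t), r t] <= d) ->
  forall t, '[A (w t), w t] <= expR `|t| * d.
Proof.
move=> + d0.
wlog suff : L w r / (forall x, '[A (L x), x] = 0) ->
  (forall t : R, is_derive t 1 w (L (w t) + r t)) -> w 0 = 0 ->
  (forall t, '[A (r t), r t] <= d) ->
  forall t, 0 <= t -> '[A (w t), w t] <= expR t * d.
  move=> Hw Ls dw w0 rd t; have [t0|t0] := leP 0 t.
    by rewrite ger0_norm//; exact: (Hw L w r).
  rewrite ltr0_norm// -[w t](_ : (w \o -%R) (- t) = _); last by rewrite /= opprK.
  apply: (Hw (fun x => - L x) _ (fun s => - r (- s))) => //.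
  - by move=> x; rewrite (linearN A) innerNl Ls oppr0.
  - by move=> s /=; rewrite -opprD; exact: is_derive_opparg.
  - by rewrite /= oppr0.
  - by move=> s; rewrite (linearN A) innerNl innerNr opprK.
  - by rewrite oppr_ge0 ltW.
move=> Ls dw w0 rd t t0.
pose f s := expR (- s) * ('[A (w s), w s] + d).
have df (s : R) : is_derive s 1 f (expR (- s) * (2 * '[A (r s), w s]) - expR (- s) * ('[A (w s), w s] + d)).
  have d1 : is_derive s 1 (fun s => '[A (w s), w s] + d : R) (2 * '[A (r s), w s] + 0).
    apply: is_deriveD; apply: is_derive_eq (is_derive_form (dw s) (dw s)) _.
    by rewrite (formC (w s)) (linearD A) innerDl Ls; ring.
  have d2 : is_derive s 1 (fun s => expR (- s) : R) (- expR (- s)).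
    exact: (is_derive_opparg (is_derive_expR (- s))).
  apply: is_derive_eq (is_deriveM d2 d1) _.
  by rewrite addr0 /GRing.scale/=; ring.
have : f t <= f 0.
  apply: (@ler0_derive1_nincr _ f 0 t) => //.
  - move=> s _; rewrite derive1E; have [_ ->] := df s.
    rewrite -mulrBr pmulr_rle0 ?expR_gt0//.
    have := form_amgm (r s) (w s); have := rd s; lra.
  - by apply: derivable_within_continuous => s _; have [] := df s.
rewrite /f w0 (linear0 A) inner0l add0r oppr0 expR0 mul1r expRN ler_pdivrMl ?expR_gt0//.
by lra.
Qed.

Variables (L : nat -> H -> H) (j G : V -> H).
Hypothesis LB : forall n x y, L n (x - y) = L n x - L n y.
Hypothesis LZ : forall n k x, L n (k *: x) = k *: L n x.
Hypothesis Lb : forall n, exists2 K : R, 0 < K & forall x, `|L n x| <= K * `|x|.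
Hypothesis Lskew : forall n x y, '[A (L n x), y] = - '[A x, L n y].
Hypothesis Lcomm : forall n m x, L n (L m x) = L m (L n x).
Hypothesis jdense : dense (range j).
Hypothesis LG : forall v, L n (j v) @[n --> \oo] --> G v.

Let ode_ex n x : exists X : R -> H, X 0 = x /\ forall t : R, is_derive t 1 X (L n (X t)).
Proof. by have [K K0 hK] := Lb n; exact: (linear_ode K0 (LB n) hK). Qed.

Let Sn n t x := sval (cid (ode_ex n x)) t.

Let Sn0 n x : Sn n 0 x = x.
Proof. by have [] := svalP (cid (ode_ex n x)). Qed.

Let Sn_der n x (t : R) : is_derive t 1 (fun t => Sn n t x) (L n (Sn n t x)).
Proof. by have [_] := svalP (cid (ode_ex n x)); exact. Qed.

Let Lskew0 n x : '[A (L n x), x] = 0.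
Proof. by have := Lskew n x x; rewrite (formC x); lra. Qed.

(** [energy_growth] with zero source. Linearity of [Sn n t] and its commutation with each [L m]
    follow, since every defect solves this equation with zero initial value. *)
Let Sn_uniq n (y : R -> H) : (forall t : R, is_derive t 1 y (L n (y t))) -> y 0 = 0 ->
  forall t, y t = 0.
Proof.
move=> dy y0 t; apply: form_eq0; apply/eqP; rewrite eq_le form_ge0 andbT.
rewrite -(mulr0 (expR `|t|)).
apply: (@energy_growth (L n) y (cst 0)) => //.
  by move=> s; rewrite addr0.
by move=> s; rewrite (linear0 A) inner0l.
Qed.

Let SnB n t x y : Sn n t (x - y) = Sn n t x - Sn n t y.
Proof.
apply/subr0_eq; move: t; apply: (@Sn_uniq n) => [t|]; last by rewrite !Sn0 subrr.
rewrite !LB; apply: is_deriveB => //; exact: is_deriveB.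
Qed.

Let SnZ n t k x : Sn n t (k *: x) = k *: Sn n t x.
Proof.
apply/subr0_eq; move: t; apply: (@Sn_uniq n) => [t|]; last by rewrite !Sn0 subrr.
by rewrite LB LZ; apply: is_deriveB => //; exact: is_deriveZ.
Qed.

Let SnL n m t x : L m (Sn n t x) = Sn n t (L m x).
Proof.
have [K K0 hK] := Lb m.
apply/subr0_eq; move: t; apply: (@Sn_uniq n) => [t|]; last by rewrite !Sn0 subrr.
rewrite LB Lcomm; apply: is_deriveB => //.
apply/is_derive_cvgP; have /is_derive_cvgP dS := Sn_der n x t.
under eq_fun do rewrite -LB -LZ.
apply: (cvg_comp (fun h => h^-1 *: (Sn n (h + t) x - Sn n t x)) (L m) dS).
exact: (lipschitz_continuous K0 (LB m) hK).
Qed.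

Let Sn_form n t x y : '[A (Sn n t x), Sn n t y] = '[A x, y].
Proof.
rewrite -[in RHS](Sn0 n x) -[in RHS](Sn0 n y).
apply: (@is_derive_0_is_cst _ (fun t => '[A (Sn n t x), Sn n t y])) => s.
apply: is_derive_eq (is_derive_form (Sn_der n x s) (Sn_der n y s)) _.
by rewrite Lskew addNr.
Qed.

(** The function [s |-> <A (Sn n s x), Sn n (s - t) y>] is constant; its values at [t] and at 0 are
    the two sides. *)
Let Sn_adj n t x y : '[A (Sn n t x), y] = '[A x, Sn n (- t) y].
Proof.
have dadj (s : R) : is_derive s 1 (fun s => '[A (Sn n s x), Sn n (s - t) y] : R) 0.
  have d2 : is_derive s 1 (fun s => Sn n (s - t) y) (L n (Sn n (s - t) y)).
    exact: (@is_derive_subarg _ _ (fun s => Sn n s y)).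
  apply: is_derive_eq (is_derive_form (Sn_der n x s) d2) _.
  by rewrite Lskew addNr.
by have := @is_derive_0_is_cst _ _ t 0 dadj; rewrite subrr sub0r !Sn0.
Qed.

Let rho := C / c.

Let rho1 : 1 <= rho.
Proof. by rewrite /rho ler_pdivlMr// mul1r. Qed.

(** Coercivity gives [|x|^2 <= k (C / c) |y|^2]. Since [k (C / c) >= 1], it may be replaced by its
    square, which avoids square roots. *)
Lemma form_norm_le (x y : H) (k : R) : 1 <= k ->
  '[A x, x] <= k * '[A y, y] -> `|x| <= k * (C / c) * `|y|.
Proof.
move=> k1 h; have /andP[h1 _] := Acoer x; have /andP[_ h2] := Acoer y.
have C0 : 0 < C by exact: lt_le_trans c0 cC.
have k0 : 0 < k by exact: lt_le_trans ltr01 k1.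
have kr1 : 1 <= k * rho by rewrite -[1]mulr1 ler_pM.
have nn : 0 <= k * rho by exact: le_trans ler01 kr1.
rewrite -/rho -(@ler_pXn2r _ 2)// ?nnegrE ?(mulr_ge0 nn)//.
rewrite exprMn (@le_trans _ _ (k * rho * `|y| ^+ 2))//; last first.
  by rewrite ler_wpM2r ?sqr_ge0// expr2 ler_peMl// (le_trans ler01).
rewrite -!inner_norm -(ler_pM2l c0) (le_trans h1)// (le_trans h)//.
rewrite (_ : c * _ = k * (C * '[y, y])); first by rewrite ler_pM2l.
by rewrite /rho; field; rewrite gt_eqF.
Qed.

Let Sn_bound n t x : `|Sn n t x| <= rho * `|x|.
Proof. by rewrite -[rho]mul1r; apply: form_norm_le => //; rewrite mul1r Sn_form. Qed.

(** The difference of the two flows solves the equation of [L n] with source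
    [Sn m s (L n (j v) - L m (j v))], whose energy is constant in time because [Sn m] preserves the
    form. *)
Let Sn_diff n m t v : `|Sn n t (j v) - Sn m t (j v)| <=
  expR `|t| * rho * `|L n (j v) - L m (j v)|.
Proof.
apply: form_norm_le; first by rewrite -expR0 ler_expR.
apply: (@energy_growth (L n) (fun s => Sn n s (j v) - Sn m s (j v)) (fun s => Sn m s (L n (j v) - L m (j v)))) => //.
- exact: form_ge0.
- move=> s; rewrite LB SnB -!SnL.
  rewrite (_ : _ + _ = L n (Sn n s (j v)) - L m (Sn m s (j v))).
    exact: is_deriveB.
  by rewrite addrA subrK.
- by rewrite !Sn0 subrr.
- by move=> s; rewrite Sn_form.
Qed.

(** [Sn_diff] settles data in the range of [j]; density and the bound [rho], uniform in [n] and [t],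
    extend this to all [x]. *)
Let Sn_cauchy x T e : 0 < e -> exists n0 : nat, forall n m t, (n0 <= n)%N -> (n0 <= m)%N ->
  `|t| <= T -> `|Sn n t x - Sn m t x| <= e.
Proof.
move=> e0.
have rho0 : 0 < rho by exact: lt_le_trans ltr01 rho1.
have d0 : 0 < e / (4 * rho) by rewrite divr_gt0// mulr_gt0.
have [|z [bz [v _ vz]]] := jdense _ (ball_open x (e / (4 * rho))).
  by exists x; exact: ballxx.
have E0 : 0 < expR T * rho by rewrite mulr_gt0// expR_gt0.
have d1 : 0 < e / (4 * (expR T * rho)) by rewrite divr_gt0// mulr_gt0.
have /cvgrPdist_le/(_ _ d1)[n0 _ hn] := @LG v.
exists n0 => n m t nn mm tT.
have xv k : `|Sn k t x - Sn k t (j v)| <= e / 4.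
  rewrite -SnB (le_trans (Sn_bound _ _ _))// -(@ler_pdivlMl _ rho)//.
  move: bz; rewrite -vz -ball_normE/= => /ltW/le_trans; apply.
  by rewrite le_eqVlt; apply/orP; left; apply/eqP; field; rewrite gt_eqF.
have nm : `|Sn n t (j v) - Sn m t (j v)| <= e / 2.
  apply: (le_trans (Sn_diff _ _ _ _)).
  apply: (@le_trans _ _ (expR T * rho * `|L n (j v) - L m (j v)|)).
    by rewrite ler_wpM2r// ler_pM2r// ler_expR.
  rewrite -(@ler_pdivlMl _ (expR T * rho))//.
  have := hn n nn; have := hn m mm => /= h1 h2.
  rewrite (_ : _ - _ = (L n (j v) - G v) + (G v - L m (j v))); last by rewrite addrA subrK.
  apply: (le_trans (ler_normD _ _)); rewrite (distrC (L n (j v))).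
  apply: (le_trans (lerD h2 h1)).
  rewrite le_eqVlt; apply/orP; left; apply/eqP; field.
  by rewrite !gt_eqF// expR_gt0.
rewrite (_ : _ - _ = (Sn n t x - Sn n t (j v)) + (Sn n t (j v) - Sn m t (j v))
  - (Sn m t x - Sn m t (j v))).
  rewrite (_ : e = e / 4 + e / 2 + e / 4); last by field.
  rewrite (le_trans (ler_normB _ _))// lerD//.
  by rewrite (le_trans (ler_normD _ _))// lerD.
by rewrite [in RHS]addrA subrK opprB addrA subrK.
Qed.

Let Sn_cvg t x : cvg (Sn n t x @[n --> \oo]).
Proof.
apply/cauchy_cvgP/cauchy_exP => e e0.
have e20 : 0 < e / 2 by rewrite divr_gt0.
have [n0 hn] := Sn_cauchy x `|t| e20.
exists (Sn n0 t x); suff : \forall n \near \oo, `|Sn n0 t x - Sn n t x| < e.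
  by rewrite -ball_normE.
exists n0 => // n /= nn; rewrite (le_lt_trans (hn _ _ _ _ _ (lexx _)))//.
by rewrite ltr_pdivrMr// ltr_pMr// ltr1n.
Qed.

Let S t x := lim (Sn n t x @[n --> \oo]).

Let SnS t x : Sn n t x @[n --> \oo] --> S t x.
Proof. exact: Sn_cvg. Qed.

Let S_unif x T e : 0 < e -> exists n0 : nat, forall n t, (n0 <= n)%N ->
  `|t| <= T -> `|Sn n t x - S t x| <= e.
Proof.
move=> e0; have [n0 hn] := Sn_cauchy x T e0; exists n0 => n t nn tT.
have h : Sn n t x - Sn m t x @[m --> \oo] --> Sn n t x - S t x.
  by apply: cvgB; [exact: cvg_cst|exact: SnS].
by apply: (cvg_norm_le h); exists n0 => // m /= mm; exact: hn.
Qed.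

Let S_cont x : continuous (fun t => S t x).
Proof.
move=> t; apply/cvgrPdist_le => e e0.
have e30 : 0 < e / 3 by rewrite divr_gt0.
have [n0 hn] := S_unif x (`|t| + 1) e30.
have hS s : `|s| <= `|t| + 1 -> `|Sn n0 s x - S s x| <= e / 3 by exact: hn.
have cSn : {for t, continuous (fun t => Sn n0 t x)} by exact: is_derive_continuous (Sn_der n0 x t).
move: (cSn) => /cvgrPdist_le/(_ _ e30).
have : \forall s \near t, `|s - t| < 1.
  by apply/nbhs_ballP; exists 1 => //= s; rewrite /ball/= distrC.
apply: filterS2 => s s1 ts.
have sT : `|s| <= `|t| + 1.
  by rewrite -[s](subrK t) addrC (le_trans (ler_normD _ _))// lerD2l ltW.
rewrite (_ : _ - _ = - (Sn n0 t x - S t x) + (Sn n0 t x - Sn n0 s x) + (Sn n0 s x - S s x)).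
  rewrite (_ : e = e / 3 + e / 3 + e / 3); last by field.
  rewrite (le_trans (ler_normD _ _))// lerD ?hS//.
  rewrite (le_trans (ler_normD _ _))// lerD// normrN hS// lerDl.
  exact: ler01.
by rewrite opprB !addrA !subrK.
Qed.

Lemma group_exists : exists S : R -> H -> H,
  [/\ (forall t x y, S t (x - y) = S t x - S t y) /\
      (forall t k x, S t (k *: x) = k *: S t x),
      forall t x y, '[A (S t x), S t y] = '[A x, y],
      forall t x y, '[A (S t x), y] = '[A x, S (- t) y],
      forall x, continuous (fun t => S t x) &
      forall v (t : R), is_derive t 1 (fun t => S t (j v)) (S t (G v))].
Proof.
have lu (f : nat -> H) (a b : H) : f n @[n --> \oo] --> a -> f n @[n --> \oo] --> b -> a = b.
  by move=> fa fb; rewrite -(cvg_lim _ fa)// (cvg_lim _ fb).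
have luR (f : nat -> R) (a b : R) : f n @[n --> \oo] --> a -> f n @[n --> \oo] --> b -> a = b.
  by move=> fa fb; rewrite -(cvg_lim _ fa)// (cvg_lim _ fb).
have cA := continuous_form.
have SB t x y : S t (x - y) = S t x - S t y.
  apply: lu (@SnS t (x - y)) _; under eq_fun do rewrite SnB.
  by apply: cvgB; by exact: SnS.
exists S; split.
- split=> // t k x; apply: lu (@SnS t (k *: x)) _; under eq_fun do rewrite SnZ.
  by apply: cvgZr; by exact: SnS.
- move=> t x y; apply: (luR (fun n => '[A (Sn n t x), Sn n t y])).
    apply: cvg_inner; last by exact: SnS.
    exact: (cvg_comp _ _ (@SnS t x) (cA _)).
  by under eq_fun do rewrite Sn_form; exact: cvg_cst.
- move=> t x y; apply: (luR (fun n => '[A (Sn n t x), y])).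
    apply: cvg_inner; last exact: cvg_cst.
    exact: (cvg_comp _ _ (@SnS t x) (cA _)).
  under eq_fun do rewrite Sn_adj.
  by apply: cvg_inner; [exact: cvg_cst|exact: SnS].
- exact: S_cont.
(* Commutation writes the derivative as [Sn n t (L n (j v))], whose datum tends to [G v]; the
   uniform bound and [S_unif] then give locally uniform convergence of the derivatives. *)
- move=> v; apply: (@is_derive_limit _ _ (fun n t => Sn n t (j v))
    (fun n t => Sn n t (L n (j v)))) => //.
  + by move=> n t; rewrite -SnL; exact: Sn_der.
  + move=> T e e0.
    have rho0 : 0 < rho by exact: lt_le_trans ltr01 rho1.
    have e20 : 0 < e / 2 by rewrite divr_gt0.
    have e2r : 0 < e / 2 / rho by rewrite divr_gt0.
    have [n0 hn] := S_unif (G v) T e20.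
    have /cvgrPdist_le/(_ _ e2r) := @LG v; have : \forall n \near \oo, (n0 <= n)%N by exists n0.
    apply: filterS2 => n nn h t tT.
    rewrite (_ : _ - _ = Sn n t (L n (j v) - G v) + (Sn n t (G v) - S t (G v))).
      rewrite (le_trans (ler_normD _ _))// [leRHS]splitr lerD//.
        by rewrite (le_trans (Sn_bound _ _ _))// mulrC -ler_pdivlMr// distrC.
      exact: hn.
    by rewrite SnB addrA subrK.
Qed.

End UnitaryGroup.

(** * The generator, its resolvent equation and the bounded skew approximants *)

Section Resolvent.
Context {R : realType} {H V : hilbertType R}.
Variables (j P : {linear V -> H}) (A : {linear H -> H}) (c C : R).
Hypothesis jinj : injective j.
Hypothesis bA : bounded_op A.
Hypothesis sA : symmetric_op A.
Hypothesis c0 : 0 < c.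
Hypothesis cC : c <= C.
Hypothesis Acoer : forall x : H, c * '[x, x] <= '[A x, x] <= C * '[x, x].
Hypothesis jdense : dense (range j).
Hypothesis skewP : skew_adjoint j P.
Hypothesis gneP : graph_norm_equiv j P.

Let fC := formC sA.
Let f_ge0 := form_ge0 c0 Acoer.
Let f_eq0 := form_eq0 c0 Acoer.

Let C0 : 0 < C. Proof. exact: lt_le_trans c0 cC. Qed.

Lemma A_eq0 x : A x = 0 -> x = 0.
Proof. by move=> h; apply: f_eq0; rewrite h inner0l. Qed.

Lemma A_surj y : exists x, A x = y.
Proof.
have [] := @lax_milgram R H (fun x z => '[A x, z]) (fun z => '[y, z]) c C `|y| _ _ fC c0 _ _ _ _ _.
- by move=> u v w; exact: innerDr.
- by move=> k u v; exact: innerZr.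
- by move=> v; rewrite -inner_norm; case/andP: (Acoer v).
- by move=> v; rewrite -inner_norm; case/andP: (Acoer v).
- by move=> v w; exact: innerDr.
- by move=> k v; exact: innerZr.
- by move=> v; exact: abs_inner_le.
- by move=> x hx; exists x; apply: inner_ext => z; rewrite innerC hx innerC.
Qed.

Definition Ainv y := sval (cid (A_surj y)).

Lemma AinvP y : A (Ainv y) = y.
Proof. exact: svalP (cid (A_surj y)). Qed.

Lemma A_inj x y : A x = A y -> x = y.
Proof. by move=> h; apply/subr0_eq/A_eq0; rewrite linearB h subrr. Qed.

Lemma AinvB x y : Ainv (x - y) = Ainv x - Ainv y.
Proof. by apply: A_inj; rewrite linearB !AinvP. Qed.

Lemma Ainv_le y : `|Ainv y| <= c^-1 * `|y|.
Proof.
have [->|x0] := eqVneq (Ainv y) 0; first by rewrite normr0 mulr_ge0// invr_ge0 ltW.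
rewrite ler_pdivlMl// -(@ler_pM2r _ `|Ainv y|) ?normr_gt0//.
have /andP[h _] := Acoer (Ainv y).
rewrite -mulrA -expr2 -inner_norm (le_trans h)// AinvP.
exact: inner_le_norm.
Qed.

Lemma Ainv_sym x y : '[Ainv x, y] = '[x, Ainv y].
Proof. by rewrite -{1}(AinvP y) -sA AinvP. Qed.

Definition generator v := - Ainv (P v).

Lemma A_generator v : A (generator v) = - P v.
Proof. by rewrite /generator linearN AinvP. Qed.

Lemma generatorD v w : generator (v + w) = generator v + generator w.
Proof. by apply: A_inj; rewrite linearD !A_generator linearD opprD. Qed.

Lemma generatorB v w : generator (v - w) = generator v - generator w.
Proof. by apply: A_inj; rewrite (linearB A) !A_generator (linearB P) opprB opprK addrC. Qed.

Lemma generatorZ k v : generator (k *: v) = k *: generator v.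
Proof. by apply: A_inj; rewrite !linearZ/= !A_generator linearZ/= scalerN. Qed.

Lemma P_skew v w : '[P w, j v] = - '[j w, P v].
Proof.
have : adjoint_graph (range (fun v => (j v, P v))) (j v, - P v).
  by rewrite skewP; exists v.
by move/(_ (j w, P w)) => /= ->; [rewrite innerNr|exists w].
Qed.

Lemma P_skew0 v : '[P v, j v] = 0.
Proof. by have := P_skew v v; rewrite (innerC (j v)); lra. Qed.

(** The part of skew-adjointness beyond skew-symmetry: the adjoint has no larger domain than [V].
    This is how regularity is gained, both for the resolvent and for uniqueness. *)
Lemma P_maximal x y : (forall w, '[P w, x] = '[j w, y]) -> exists2 v, j v = x & - P v = y.
Proof.
move=> h; have : adjoint_graph (range (fun v => (j v, P v))) (x, y).
  by move=> _ [w _ <-]; exact: h.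
by rewrite skewP => -[v _ [<- <-]]; exists v.
Qed.

Lemma generator_skew v w : '[A (generator v), j w] = - '[A (j v), generator w].
Proof. by rewrite (sA (j v)) !A_generator innerNl innerNr P_skew. Qed.

Lemma generator_skew0 v : '[A (generator v), j v] = 0.
Proof. by rewrite A_generator innerNl P_skew0 oppr0. Qed.

Lemma generator_maximal x y : (forall w, '[A x, generator w] = - '[A y, j w]) ->
  exists2 v, j v = x & generator v = y.
Proof.
move=> h; have [|v jv Pv] := @P_maximal x (A y).
  by move=> w; have := h w; rewrite sA A_generator innerNr (innerC x) (innerC (A y)); exact: oppr_inj.
by exists v => //; apply: A_inj; rewrite A_generator.
Qed.

Lemma graph_bounds : exists k K : R, [/\ 0 < k, 0 < K &
  forall v, k * `|v| ^+ 2 <= `|j v| ^+ 2 + `|P v| ^+ 2 <= K * `|v| ^+ 2].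
Proof.
have [k [K [k0 K0 h]]] := gneP; exists (k ^+ 2), (K ^+ 2).
split; rewrite ?exprn_gt0// => v; have /andP[h1 h2] := h v.
have E : `|j v| ^+ 2 + `|P v| ^+ 2 = graph_norm j P v ^+ 2.
  by rewrite sqr_sqrtr// addr_ge0 ?sqr_ge0.
rewrite E -!exprMn !ler_pXn2r ?nnegrE ?h1 ?h2 ?sqrtr_ge0//.
- by rewrite mulr_ge0// ltW.
- by rewrite mulr_ge0// ltW.
Qed.

(** The equation [x = (1 - h^2 G^2) v], where the witness [e] records that [G v] lies in the domain,
    so that [G^2 v] makes sense. *)
Definition resolves (h : R) x v e := j e = generator v /\ x = j v - h ^+ 2 *: generator e.

(* The variational problem on [V] for [1 - h^2 G^2], where [G = generator]. *)
Lemma resolves_exists h x : 0 < h -> exists v e, resolves h x v e.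
Proof.
move=> h0; have [k [K [k0 K0 gb]]] := graph_bounds.
have [KA KA0 hKA] := bounded_nearP bA.
have h20 : 0 < h ^+ 2 by rewrite exprn_gt0.
pose a v w := '[A (j v), j w] + h ^+ 2 * '[A (generator v), generator w].
have aD u v w : a u (v + w) = a u v + a u w.
  by rewrite /a linearD generatorD !innerDr; ring.
have aZ l u v : a u (l *: v) = l * a u v.
  by rewrite /a linearZ/= generatorZ !innerZr; ring.
have aC u v : a u v = a v u by rewrite /a fC (fC (generator u)).
have c1 : 0 < c * h ^+ 2 / (KA ^+ 2 + h ^+ 2).
  by rewrite divr_gt0 ?addr_gt0 ?mulr_gt0// exprn_gt0.
(* The factor [c h^2 / (KA^2 + h^2)] is below both [c] and [c h^2 / KA^2], so it serves the two
   terms [|j v|^2] and [|P v|^2] at once; [k] converts to the norm of [V]. *)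
pose M := c * h ^+ 2 / (KA ^+ 2 + h ^+ 2) * k.
have coer v : M * `|v| ^+ 2 <= a v v.
  have /andP[gb1 _] := gb v; have /andP[cj _] := Acoer (j v); have /andP[cG _] := Acoer (generator v).
  have PG : `|P v| ^+ 2 <= KA ^+ 2 * `|generator v| ^+ 2.
    by rewrite -exprMn ler_pXn2r ?nnegrE ?mulr_ge0 ?(ltW KA0)// -normrN -A_generator.
  rewrite /M -mulrA (@le_trans _ _ (c * h ^+ 2 / (KA ^+ 2 + h ^+ 2) * (`|j v| ^+ 2 + `|P v| ^+ 2)))//.
    by rewrite ler_pM2l.
  rewrite (@le_trans _ _ (c * `|j v| ^+ 2 + c * h ^+ 2 * `|generator v| ^+ 2))//; last first.
    by rewrite -!inner_norm /a; apply: lerD => //; rewrite [c * _]mulrC -mulrA ler_pM2l.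
  have D0 : 0 < KA ^+ 2 + h ^+ 2 by rewrite addr_gt0// exprn_gt0.
  rewrite mulrAC ler_pdivrMr// -!mulrA -mulrDr -mulrA ler_pM2l//.
  have q1 := ler_wpM2l (ltW h20) PG.
  have q2 := mulr_ge0 (sqr_ge0 `|j v|) (sqr_ge0 KA).
  have q3 := mulr_ge0 (mulr_ge0 (ltW h20) (ltW h20)) (sqr_ge0 `|generator v|).
  move: q1 q2 q3; lra.
have bnd v : a v v <= (C * (1 + h ^+ 2 / c ^+ 2) * K) * `|v| ^+ 2.
  have /andP[_ gb2] := gb v; have /andP[_ cj] := Acoer (j v); have /andP[_ cG] := Acoer (generator v).
  have GP : `|generator v| ^+ 2 <= `|P v| ^+ 2 / c ^+ 2.
    rewrite ler_pdivlMr ?exprn_gt0// mulrC -exprMn ler_pXn2r ?nnegrE ?mulr_ge0 ?(ltW c0)//.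
    by rewrite -ler_pdivlMl// /generator normrN Ainv_le.
  apply: (@le_trans _ _ (C * (1 + h ^+ 2 / c ^+ 2) * (`|j v| ^+ 2 + `|P v| ^+ 2))); last first.
    by rewrite -[leRHS]mulrA ler_wpM2l// mulr_ge0 ?(ltW C0)// addr_ge0// divr_ge0 ?exprn_ge0// ltW.
  apply: (@le_trans _ _ (C * `|j v| ^+ 2 + h ^+ 2 * (C * (`|P v| ^+ 2 / c ^+ 2)))).
    rewrite /a; apply: lerD; first by rewrite -inner_norm.
    by rewrite ler_pM2l// (le_trans cG)// ler_pM2l// inner_norm.
  have jc : 0 <= `|j v| ^+ 2 * (h ^+ 2 / c ^+ 2) by rewrite mulr_ge0 ?divr_ge0 ?sqr_ge0.
  have pp := sqr_ge0 `|P v|; have CC := ltW C0; rewrite -subr_ge0.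
  rewrite (_ : _ - _ = C * (`|j v| ^+ 2 * (h ^+ 2 / c ^+ 2) + `|P v| ^+ 2)); last by ring.
  by rewrite mulr_ge0// addr_ge0.
have lb v : `|'[A x, j v]| <= (`|A x| * Num.sqrt K) * `|v|.
  rewrite (le_trans (abs_inner_le _ _))// -mulrA ler_wpM2l//.
  rewrite -(@ler_pXn2r _ 2)// ?nnegrE ?mulr_ge0// exprMn sqr_sqrtr ?(ltW K0)//.
  by have /andP[_] := gb v; apply: le_trans; rewrite lerDl sqr_ge0.
have [] := @lax_milgram R V a (fun w => '[A x, j w]) M _ _ aD aZ aC _ coer bnd _ _ lb.
- by rewrite mulr_gt0.
- by move=> v w; rewrite linearD innerDr.
- by move=> l v; rewrite linearZ/= innerZr.
(* The variational identity reads [<A (G v), G w> = - h^-2 <A (j v - x), j w>] for all [w], so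
   maximality puts [G v] into the domain. *)
move=> v hv; have [|e je Ge] := @generator_maximal (generator v) ((h ^+ 2)^-1 *: (j v - x)).
  move=> w; apply: (mulfI (lt0r_neq0 h20)).
  have := hv w; rewrite /a => /(canRL (addKr _)) ->.
  rewrite linearZ/= innerZl mulrN mulrA divff ?gt_eqF// mul1r linearB innerBl; ring.
exists v, e; split => //; rewrite Ge scalerA divff ?gt_eqF// scale1r opprB addrCA subrr addr0 //.
Qed.

Lemma resolves_lin h x y v w e d k : resolves h x v e -> resolves h y w d ->
  resolves h (x + k *: y) (v + k *: w) (e + k *: d).
Proof.
move=> [je ->] [jd ->]; split; first by rewrite !linearD !linearZ/= generatorD generatorZ je jd.
rewrite (linearD j) [j (k *: w)]linearZ/= generatorD generatorZ scalerBr scalerDr !scalerA (mulrC k) opprD.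
by rewrite addrACA.
Qed.

(** Skewness turns the cross term [- 2 h^2 <A (j v), G e>] into [2 h^2 <A (j e), j e>]. All three
    terms are then nonnegative for [h >= 0], the source of uniqueness, boundedness and convergence
    below. *)
Lemma resolves_form h x v e : resolves h x v e ->
  '[A x, x] = '[A (j v), j v] + 2 * h ^+ 2 * '[A (j e), j e] + h ^+ 4 * '[A (generator e), generator e].
Proof.
move=> [je ->]; rewrite (linearB A) [A (_ *: _)]linearZ/= innerBl !innerBr !innerZl !innerZr.
have := generator_skew v e; rewrite -je => E.
rewrite (fC (generator e)) -(opprK '[A (j v), generator e]) -E; ring.
Qed.

Lemma resolves_unique h x v e w d : 0 < h -> resolves h x v e -> resolves h x w d ->
  v = w /\ e = d.
Proof.
move=> h0 r1 r2; have := resolves_form (resolves_lin (-1) r1 r2).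
rewrite !scaleN1r subrr (linear0 A) inner0l => E.
have h2 : 0 < h ^+ 2 by rewrite exprn_gt0.
have ga := f_ge0 (j (v - w)).
have gb := mulr_ge0 (ltW h2) (f_ge0 (j (e - d))).
have gc : 0 <= h ^+ 4 * '[A (generator (e - d)), generator (e - d)].
  by rewrite mulr_ge0 ?f_ge0// exprn_ge0// ltW.
have a0 : '[A (j (v - w)), j (v - w)] = 0 by lra.
have : h ^+ 2 * '[A (j (e - d)), j (e - d)] = 0 by lra.
move=> /eqP; rewrite mulf_eq0 (gt_eqF h2)/= => /eqP b0.
by split; apply/subr0_eq; apply: jinj; rewrite (linear0 j); exact: f_eq0.
Qed.

(* If [jw = jv - h^2 Ge] with [je = Gv], then [Gw = je - h^2 G e'] with [je' = Ge]. *)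
Lemma resolves_generator h w v e : 0 < h -> resolves h (j w) v e ->
  resolves h (generator w) e ((h ^+ 2)^-1 *: (v - w)).
Proof.
move=> h0 [je jw]; have h2 : h ^+ 2 != 0 by rewrite expf_neq0// gt_eqF.
have jGe : j ((h ^+ 2)^-1 *: (v - w)) = generator e.
  by rewrite linearZ/= linearB jw opprB addrCA subrr addr0 scalerA mulVf// scale1r.
split => //; rewrite generatorZ scalerA mulfV// scale1r je generatorB opprB addrCA subrr addr0 //.
Qed.

(** The solution pair as total functions of [h], with the dummy value 0 unless [h > 0]. *)
Let rv h x := if pselect (0 < h) is left h0 then sval (cid (resolves_exists x h0)) else 0.
Let re h x := if pselect (0 < h) is left h0 then
  sval (cid (svalP (cid (resolves_exists x h0)))) else 0.

Let rP h x : 0 < h -> resolves h x (rv h x) (re h x).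
Proof.
move=> h0; rewrite /rv /re; case: pselect => // h1.
exact: (svalP (cid (svalP (cid (resolves_exists x h1))))).
Qed.

(* [yosida h = G (1 - h^2 G^2)^-1] is bounded, skew for the form, and tends to [G]. *)
Definition yosida h x := j (re h x).

Lemma yosidaE h x v e : 0 < h -> resolves h x v e -> yosida h x = j e.
Proof. by move=> h0 r; have [_ <-] := resolves_unique h0 (rP x h0) r. Qed.

Lemma yosidaB h x y : 0 < h -> yosida h (x - y) = yosida h x - yosida h y.
Proof.
move=> h0; have := resolves_lin (-1) (rP x h0) (rP y h0); rewrite !scaleN1r.
by move=> /(yosidaE h0) ->; rewrite linearB.
Qed.

Lemma yosidaZ h k x : 0 < h -> yosida h (k *: x) = k *: yosida h x.
Proof.
move=> h0; have r0 : resolves h 0 0 0.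
  have G0 : generator 0 = 0 by have := generatorZ 0 0; rewrite !scale0r.
  by split; rewrite linear0 ?G0// scaler0 subr0.
have := resolves_lin k r0 (rP x h0); rewrite !add0r.
by move=> /(yosidaE h0) ->; rewrite linearZ.
Qed.

(** With [x = j v - h^2 G e] and [j e = G v], both resulting pairings have the form
    [<A (G y), j y> = 0]; polarisation then gives [yosida_skew]. *)
Lemma yosida_skew0 h x : 0 < h -> '[A (yosida h x), x] = 0.
Proof.
move=> h0; have [je xE] := rP x h0; rewrite {2}xE /yosida innerBr innerZr.
by rewrite {1}je generator_skew0 (fC (j _)) generator_skew0 mulr0 subrr.
Qed.

Lemma yosida_skew h x y : 0 < h -> '[A (yosida h x), y] = - '[A x, yosida h y].
Proof.
move=> h0; have := yosida_skew0 (x - y) h0; rewrite yosidaB// (linearB A) !innerE.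
by rewrite !yosida_skew0// (fC x); lra.
Qed.

Lemma yosida_form_le h x : 0 < h -> 2 * h ^+ 2 * '[A (yosida h x), yosida h x] <= '[A x, x].
Proof.
move=> h0; rewrite (resolves_form (rP x h0)) /yosida.
have h4 : 0 <= h ^+ 4 by rewrite exprn_ge0// ltW.
have := f_ge0 (j (rv h x)); have := f_ge0 (generator (re h x)) => g1 g2.
have := mulr_ge0 h4 g1; lra.
Qed.

Lemma yosida_bounded h : 0 < h -> exists2 K : R, 0 < K & forall x, `|yosida h x| <= K * `|x|.
Proof.
(* The bound for the form is [1 / (2 h^2)]; the added 1 meets the requirement [1 <= k] of
   [form_norm_le]. *)
move=> h0; pose k := (2 * h ^+ 2)^-1 + 1.
have h2 : 0 < 2 * h ^+ 2 by rewrite mulr_gt0// exprn_gt0.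
have k1 : 1 <= k by rewrite lerDr invr_ge0 ltW.
exists (k * (C / c)); first by rewrite mulr_gt0 ?divr_gt0// (lt_le_trans ltr01).
move=> x; apply: (form_norm_le c0 cC Acoer) => //.
have : '[A (yosida h x), yosida h x] <= (2 * h ^+ 2)^-1 * '[A x, x].
  by rewrite ler_pdivlMl// yosida_form_le.
by move/le_trans; apply; rewrite ler_wpM2r// lerDl.
Qed.

(** By [resolves_generator] the [h]-resolvent commutes with [G], so its solution for
    [x = j v - k^2 G e] is the same combination of those for [j v] and [G e]. Both composites turn
    out to be [j b]. *)
Lemma yosida_comm h k x : 0 < h -> 0 < k ->
  yosida h (yosida k x) = yosida k (yosida h x).
Proof.
move=> h0 k0.
have [je xE] := rP x k0; set v := rv k x in je xE; set e := re k x in je xE.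
have r1 := rP (j v) h0; set v1 := rv h (j v) in r1; set e1 := re h (j v) in r1.
have rGv := resolves_generator h0 r1.
set b := (h ^+ 2)^-1 *: (v1 - v) in rGv.
have rje : resolves h (j e) e1 b by rewrite je.
have rGe := resolves_generator h0 rje.
have rx := resolves_lin (- k ^+ 2) r1 rGe.
rewrite scaleNr -xE in rx.
rewrite {2}/yosida -/e (yosidaE h0 rje) (yosidaE h0 rx).
have [jb jeE] := rje.
have rk : resolves k (j (e1 + (- k ^+ 2) *: ((h ^+ 2)^-1 *: (e1 - e)))) e1 b.
  split=> //; rewrite linearD linearZ/= scaleNr.
  by have [-> _] := rGe.
by rewrite (yosidaE k0 rk).
Qed.

(** By [resolves_generator], [yosida h (j v)] is the resolvent solution with datum [G v], so strong
    convergence of the resolvent to the identity suffices: order [h] on the range of [j], then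
    density and the uniform bound [C / c]. *)
Lemma yosida_cvg v : yosida n.+1%:R^-1 (j v) @[n --> \oo] --> generator v.
Proof.
have n0 n : 0 < n.+1%:R^-1 :> R by rewrite invr_gt0.
(* [w h y], the solution of the resolvent equation with datum [y], tends to [y] *)
have near_id y e : 0 < e -> \forall n \near \oo, `|j (rv n.+1%:R^-1 y) - y| <= e.
  move=> e0.
  have contr h x : 0 < h -> `|j (rv h x)| <= C / c * `|x|.
    move=> h0; rewrite -[C / c]mul1r; apply: (form_norm_le c0 cC Acoer) => //.
    rewrite mul1r (resolves_form (rP x h0)).
    rewrite -addrA lerDl addr_ge0// mulr_ge0 ?f_ge0// ?exprn_ge0 ?(ltW h0)//.
    by rewrite mulr_ge0// exprn_ge0// ltW.
  (* The form identity for the datum [G w] bounds [2 h^2 <A (G e1), G e1>] by [<A (G w), G w>], and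
     [j v1 - j w = h^2 G e1] is therefore of order [h]. The factor [1] is the [k] of
     [form_norm_le]. *)
  have small w : exists2 K : R, 0 <= K & forall h, 0 < h -> `|j (rv h (j w)) - j w| <= K * h.
    exists (1 * (C / c) * `|generator w|).
      by rewrite mul1r mulr_ge0// divr_ge0 ?(ltW C0) ?(ltW c0).
    move=> h h0; move: (rv h (j w)) (re h (j w)) (rP (j w) h0) => v1 e1 rw.
    have [je jw] := rw; have rGw := resolves_generator h0 rw.
    have FE := resolves_form rGw; have [jGe _] := rGw; rewrite jGe in FE.
    have -> : 1 * (C / c) * `|generator w| * h = 1 * (C / c) * `|h *: generator w|.
      by rewrite normrZ gtr0_norm//; ring.
    apply: (form_norm_le c0 cC Acoer) => //; rewrite mul1r.
    rewrite [A (h *: _)]linearZ/= innerZl innerZr FE.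
    have -> : j v1 - j w = h ^+ 2 *: generator e1 by rewrite jw opprB addrCA subrr addr0.
    rewrite [A (_ *: _)]linearZ/= innerZl innerZr.
    have h2 : 0 <= h ^+ 2 by rewrite exprn_ge0// ltW.
    have g1 := mulr_ge0 h2 (f_ge0 (j e1)).
    have g2 := mulr_ge0 (mulr_ge0 h2 h2) (f_ge0 (generator e1)).
    have g3 := mulr_ge0 (mulr_ge0 h2 (mulr_ge0 h2 h2)) (f_ge0 (generator ((h ^+ 2)^-1 *: (v1 - w)))).
    move: g1 g2 g3; lra.
  have rho1 : 1 <= C / c by rewrite ler_pdivlMr// mul1r.
  have rho0 : 0 < C / c by exact: lt_le_trans ltr01 rho1.
  have d0 : 0 < e / 3 / (C / c) by rewrite !divr_gt0.
  have [|z [bz [w _ wz]]] := jdense _ (ball_open y (e / 3 / (C / c))).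
    by exists y; exact: ballxx.
  move: bz; rewrite -wz -ball_normE/= => /ltW yw.
  have [K K0 hK] := small w.
  have e3 : 0 < e / 3 / (K + 1) by rewrite !divr_gt0// ltr_wpDl.
  have [m _ hm] := near_infty_natSinv_lt (PosNum e3).
  exists m => // n /= mn; have hn := hm n mn.
  rewrite (_ : _ - _ = j (rv n.+1%:R^-1 (y - j w)) + (j (rv n.+1%:R^-1 (j w)) - j w) - (y - j w)).
    rewrite (_ : e = e / 3 + e / 3 + e / 3); last by field.
    rewrite (le_trans (ler_normB _ _))// lerD//; last first.
      by rewrite (le_trans yw)// ler_piMr ?divr_ge0 ?(ltW e0)// invf_le1.
    rewrite (le_trans (ler_normD _ _))// lerD//.
      by rewrite (le_trans (contr _ _ (n0 n)))// mulrC -ler_pdivlMr.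
    rewrite (le_trans (hK _ (n0 n)))// (@le_trans _ _ ((K + 1) * n.+1%:R^-1))//.
      by rewrite ler_wpM2r ?(ltW (n0 n))// lerDl.
    by rewrite mulrC -ler_pdivlMr ?ltr_wpDl// ltW.
  have E : rv n.+1%:R^-1 (y - j w) = rv n.+1%:R^-1 y - rv n.+1%:R^-1 (j w).
    have := resolves_lin (-1) (rP y (n0 n)) (rP (j w) (n0 n)); rewrite !scaleN1r => rr.
    by have [] := resolves_unique (n0 n) (rP _ (n0 n)) rr.
  by rewrite E linearB addrA subrK opprB addrA subrK.
apply/cvgrPdist_le => e e0; apply: filterS (near_id (generator v) e e0) => n.
have rGv := resolves_generator (n0 n) (rP (j v) (n0 n)).
have [<- _] := resolves_unique (n0 n) rGv (rP _ (n0 n)).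
by rewrite distrC.
Qed.

Lemma unitary_group : exists S : R -> H -> H,
  [/\ (forall t x y, S t (x - y) = S t x - S t y) /\
      (forall t k x, S t (k *: x) = k *: S t x),
      forall t x y, '[A (S t x), S t y] = '[A x, y],
      forall t x y, '[A (S t x), y] = '[A x, S (- t) y],
      forall x, continuous (fun t => S t x) &
      forall v (t : R), is_derive t 1 (fun t => S t (j v)) (S t (generator v))].
Proof.
have n0 n : 0 < n.+1%:R^-1 :> R by rewrite invr_gt0.
apply: (@group_exists R H V A c C bA sA c0 cC Acoer (fun n => yosida n.+1%:R^-1)).
- by move=> n x y; exact: yosidaB.
- by move=> n k x; exact: yosidaZ.
- by move=> n; exact: yosida_bounded.
- by move=> n x y; exact: yosida_skew.
- by move=> n m x; exact: yosida_comm.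
- exact: jdense.
- exact: yosida_cvg.
Qed.

End Resolvent.

(** * Bochner integrals *)

Section Bochner.
Context {R : realType}.
Local Notation mu := (@lebesgue_measure R).
Local Notation intg D f := (mu.-integrable D (EFin \o f)).

Lemma Rdominated_cvg D (f_ : nat -> R -> R) (f g : R -> R) : measurable D ->
  (forall n, measurable_fun setT (f_ n)) -> measurable_fun setT f ->
  {ae mu, forall t, D t -> f_ n t @[n --> \oo] --> f t} -> intg D g ->
  (forall n t, D t -> `|f_ n t| <= g t) ->
  \int[mu]_(t in D) f_ n t @[n --> \oo] --> \int[mu]_(t in D) f t.
Proof.
move=> mD mf_ mf cf ig fg.
have [] := @dominated_convergence _ _ R mu D mD (fun n => EFin \o f_ n) (EFin \o f) (EFin \o g).
- by move=> n; apply/measurable_EFinP; apply: (@measurable_funTS _ _ _ _ D (f_ n)); exact: mf_.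
- by apply/measurable_EFinP; apply: (@measurable_funTS _ _ _ _ D f); exact: mf.
- apply: ae_sub cf => t h Dt; apply: cvg_EFin; last exact: h.
  by apply: nearW.
- exact: ig.
- by apply: aeW => t n Dt /=; rewrite lee_fin fg.
- move=> if_ _ h; apply: fine_cvg; move: h; rewrite /Rintegral fineK//.
  exact: integrable_fin_num.
Qed.

Lemma intg_restrict D (f : R -> R) : measurable D -> intg D f -> intg setT (f \_ D).
Proof.
move=> mD fi; have := (@integrable_mkcond _ _ _ mu D (EFin \o f) mD).1 fi.
by rewrite restrict_EFin.
Qed.

Lemma Rintegral_sum (I : Type) (r : seq I) (F : I -> R -> R) :
  (forall i, intg setT (F i)) ->
  intg setT (fun t => \sum_(i <- r) F i t) /\
  \int[mu]_t (\sum_(i <- r) F i t) = \sum_(i <- r) \int[mu]_t F i t.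
Proof.
move=> iF; elim: r => [|i r [IH1 IH2]].
  split; first by under [_ \o _]eq_fun do rewrite /= big_nil; exact: integrable0.
  rewrite big_nil; under eq_Rintegral do rewrite big_nil.
  by rewrite Rintegral_cst// mul0r.
split.
  by under [X in EFin \o X]eq_fun do rewrite big_cons; exact: intgD.
by rewrite big_cons -IH2 -RintegralD//; apply: eq_Rintegral => t _; rewrite big_cons.
Qed.

Context {H : hilbertType R}.
Hypothesis sH : separable H.
Implicit Types (F s : R -> H).

Lemma simple_integral_inner s y : simple_integrable s ->
  intg setT (fun t => `|s t|) /\ '[y, simple_integral s] = \int[mu]_t '[y, s t].
Proof.
move=> [bs fs is_].
have ms := borel_wmeas bs.
have ins : intg setT (fun t => `|s t|).
  apply/integrableP; split; first by apply/measurable_EFinP; exact: wmeas_norm.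
  by under eq_integral do rewrite /= normr_id.
split=> //.
have mE x : measurable (s @^-1` [set x]).
  rewrite (_ : _ @^-1` _ = setT `&` (fun t => `|s t - x|) @^-1` [set 0]).
    by apply: (wmeas_norm sH (wmeasB ms (wmeas_cst _))).
  rewrite setTI; apply/seteqP; split => t /=; first by move=> ->; rewrite subrr normr0.
  by move/eqP; rewrite normr_eq0 subr_eq0 => /eqP.
pose F x t := \1_(s @^-1` [set x]) t * '[y, x].
(* A nonzero level set has finite measure since its indicator is dominated by [|s| / |x|]; the zero
   level may be infinite but contributes nothing. *)
have i1 x : x != 0 -> intg setT (\1_(s @^-1` [set x]) : R -> R).
  move=> x0; have nx : 0 < `|x| by rewrite normr_gt0.
  apply: (@intg_le _ _ _ (fun t => `|x|^-1 * `|s t|)) => //.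
    move=> t _; rewrite indicE; case: (boolP (t \in _)) => [|_].
      by rewrite inE => /= ->; rewrite normr1 mulVf// gt_eqF.
    by rewrite normr0 mulr_ge0// invr_ge0.
  exact: intgZ.
have iF x : intg setT (F x).
  have [->|x0] := eqVneq x 0.
    rewrite /F; under [X in EFin \o X]eq_fun do rewrite inner0r mulr0.
    exact: integrable0.
  rewrite /F; under [X in EFin \o X]eq_fun do rewrite mulrC.
  by apply: intgZ => //; exact: i1.
rewrite /simple_integral fsbig_finite//=.
rewrite [RHS](_ : _ = \int[mu]_t (\sum_(x <- finmap.enum_fset (fset_set (range s))) F x t)); last first.
  apply: eq_Rintegral => t _.
  rewrite (bigD1_seq (s t)) ?finmap.fset_uniq//=; last first.
    by rewrite in_fset_set// inE; exists t.
  rewrite /F indicE mem_set//= mul1r big1 ?addr0// => x xst.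
  rewrite indicE memNset ?mul0r//= => stx; by rewrite stx eqxx in xst.
rewrite (Rintegral_sum _ iF).2.
rewrite (big_morph (fun w => '[y, w]) (id1 := 0) (op1 := +%R)); last 2 first.
- by move=> u v; exact: innerDr.
- exact: inner0r.
apply: eq_bigr => x _; rewrite innerZr /F.
have [->|x0] := eqVneq x 0.
  rewrite inner0r mulr0; under eq_Rintegral do rewrite mulr0.
  by rewrite Rintegral_cst// mul0r.
rewrite (@RintegralZr _ _ _ mu setT _ _ measurableT (i1 _ x0)).
congr (_ * _); rewrite /Rintegral; congr fine.
have := @integral_indic _ _ _ mu setT measurableT _ (mE x).
by rewrite setIT => ->.
Qed.

(** Every admissible approximating sequence has the weak integral as its limit, so the vector chosen
    by [bochner] is determined. *)
Lemma simple_integral_cvg F (s_ : nat -> R -> H) : wmeas F -> intg setT (fun t => `|F t|) ->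
  (forall n, simple_integrable (s_ n)) ->
  (\int[mu]_t `|F t - s_ n t|%:E)%E @[n --> \oo] --> 0%E ->
  simple_integral (s_ n) @[n --> \oo] --> wint setT F.
Proof.
move=> mF iF hs cs.
have ms n : wmeas (s_ n) by apply: borel_wmeas; have [] := hs n.
have is_ n : intg setT (fun t => `|s_ n t|) by have [] := simple_integral_inner 0 (hs n).
have iFs n : intg setT (fun t => `|F t - s_ n t|) by exact: intg_normB.
have cr : \int[mu]_t `|F t - s_ n t| @[n --> \oo] --> (0 : R) by exact: (fine_cvg cs).
have dist n : `|wint setT F - simple_integral (s_ n)| <= \int[mu]_t `|F t - s_ n t|.
  apply: norm_le_inner; first exact: Rintegral_ge0.
  move=> z; rewrite innerBr wintP// (simple_integral_inner z (hs n)).2.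
  rewrite -RintegralB ?intg_inner// -RintegralZl//.
  apply: le_Rintegral => //; last by move=> t _; rewrite -innerBr inner_le_norm.
    by apply: intgB => //; exact: intg_inner.
  exact: intgZ.
apply/cvgrPdist_le => e e0; move/cvgrPdist_le: cr => /(_ e e0); apply: filterS => n h.
apply: (le_trans (dist n)); apply: le_trans h.
by rewrite sub0r normrN ler_norm.
Qed.

(* Riemann-type step functions [F (floor (n t) / n)] suffice for bounded, compactly
   supported, almost everywhere continuous integrands. *)
Lemma bochnerE F (a b M : R) : wmeas F -> intg setT (fun t => `|F t|) ->
  (forall t, `|F t| <= M) -> (forall t, t < a \/ b < t -> F t = 0) ->
  {ae mu, forall t, {for t, continuous F}} -> bochner F = wint setT F.
Proof.
move=> mF iF FM F0 Fc.
have M0 : 0 <= M by exact: le_trans (normr_ge0 _) (FM 0).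
pose g n (t : R) : R := (Num.floor (n.+1%:R * t))%:~R / n.+1%:R.
have n0 n : 0 < n.+1%:R :> R by [].
have g_le n t : g n t <= t by rewrite /g ler_pdivrMr// mulrC floor_le.
have g_gt n t : t - n.+1%:R^-1 < g n t.
  rewrite /g ltr_pdivlMr// mulrBl mulVf ?gt_eqF// ltrBlDr mulrC.
  by have := floorD1_gt (n.+1%:R * t); rewrite rmorphD.
have inv1 n : n.+1%:R^-1 <= 1 :> R by rewrite invf_le1// ler1n.
have mg n : measurable_fun setT (g n).
  apply: nondecreasing_measurable => // s t st; rewrite /g ler_pM2r ?invr_gt0//.
  by rewrite ler_int le_floor// ler_pM2l.
pose s_ n t := F (g n t).
have ms n : wmeas (s_ n) by exact: wmeas_comp.
(* The grid point [g n t] lies at most 1 to the left of [t], hence the margin in [b + 1]. *)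
have s0 n t : t < a \/ b + 1 < t -> s_ n t = 0.
  move=> ht; apply: F0; case: ht => ht.
    by left; exact: le_lt_trans (g_le n t) ht.
  by right; have := g_gt n t; have := inv1 n; move: (n.+1%:R^-1) => r; lra.
pose B : R -> R := (cst M) \_ `[a, b + 1].
have iB : intg setT B.
  by apply: intg_restrict => //; apply: intg_continuous; exact: cst_continuous.
have sB n t : `|s_ n t| <= B t.
  rewrite /B patchE; case: ifPn => [_|]; first exact: FM.
  rewrite notin_setE /= in_itv/= => /negP; rewrite negb_and -!ltNge => /orP ht.
  by rewrite s0 ?normr0.
have is_ n : intg setT (fun t => `|s_ n t|).
  apply: (@intg_le _ _ _ B) => //; first exact: wmeas_norm.
  by move=> t _; rewrite normr_id.
have simp n : simple_integrable (s_ n).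
  split; first exact: wmeas_borel.
    pose N := (Num.bound (n.+1%:R * (`|a| + `|b| + 1))).
    have bN x : x <= `|a| + `|b| + 1 -> n.+1%:R * x < N%:R.
      move=> hx; apply: le_lt_trans (archi_boundP _); first by rewrite ler_pM2l.
      by rewrite mulr_ge0// addr_ge0// addr_ge0.
    pose h (z : int) := F (z%:~R / n.+1%:R).
    apply: (@sub_finite_set _ _ ([set 0] `|` h @` (Posz @` `I_N `|` Negz @` `I_N))); last first.
      rewrite finite_setU; split=> //; apply: finite_image.
      by rewrite finite_setU; split; exact: finite_image.
    move=> _ [t _ <-].
    have [ht|] := boolP ((t < a) || (b + 1 < t)); first by left; exact/s0/orP.
    rewrite negb_or -!leNgt => /andP[at_ tb]; right.
    exists (Num.floor (n.+1%:R * t)) => //.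
    have := floor_le (n.+1%:R * t); have := floorD1_gt (n.+1%:R * t).
    case: (Num.floor _) => m fl1 fl2; [left|right]; exists m => //=.
      rewrite -(ltr_nat R); apply: (le_lt_trans fl2); apply: bN.
      by have := ler_norm b; have := normr_ge0 a; lra.
    rewrite -(ltr_nat R); apply: le_lt_trans (bN (- t) _).
      move: fl1; rewrite NegzE rmorphD rmorphN/= -pmulrn -natr1; lra.
    by have := ler_norm (- a); rewrite normrN; have := normr_ge0 b; lra.
  by apply: integrable_lty => //; exact: is_.
have cs : (\int[mu]_t `|F t - s_ n t|%:E)%E @[n --> \oo] --> 0%E.
  have iFs n : intg setT (fun t => `|F t - s_ n t|) by exact: intg_normB.
  suff h : \int[mu]_t `|F t - s_ n t| @[n --> \oo] --> (0 : R).
    have E n : (\int[mu]_t `|F t - s_ n t|%:E)%E = (\int[mu]_t `|F t - s_ n t|)%:E.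
      by rewrite /Rintegral fineK//; exact: integrable_fin_num (iFs n).
    by under eq_fun do rewrite E; apply: cvg_EFin => //; exact: nearW.
  rewrite [X in _ --> X](_ : _ = \int[mu]_(t in setT) (cst 0 t : R)); last first.
    by rewrite Rintegral_cst// mul0r.
  apply: (@Rdominated_cvg _ _ _ (fun t => `|F t| + B t)) => //.
  - by move=> n; apply: wmeas_norm => //; exact: wmeasB.
  - apply: ae_sub Fc => t Ft _.
    apply/norm_cvg0P; rewrite -[X in _ --> X](subrr (F t)); apply: cvgB; first exact: cvg_cst.
    apply: (@cvg_comp _ _ _ (g^~ t) F _ _ _ _ Ft); apply/cvgrPdist_lt => e e0.
    apply: filterS (near_infty_natSinv_lt (PosNum e0)) => n /= hn.
    by apply: le_lt_trans hn; have := g_gt n t; have := g_le n t; rewrite ler_norml; move: (n.+1%:R^-1) => r; lra.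
  - exact: intgD.
  - by move=> n t _; rewrite normr_id (le_trans (ler_normB _ _))// lerD.
rewrite /bochner; set S := [set w | _].
have : S (get S).
  apply: getPex; exists (wint setT F); split; first exact: wmeas_borel.
  by exists s_; split=> //; exact: simple_integral_cvg.
move=> [_ [r_ [r1 r2 r3]]].
have r4 := simple_integral_cvg mF iF r1 r2.
by rewrite -(cvg_lim _ r3)// (cvg_lim _ r4).
Qed.

End Bochner.

(** * Integration by parts and test functions *)

Section Pairing.
Context {R : realType} {H : hilbertType R}.
Local Notation mu := (@lebesgue_measure R).
Local Notation intg D f := (mu.-integrable D (EFin \o f)).
Hypothesis sH : separable H.
Implicit Types (k F G : R -> H).

Lemma continuous_bounded (W : normedModType R) (f : R -> W) (T : R) : continuous f ->
  exists2 M : R, 0 <= M & forall t, `|t| <= T -> `|f t| <= M.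
Proof.
move=> cf; have [T0|T0] := leP 0 T; last first.
  by exists 0 => // t tT; have := le_lt_trans tT T0; rewrite ltNge normr_ge0.
have TT : - T <= T by rewrite ge0_cp.
have [|c _ hc] := @EVT_max R (fun t => `|f t|) _ _ TT.
  by apply: continuous_subspaceT => t; apply: cvg_norm; exact: cf.
exists `|f c| => // t tT; apply: hc.
by rewrite in_itv/= -ler_norml.
Qed.

Lemma continuous_bounded_supp (W : normedModType R) (f : R -> W) (b : R) : continuous f ->
  (forall t, b <= `|t| -> f t = 0) -> exists2 M : R, 0 <= M & forall t, `|f t| <= M.
Proof.
move=> cf f0; have [M M0 hM] := continuous_bounded b cf.
exists M => // t; have [/hM//|bt] := leP `|t| b.
by rewrite f0 ?normr0// ltW.
Qed.

Lemma intg_pairing k G (b M : R) : pastL1 k -> wmeas G ->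
  (forall t, `|G t| <= M) -> (forall t, b < t -> G t = 0) ->
  intg setT (fun t => '[k t, G t]).
Proof.
move=> [mk ik] mG GM G0.
apply: (@intg_le _ _ _ (fun t => M * ((fun s => `|k s|) \_ `]-oo, b]) t)) => //.
- exact: wmeas_inner.
- move=> t _; rewrite patchE; case: ifPn => [_|].
    by rewrite (le_trans (abs_inner_le _ _))// mulrC ler_wpM2r.
  rewrite notin_setE /= in_itv/= => /negP; rewrite -ltNge => bt.
  by rewrite G0// inner0r normr0 mulr0.
- by apply: intgZ => //; apply: intg_restrict.
Qed.

(** Fubini on the triangle [s <= t]: the inner integral of [G] over [t >= s] equals [- F s], because
    [F] vanishes at late times. No regularity of [k] enters. *)
Lemma wint_by_parts k F G (b : R) : pastL1 k -> (forall t : R, is_derive t 1 F (G t)) ->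
  continuous G -> (forall t, b <= `|t| -> F t = 0) -> (forall t, b <= `|t| -> G t = 0) ->
  \int[mu]_t '[wint `]-oo, t] k, G t] = - \int[mu]_s '[k s, F s].
Proof.
move=> [mk ik] dF cG F0 G0.
have cF : continuous F by move=> t; exact: is_derive_continuous (dF t).
have [M M0 hM] := continuous_bounded_supp cG G0.
have mG := wmeas_continuous cG.
pose K s t : R := if s <= t then '[k s, G t] else 0.
have mK : measurable_fun setT (fun p : R * R => K p.1 p.2).
  apply: measurable_fun_ifT => //; first exact: measurable_fun_ler.
  apply: (@wmeas_inner _ _ _ _ (k \o fst) (G \o snd)) => //; exact: wmeas_comp.
have : \int[mu]_s \int[mu]_t K s t = \int[mu]_t \int[mu]_s K s t.
  apply: (@Rintegral_fubini R K ((fun s => `|k s|) \_ `]-oo, b]) ((cst M) \_ `[- b, b]) mK).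
- exact: intg_restrict.
- by apply: intg_restrict => //; apply: intg_continuous; exact: cst_continuous.
- move=> s t; rewrite /K; case: ifPn => st; last first.
    by rewrite normr0 mulr_ge0// patchE; case: ifP.
  apply: le_trans (abs_inner_le _ _) _.
  have [tb|tb] := leP b `|t|.
    by rewrite G0// normr0 mulr0 mulr_ge0// patchE; case: ifP.
  have := tb; rewrite ltr_norml => /andP[tb1 tb2].
  rewrite !patchE !mem_set ?ler_wpM2l//= in_itv/= ?(ltW tb1) ?(ltW tb2)//.
  by rewrite (le_trans st)// ltW.
have -> : \int[mu]_t \int[mu]_s K s t = \int[mu]_t '[wint `]-oo, t] k, G t].
  apply: eq_Rintegral => t _; rewrite innerC wintP// [RHS]Rintegral_mkcond.
  by apply: eq_Rintegral => s _; rewrite patchE /K mem_setE in_itv/= innerC.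
move=> <-; have E s : \int[mu]_t K s t = -1 * '[k s, F s].
  have [bs|sb] := leP b s.
    rewrite F0 ?(le_trans bs (ler_norm _))// inner0r mulr0.
    rewrite -[RHS](mul0r (fine (mu setT))) -Rintegral_cst//; apply: eq_Rintegral => t _.
    rewrite /K; case: ifP => // st; rewrite G0 ?inner0r//.
    by rewrite (le_trans bs)// (le_trans st)// ler_norm.
  transitivity (\int[mu]_(t in `[s, b]) '[k s, G t]).
    rewrite [RHS]Rintegral_mkcond; apply: eq_Rintegral => t _.
    rewrite patchE /K mem_setE in_itv/=; case: leP => //= st.
    case: leP => // bt; by rewrite G0 ?inner0r// (le_trans (ltW bt))// ler_norm.
  rewrite -[RHS]addr0 mulN1r addrC -[0](inner0r (k s)) -(F0 b) ?ler_norm//.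
  apply: (@Rintegral_FTC _ _ (fun t => '[k s, F t])); first exact: ltW.
    by apply: continuous_inner => //; exact: cst_continuous.
  by move=> t; exact: is_derive_innerr.
under eq_Rintegral do rewrite E.
have [N N0 hN] := continuous_bounded_supp cF F0.
rewrite RintegralZl ?mulN1r//; apply: (@intg_pairing _ _ b N) => //.
  exact: wmeas_continuous.
by move=> t bt; rewrite F0// (le_trans (ltW bt))// ler_norm.
Qed.
End Pairing.

(** * Smooth scalar cut-offs *)

Section SmoothScalars.
Context {R : realType}.
Implicit Types (f : R -> R) (x : R).

(** The functions [x^-k e^(-1/x)] extended by 0; differentiation only produces members of higher
    index, so the whole family is treated at once. *)
Definition bexp k x : R := if 0 < x then x^-1 ^+ k * expR (- x^-1) else 0.

Lemma bexp_ge0 k x : 0 <= bexp k x.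
Proof.
rewrite /bexp; case: ifP => // x0; rewrite mulr_ge0// ?expR_ge0// exprn_ge0//.
by rewrite invr_ge0 ltW.
Qed.

(** From [e^z >= z^(k+1) / (k+1)!] at [z = 1 / x]; this decay gives differentiability at 0. *)
Lemma bexp_le k x : 0 <= x -> bexp k x <= k.+1`!%:R * x.
Proof.
move=> x0; rewrite /bexp; case: ifP => [xp|_]; last by rewrite mulr_ge0.
have z0 : 0 <= x^-1 by rewrite invr_ge0.
have /(le_trans _) := expR_ge1Dxn k z0; move=> /(_ (x^-1 ^+ k.+1 / k.+1`!%:R)).
rewrite lerDr ler01 => /(_ isT) h.
have e0 := expR_gt0 x^-1; rewrite expRN ler_pdivrMr//.
have -> : x^-1 ^+ k = x^-1 ^+ k.+1 / k.+1`!%:R * (k.+1`!%:R * x).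
  have c0 : k.+1`!%:R != 0 :> R by rewrite pnatr_eq0 -lt0n fact_gt0.
  by rewrite mulrA mulfVK// exprSr mulfVK// gt_eqF.
by rewrite mulrC ler_wpM2l// mulr_ge0.
Qed.

Lemma is_derive_bexp k x :
  is_derive x 1 (bexp k) (bexp k.+2 x - k%:R * bexp k.+1 x).
Proof.
have [x0|x0|->] := ltgtP x 0.
- rewrite /bexp !(ltNge 0) (ltW x0)/= mulr0 subr0.
  apply: near_eq_is_derive (is_derive_cst 0 x 1).
  by apply: filterS (lt_nbhsl x0) => y /= y0; rewrite (ltNge 0) ltW.
- rewrite [in X in is_derive _ _ _ X]/bexp !x0.
  have x1 : x != 0 by rewrite gt_eqF.
  have dV : is_derive x 1 (fun y : R => y^-1) (- x ^- 2).
    by have := @is_deriveV _ id x 1 1 x1 (is_derive_id _ _); rewrite scaler1.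
  have dE := @is_derive1_comp _ expR (fun y => - y^-1) x _ _ (is_derive_expR _) (is_deriveN dV).
  have dX := is_deriveX k dV.
  apply: (near_eq_is_derive (f := (fun y : R => y^-1) ^+ k * (expR \o (fun y => - y^-1)))).
    apply: filterS (lt_nbhsr x0) => y y0.
    by rewrite /bexp y0 exprfctE.
  apply: is_derive_eq (is_deriveM dX dE) _.
  rewrite /= /GRing.scale/= opprK exprfctE -exprVn; move: (x^-1) (expR _) => z E.
  by case: k {dX} => [|k] /=; rewrite ?exprS; ring.
- rewrite /bexp ltxx mulr0 subr0; apply/is_derive_epsP => e e0.
  have c0 : 0 < k.+2`!%:R :> R by rewrite ltr0n fact_gt0.
  have M0 : 0 < e / k.+2`!%:R by rewrite divr_gt0.
  have : \forall y \near (0 : R), `|0 - y| < e / k.+2`!%:R by exact: nbhsx_ballx.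
  apply: filterS => y; rewrite sub0r normrN => hy.
  rewrite scaler0 !subr0 ltxx subr0; have [y0|y0] := ltP 0 y; last by rewrite normr0 mulr_ge0// ltW.
  have := bexp_le k.+1 (ltW y0); rewrite /bexp y0 => h1.
  (* The difference quotient at 0 is the member of index [k + 1], which is at most [(k + 2)! y]. *)
  have E : y^-1 ^+ k = y * y^-1 ^+ k.+1 by rewrite exprS mulrA divff ?mul1r// gt_eqF.
  rewrite ger0_norm ?mulr_ge0 ?expR_ge0 ?exprn_ge0 ?invr_ge0 ?(ltW y0)//.
  rewrite E -mulrA mulrC (gtr0_norm y0) ler_pM2r// (le_trans h1)// mulrC -ler_pdivlMr//.
  by rewrite ltW// -(gtr0_norm y0).
Qed.

(** A syntactic class closed under differentiation, so infinite differentiability follows by one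
    induction on the order. *)
Inductive smooth_fun : (R -> R) -> Prop :=
| smooth_bexp k a b : smooth_fun (fun x => bexp k (a * x + b))
| smooth_cst a : smooth_fun (fun=> a)
| smooth_add f g : smooth_fun f -> smooth_fun g -> smooth_fun (fun x => f x + g x)
| smooth_mul f g : smooth_fun f -> smooth_fun g -> smooth_fun (fun x => f x * g x).

Lemma smooth_derive f : smooth_fun f ->
  exists2 g, smooth_fun g & forall x, is_derive x 1 f (g x).
Proof.
elim=> {f} [k a b|a|f g _ [f' sf hf] _ [g' sg hg]|f g sf0 [f' sf hf] sg0 [g' sg hg]].
- exists (fun x => (bexp k.+2 (a * x + b) + - k%:R * bexp k.+1 (a * x + b)) * a).
    apply: smooth_mul; last exact: smooth_cst.
    apply: smooth_add; first exact: smooth_bexp.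
    by apply: smooth_mul; [exact: smooth_cst|exact: smooth_bexp].
  move=> x; rewrite mulNr.
  apply: (@is_derive1_comp _ (bexp k) (fun x => a * x + b)); first exact: is_derive_bexp.
  have := is_deriveD (is_deriveZ a (is_derive_id x 1)) (is_derive_cst b x 1).
  by rewrite addr0 scaler1.
- by exists (fun=> 0); [exact: smooth_cst|move=> x; exact: is_derive_cst].
- exists (fun x => f' x + g' x); first exact: smooth_add.
  by move=> x; exact: is_deriveD.
- exists (fun x => f x * g' x + g x * f' x).
    by apply: smooth_add; exact: smooth_mul.
  by move=> x; have := is_deriveM (hf x) (hg x).
Qed.

Lemma smooth_continuous f : smooth_fun f -> continuous f.
Proof. by move=> /smooth_derive[g _ fg] x; exact: is_derive_continuous (fg x). Qed.

Lemma smooth_derivable f : smooth_fun f -> forall n x, derivable (derive1n n f) x 1.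
Proof.
move=> sf n; elim: n f sf => [|n IH] f /smooth_derive[g sg fg] x.
  by case: (fg x).
rewrite derive1Sn (_ : derive1 f = g); first exact: IH.
by apply/funext => y; rewrite derive1E; case: (fg y).
Qed.

(** For [p < x < q] this is [e^(-1/((n+1)(x-p))) e^(-1/((n+1)(q-x)))], and 0 elsewhere: a smooth
    function with values in [[0, 1]] tending pointwise to the indicator of []p, q[]. *)
Definition plateau n p q x := bexp 0 (n.+1%:R * (x - p)) * bexp 0 (n.+1%:R * (q - x)).

Lemma plateau_smooth n p q : smooth_fun (plateau n p q).
Proof.
rewrite (_ : plateau n p q = fun x => bexp 0 (n.+1%:R * x + (- n.+1%:R * p)) *
  bexp 0 (- n.+1%:R * x + n.+1%:R * q)).
  by apply: smooth_mul; exact: smooth_bexp.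
by apply/funext => x; rewrite /plateau; congr (bexp _ _ * bexp _ _); ring.
Qed.

Lemma plateau_norm n p q x : `|plateau n p q x| <= 1.
Proof.
have b1 y : bexp 0 y <= 1.
  rewrite /bexp; case: ifP => // y0.
  by rewrite mul1r expR_le1 oppr_le0 invr_ge0 ltW.
rewrite ger0_norm ?mulr_ge0 ?bexp_ge0//.
by rewrite -[1]mulr1 ler_pM ?bexp_ge0.
Qed.

Lemma plateau_out n p q x : x <= p \/ q <= x -> plateau n p q x = 0.
Proof.
rewrite /plateau /bexp !pmulr_rgt0// !subr_gt0 => -[h|h].
  by rewrite ltNge h mul0r.
by rewrite [x < q]ltNge h mulr0.
Qed.

Lemma plateau_cvg p q x : p < x < q -> plateau n p q x @[n --> \oo] --> (1 : R).
Proof.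
move=> /andP[px xq].
have b1 y : 0 < y -> bexp 0 (n.+1%:R * y) @[n --> \oo] --> (1 : R).
  move=> y0; rewrite (_ : (fun _ => _) = fun n => expR (- (n.+1%:R^-1 * y^-1))).
    have h : - (n.+1%:R^-1 * y^-1) @[n --> \oo] --> - (0 * y^-1 : R).
      by apply: cvgN; apply: cvgMl; exact: cvg_harmonic.
    by have := cvg_comp _ _ h (@continuous_expR R (- (0 * y^-1))); rewrite mul0r oppr0 expR0.
  by apply/funext => n; rewrite /bexp pmulr_rgt0// y0 mul1r invfM.
rewrite -[X in _ --> X](mulr1 1); apply: cvgM; apply: b1; by rewrite subr_gt0.
Qed.

(* The difference of a primitive and its translate vanishes near both ends, while
   its derivative is the plateau minus its translate. *)
Definition bump n p q L x :=
  primitive (plateau n p q) x - primitive (plateau n p q) (x + L).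

Lemma is_derive_bump n p q L x :
  is_derive x 1 (bump n p q L) (plateau n p q x - plateau n p q (x + L)).
Proof.
have cp := smooth_continuous (plateau_smooth n p q).
apply: is_deriveB; first exact: is_derive_primitive.
have := @is_derive_subarg R R (primitive (plateau n p q)) x (- L) _ (is_derive_primitive cp _).
by rewrite opprK.
Qed.

Lemma bump_smooth n p q L k x : derivable (derive1n k (bump n p q L)) x 1.
Proof.
case: k => [|k]; first by case: (is_derive_bump n p q L x).
rewrite derive1Sn (_ : derive1 _ = fun x => plateau n p q x +
   -1 * (plateau n p q (x + L))); last first.
  by apply/funext => y; rewrite derive1E mulN1r; case: (is_derive_bump n p q L y).
apply: smooth_derivable; apply: smooth_add; first exact: plateau_smooth.
apply: smooth_mul; first exact: smooth_cst.
rewrite (_ : (fun _ => _) = plateau n (p - L) (q - L)); first exact: plateau_smooth.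
by apply/funext => y; rewrite /plateau; congr (bexp _ (_ * _) * bexp _ (_ * _)); ring.
Qed.

Lemma bump_out n p q L x : 0 <= L -> q <= x \/ x + L <= p -> bump n p q L x = 0.
Proof.
move=> L0 h; have cp := smooth_continuous (plateau_smooth n p q).
have xL : x <= x + L by rewrite lerDl.
rewrite /bump -opprB -(Rintegral_FTC xL cp (is_derive_primitive cp)).
apply/eqP; rewrite oppr_eq0; apply/eqP.
rewrite -[RHS](mul0r (fine (lebesgue_measure `[x, x + L]))) -Rintegral_cst//.
apply: eq_Rintegral => y; rewrite inE/= in_itv/= => /andP[xy yx]; apply: plateau_out.
by case: h => h; [right|left]; [exact: le_trans h xy|exact: le_trans yx h].
Qed.

End SmoothScalars.

Section TestFunctions.
Context {R : realType} {V : hilbertType R}.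
Implicit Types (phi : R -> V) (f : R -> R).

Lemma is_derive_scale f (df : R) (v : V) (t : R) : is_derive t 1 f df ->
  is_derive t 1 (fun s => f s *: v) (df *: v).
Proof.
move=> /is_derive_cvgP hf; apply/is_derive_cvgP.
under eq_fun do rewrite -scalerBl scalerA.
exact: cvgZl.
Qed.

Lemma test_function_scale f (v : V) (b : R) :
  (forall n t, derivable (derive1n n f) t 1) -> (forall t, b <= `|t| -> f t = 0) ->
  test_function (fun t => f t *: v) /\
  forall t, derive1 (fun t => f t *: v) t = derive1 f t *: v.
Proof.
move=> df f0.
have dE n : derive1n n (fun t => f t *: v) = (fun t => derive1n n f t *: v).
  elim: n => [//|n IH]; apply/funext => t; rewrite !derive1nS IH derive1E.
  by rewrite derive1E; case: (is_derive_scale v (derivableP (df n t))).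
split; last by move=> t; have := congr1 (@^~ t) (dE 1%N).
split=> [n t|].
  by rewrite dE; case: (is_derive_scale v (derivableP (df n t))).
apply: (@subclosed_compact _ _ `[- b, b]); first exact: closed_closure.
  exact: segment_compact.
rewrite [X in _ `<=` X]((closure_id _).1 _); last exact: itv_closed.
apply: closureS => t /=; rewrite in_itv/= -ler_norml.
by apply: contraNT; rewrite -ltNge => bt; rewrite f0 ?scale0r// ltW.
Qed.

Lemma test_functionP phi : test_function phi ->
  exists b : R, [/\ 0 < b, continuous phi, continuous (derive1 phi),
    forall t : R, is_derive t 1 phi (derive1 phi t) &
    forall t, b <= `|t| -> phi t = 0 /\ derive1 phi t = 0].
Proof.
move=> [dphi /compact_bounded [M [_ hM]]].
have d0 (t : R) : is_derive t 1 phi (derive1 phi t).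
  by rewrite derive1E; exact: derivableP (dphi 0%N t).
have c0 : continuous phi by move=> t; exact: is_derive_continuous (d0 t).
have c1 : continuous (derive1 phi).
  by move=> t; exact: is_derive_continuous (derivableP (dphi 1%N t)).
have phi0 t : `|M| + 1 < `|t| -> phi t = 0.
  move=> ht; apply/eqP; apply: contraTT ht => phit; rewrite -leNgt.
  apply: (hM (`|M| + 1)); first by rewrite (le_lt_trans (ler_norm _))// ltrDl.
  exact: subset_closure.
(* One unit beyond the radius outside which [phi] vanishes, so that [phi] is zero on a neighbourhood
   of [t] and its derivative vanishes as well. *)
exists (`|M| + 2); split=> // t ht.
have tM : `|M| + 1 < `|t| by apply: lt_le_trans ht; rewrite ltrD2l ltr1n.
split; first exact: phi0.
suff : is_derive t 1 phi 0 by rewrite derive1E; case.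
apply: near_eq_is_derive (is_derive_cst 0 t 1).
have : \forall s \near t, `|M| + 1 < `|s|.
  have d0' : 0 < `|t| - (`|M| + 1) by rewrite subr_gt0.
  apply/nbhs_ballP; exists (`|t| - (`|M| + 1)) => //= s; rewrite -ball_normE /= => hs.
  have := ler_normB t s; have := ler_distD s t 0; rewrite !subr0; lra.
by apply: filterS => s /phi0 ->.
Qed.

End TestFunctions.

(** * Uniqueness for the homogeneous equation *)

Section Homogeneous.
Context {R : realType} {H : hilbertType R}.
Local Notation mu := (@lebesgue_measure R).
Local Notation intg D f := (mu.-integrable D (EFin \o f)).
Hypothesis sH : separable H.

Lemma Rintegral_null D (f : R -> R) : measurable D -> (forall t, D t -> f t = 0) ->
  \int[mu]_(t in D) f t = 0.
Proof.
move=> mD f0; rewrite -[RHS](mul0r (fine (mu D))) -Rintegral_cst//.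
by apply: eq_Rintegral => t /set_mem; exact: f0.
Qed.

Lemma wint_null D (F : R -> H) : measurable D -> (forall t, D t -> F t = 0) -> wint D F = 0.
Proof.
move=> mD F0.
have -> : wint D F = wint D (fun=> 0).
  rewrite /wint; congr get; apply/seteqP; split=> w h x /=; rewrite h.
    by apply: eq_Rintegral => t /set_mem Dt; rewrite F0.
  by apply: eq_Rintegral => t /set_mem Dt; rewrite F0.
have i0 : intg D (fun=> `|0 : H|).
  by under [X in EFin \o X]eq_fun do rewrite normr0; exact: integrable0.
apply: inner_ext => x; rewrite wintP//.
by rewrite inner0r Rintegral_null// => t _; rewrite inner0r.
Qed.

Lemma pastL1_cut (F : R -> H) (T0 : R) : wmeas F -> (forall t, t < T0 -> F t = 0) ->
  (forall t, exists M : R, forall s, T0 <= s <= t -> `|F s| <= M) -> pastL1 F.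
Proof.
move=> mF F0 bF; split=> // t; have [M hM] := bF t.
apply: (@intg_le _ _ _ ((cst `|M|) \_ `[T0, t])) => //; first exact: wmeas_norm.
  move=> s /=; rewrite in_itv/= => st; rewrite normr_id patchE.
  have [sT|sT] := ltP s T0; first by rewrite F0// normr0; case: ifP.
  rewrite mem_set/= ?in_itv/= ?sT//; apply: le_trans (ler_norm _); apply: hM.
  by rewrite sT.
apply: (@integrableS _ _ _ mu setT) => //.
by apply: intg_restrict => //; apply: intg_continuous; exact: cst_continuous.
Qed.

Lemma pastL1_continuous (F : R -> H) (T0 : R) : continuous F -> (forall t, t < T0 -> F t = 0) ->
  pastL1 F.
Proof.
move=> cF F0; apply: (@pastL1_cut _ T0) => //; first exact: wmeas_continuous.
move=> t; have [M M0 hM] := continuous_bounded (Num.max `|T0| `|t|) cF.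
exists M => s /andP[Ts st]; apply: hM; rewrite ler_norml.
have := ler_norm t; have := ler_norm (- T0); rewrite normrN => h1 h2.
apply/andP; split; last by rewrite le_max (le_trans st h2) orbT.
rewrite lerNl le_max; apply/orP; left; lra.
Qed.

Lemma is_derive_wint (F : R -> H) : continuous F -> pastL1 F ->
  forall t : R, is_derive t 1 (fun t => wint `]-oo, t] F) (F t).
Proof.
move=> cF [mF iF]; apply: weak_is_derive => // t x.
have ii s : intg `]-oo, s] (fun r => '[x, F r]) by exact: intg_inner.
have cf : continuous (fun s => '[x, F s] : R).
  by apply: continuous_inner => //; exact: cst_continuous.
rewrite (_ : (fun _ => _) = fun s => \int[mu]_(r in `]-oo, 0]) '[x, F r] +
    primitive (fun r => '[x, F r]) s).
  have := is_deriveD (is_derive_cst (\int[mu]_(r in `]-oo, 0]) '[x, F r]) t 1)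
    (is_derive_primitive cf t).
  by rewrite add0r.
apply/funext => s; rewrite wintP// /primitive.
have sub u v : u <= v -> \int[mu]_(r in `]-oo, v]) '[x, F r] =
    \int[mu]_(r in `]-oo, u]) '[x, F r] + \int[mu]_(r in `[u, v]) '[x, F r].
  move=> uv; rewrite -Rintegral_itv_obnd_cbnd.
    by rewrite -Rintegral_Ny_sub// addrC subrK.
  apply: integrableS (ii v) => // r /=; by rewrite !in_itv/= => /andP[].
have itv0 u v : v <= u -> \int[mu]_(r in `[u, v]) '[x, F r] = 0.
  rewrite le_eqVlt => /predU1P[->|vu]; first by rewrite set_itv1 Rintegral_set1.
  by rewrite set_itv_ge ?bnd_simp -?ltNge// Rintegral_set0.
have [s0|s0] := leP 0 s; first by rewrite (sub _ _ s0) (itv0 s)// subr0.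
by rewrite (sub _ _ (ltW s0)) (itv0 0) ?ltW// sub0r addrK.
Qed.

(** Dominated convergence, as the plateaus tend to the indicator of []p, q[]. *)
Lemma plateau_limit (a : R -> R) (p q : R) : measurable_fun setT a ->
  intg `]-oo, q] a -> (forall n, \int[mu]_t (plateau n p q t * a t) = 0) ->
  \int[mu]_(t in `]p, q[) a t = 0.
Proof.
move=> ma ia h; rewrite Rintegral_mkcond.
have : \int[mu]_t (plateau n p q t * a t) @[n --> \oo] --> \int[mu]_t (a \_ `]p, q[) t.
  apply: (@Rdominated_cvg _ _ _ _ ((fun t => `|a t|) \_ `]-oo, q])) => //.
  - move=> n; apply: measurable_funM => //; apply: continuous_measurable_fun.
    exact: smooth_continuous (plateau_smooth n p q).
  - exact: (measurable_restrictT _ _).1 (measurable_funTS ma).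
  - apply: aeW => t _; rewrite patchE; case: ifPn => tpq.
      rewrite -[X in _ --> X]mul1r; apply: cvgMl; apply: plateau_cvg.
      by move: tpq; rewrite inE/= in_itv.
    have out : t <= p \/ q <= t.
      move: tpq; rewrite notin_setE/= in_itv/= => /negP.
      by rewrite negb_and -!leNgt => /orP.
    by under eq_fun do rewrite plateau_out// mul0r; exact: cvg_cst.
  - by apply: intg_restrict => //; exact: integrable_norm.
  - move=> n t _; rewrite patchE normrM; case: ifPn => tq.
      by rewrite ler_piMl// plateau_norm.
    move: tq; rewrite notin_setE/= in_itv/= => /negP; rewrite -ltNge => qt.
    by rewrite plateau_out ?normr0 ?mul0r//; right; exact: ltW.
under eq_fun do rewrite h.
by move=> h0; rewrite -(cvg_lim _ h0)// lim_cst.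
Qed.

(** Lebesgue differentiation applies to [<x n, F>] for each vector of a dense sequence; off a
    countable union of null sets [F t] is then orthogonal to a dense set. *)
Lemma wint_eq0_ae (F : R -> H) : pastL1 F -> (forall t, wint `]-oo, t] F = 0) ->
  {ae mu, forall t, F t = 0}.
Proof.
move=> [mF iF] F0; have [x hx] := separable_seq sH.
have ae0 n : {ae mu, forall t, '[x n, F t] = 0}.
  have ii t : intg `]-oo, t] (fun s => '[x n, F s]) by exact: intg_inner.
  have li : locally_integrable setT (fun s => '[x n, F s]).
    split; [exact: mF|exact: openT|move=> K _ cK].
    have /compact_bounded[M [_ hM]] := cK.
    have /integrableP[_] : intg K (fun s => '[x n, F s]).
      apply: integrableS (ii (`|M| + 1)) => // [|s Ks /=].
        exact: compact_measurable.
      rewrite in_itv/=.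
      apply: le_trans (ler_norm _) _; apply: hM Ks.
      by rewrite (le_lt_trans (ler_norm _))// ltrDl.
    by [].
  apply: ae_sub (FTC1Ny ii li) => t [_ <-].
  rewrite (_ : (fun _ => _) = fun=> 0) ?derive1E ?derive_cst//.
  by apply/funext => s; rewrite -wintP// F0 inner0r.
apply: ae_sub (ae_all ae0) => t h; apply: inner_eq0; apply/eqP; rewrite eq_le inner_ge0 andbT.
apply/ler_addgt0Pr => e e0; rewrite add0r.
have F1 : 0 < `|F t| + 1 by rewrite ltr_wpDl.
have [n hn] := hx (F t) (e / (`|F t| + 1)) (divr_gt0 e0 F1).
rewrite -[X in '[X, _]](subrK (x n)) innerDl h addr0.
apply: le_trans (inner_le_norm _ _) _.
have : `|F t - x n| * (`|F t| + 1) <= e by rewrite -ler_pdivlMr// ltW.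
by apply: le_trans; rewrite ler_wpM2l// lerDl.
Qed.

Context {V : hilbertType R}.
Variables (j P : {linear V -> H}) (A : {linear H -> H}) (c C : R).
Hypothesis jinj : injective j.
Hypothesis bA : bounded_op A.
Hypothesis sA : symmetric_op A.
Hypothesis c0 : 0 < c.
Hypothesis Acoer : forall x : H, c * '[x, x] <= '[A x, x] <= C * '[x, x].
Hypothesis jdense : dense (range j).
Hypothesis skewP : skew_adjoint j P.

Lemma homogeneous_unique (d : R -> H) (T1 : R) : pastL1 d ->
  {ae mu, forall t, t < T1 -> d t = 0} ->
  (forall phi : R -> V, test_function phi ->
    \int[mu]_t '[d t, A (j (derive1 phi t)) + P (phi t)] = 0) ->
  {ae mu, forall t, d t = 0}.
Proof.
move=> pd d0 hd; have [md id_] := pd.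
pose Z t := wint `]-oo, t] d.
have cZ : continuous Z by exact: continuous_wint.
have Z0 t : t < T1 -> Z t = 0.
  move=> tT; rewrite -(@wint_null `]-oo, t] (fun=> 0))//.
  apply: wint_ae_eq => //.
  by apply: ae_sub d0 => s h; rewrite /= in_itv/= => st; apply: h; exact: le_lt_trans tT.
have pZ : pastL1 Z by exact: pastL1_continuous cZ Z0.
pose Y t := wint `]-oo, t] Z.
have Y0 t : t < T1 -> Y t = 0.
  move=> tT; apply: wint_null => // s /=; rewrite in_itv/= => st.
  by apply: Z0; exact: le_lt_trans tT.
have key v t : '[P v, Y t] = '[j v, A (Z t)].
  (* The test function [psi v] gives [\int (psi' <A (j v), d> + psi <P v, d>) = 0], and integration
     by parts replaces [psi d] by [- psi' Z]; hence [psi' a] has integral 0, and [a] itself must be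
     shown to integrate to 0. *)
  pose a s := '[A (j v), d s] - '[P v, Z s].
  have ia s : intg `]-oo, s] a by apply: intgB => //; apply: intg_inner => //; case: pZ.
  have ma : measurable_fun setT a by apply: measurable_funB; [exact: md|case: pZ].
  have a0 : {ae mu, forall s, s < T1 -> a s = 0}.
    by apply: ae_sub d0 => s h sT; rewrite /a h// Z0// !inner0r subrr.
  have ap p q : \int[mu]_(s in `]p, q[) a s = 0.
    apply: plateau_limit => // n.
    (* This shift moves the translated plateau to times before [T1], where [a] vanishes almost
       everywhere, so only the plateau itself is seen by the integral. *)
    pose L := Num.max 0 (q - T1); pose psi := bump n p q L.
    pose chi s : R := plateau n p q s - plateau n p q (s + L).
    have L0 : 0 <= L by rewrite le_max lexx.
    have LT : q - L <= T1 by rewrite lerBlDr addrC -lerBlDr le_max lexx orbT.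
    pose b := Num.max `|q| `|p - L|.
    have bout s : b <= `|s| -> q <= s \/ s + L <= p.
      rewrite ge_max => /andP[h1 h2]; have [s0|s0] := leP 0 s.
        by left; rewrite -(ger0_norm s0) (le_trans (ler_norm _)).
      right; rewrite -lerBrDr; have := ler_norm (- (p - L)); rewrite normrN.
      by move: h2; rewrite (ltr0_norm s0); lra.
    have psi0 s : b <= `|s| -> psi s = 0 by move=> /bout; exact: bump_out.
    have chi0 s : b <= `|s| -> chi s = 0.
      move=> /bout h; rewrite /chi !plateau_out ?subrr//.
        by case: h => h; [right; rewrite (le_trans h)// lerDl|left].
      by case: h => h; [right|left; rewrite (le_trans _ h)// lerDl].
    have dpsi (s : R) : is_derive s 1 psi (chi s) by exact: is_derive_bump.
    have cchi : continuous chi.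
      have cp := smooth_continuous (plateau_smooth n p q).
      move=> s; apply: cvgB; first exact: cp.
      apply: (@continuous_comp R R R (fun x => x + L) (plateau n p q)); last exact: cp.
      by apply: cvgD; [exact: cvg_id|exact: cvg_cst].
    have [phiT phiD] := test_function_scale v (@bump_smooth R n p q L) psi0.
    have csc (w : H) : continuous (fun s => chi s *: w).
      by move=> s; apply: cvgZr_tmp; exact: cchi.
    have out0 (f : R -> R) (w : H) : (forall s, b <= `|s| -> f s = 0) ->
        forall s, b <= `|s| -> f s *: w = 0.
      by move=> f0 s /f0 ->; rewrite scale0r.
    have ii k (f : R -> R) (w : H) : pastL1 k -> (forall s, b <= `|s| -> f s = 0) ->
        continuous (fun s => f s *: w) -> intg setT (fun s => '[k s, f s *: w]).
      move=> pk f0 cf.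
      have [M _ hM] := continuous_bounded_supp cf (out0 f w f0).
      apply: (intg_pairing sH pk _ hM (b := b)); first exact: wmeas_continuous.
      by move=> s bs; rewrite f0 ?scale0r// (le_trans (ltW bs))// ler_norm.
    have ibp := wint_by_parts sH pd (fun s => is_derive_scale (P v) (dpsi s)) (csc (P v))
      (out0 _ _ psi0) (out0 _ _ chi0).
    have i1 := ii _ _ (A (j v)) pd chi0 (csc _).
    have i3 := ii _ _ (P v) pZ chi0 (csc _).
    have i2 : intg setT (fun s => '[d s, psi s *: P v]).
      apply: ii => // s; exact: is_derive_continuous (is_derive_scale _ (dpsi s)).
    have E1 : \int[mu]_s ('[d s, chi s *: A (j v)] + '[d s, psi s *: P v]) = 0.
      rewrite -[RHS](hd _ phiT); apply: eq_Rintegral => s _.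
      rewrite phiD (_ : derive1 psi s = chi s); last first.
        by rewrite derive1E; case: (dpsi s).
      rewrite [j (_ *: _)]linearZ/= [A (_ *: _)]linearZ/= [P (_ *: _)]linearZ/= innerDr.
      by [].
    have E2 : \int[mu]_s (chi s * a s) = 0.
      transitivity (\int[mu]_s ('[d s, chi s *: A (j v)] - '[Z s, chi s *: P v])).
        apply: eq_Rintegral => s _; rewrite !innerZr -mulrBr /a.
        by rewrite [in RHS]innerC ['[Z s, _]]innerC.
      move: E1; rewrite RintegralD// RintegralB// ibp opprK; exact.
    rewrite -[RHS]E2; apply: Rintegral_ae_eq => //.
    - apply: measurable_funM => //; apply: continuous_measurable_fun.
      exact: smooth_continuous (plateau_smooth n p q).
    - by apply: measurable_funM => //; exact: continuous_measurable_fun.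
    - apply: ae_sub a0 => s h _; have [/h ->|sT] := ltP s T1; first by rewrite !mulr0.
      by rewrite /chi (@plateau_out _ _ _ _ (s + L)) ?subr0//; right; lra.
  apply/eqP; rewrite -subr_eq0 -sA -opprB oppr_eq0; apply/eqP.
  have [mZ iZ] := pZ; rewrite !wintP// -RintegralB//; last 2 first.
  - exact: intg_inner.
  - exact: intg_inner.
  (* Before [p < T1] the integrand vanishes almost everywhere, so the half-line integral reduces to
     []p, t]]. *)
  pose p := Num.min t T1 - 1.
  have [pt pT] : p < t /\ p < T1.
    have : Num.min t T1 <= t by rewrite ge_min lexx.
    have : Num.min t T1 <= T1 by rewrite ge_min lexx orbT.
    by rewrite /p; lra.
  have e0 : \int[mu]_(s in `]p, t]) a s = 0.
    rewrite -Rintegral_itv_bndo_bndc//.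
    by apply: integrableS (ia t) => // s /=; rewrite !in_itv/= => /andP[_ /ltW].
  have := Rintegral_Ny_sub (ltW pt) (ia t).
  rewrite e0 => /eqP; rewrite subr_eq0 => /eqP ->.
  rewrite -[RHS](@Rintegral_null `]-oo, p] (fun=> 0))//.
  apply: Rintegral_ae_eq => //; apply: ae_sub a0 => s h.
  by rewrite /= in_itv/= => sp; apply: h; exact: le_lt_trans pT.
(* [key] says exactly that [Y t] lies in the domain of the adjoint, so skew-adjointness places it in
   the range of [j]. *)
have solve t : exists2 y, j y = Y t & - P y = A (Z t).
  by apply: (P_maximal skewP) => w; exact: key.
have E0 t : '[A (Y t), Y t] = 0.
  have dE (s : R) : is_derive s 1 (fun t => '[A (Y t), Y t] : R) 0.
    have dY : is_derive s 1 Y (Z s) := is_derive_wint cZ pZ s.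
    have [y yY yZ] := solve s.
    have e : '[A (Z s), Y s] = 0 by rewrite -yZ -yY innerNl (P_skew0 skewP) oppr0.
    by have := is_derive_form bA dY dY; rewrite [X in _ + X](formC sA) e addr0.
  have [s _] := MVT_dist (t0 := T1 - 1) (t := t) (fun s _ => dE s).
  rewrite mul0r => /eqP; rewrite subr_eq0 => /eqP ->.
  by rewrite Y0 ?inner0r// ltrBlDr ltrDl.
(* [Y t = j y = 0] forces [y = 0] by injectivity, whence [A (Z t) = - P y = 0]. *)
have Z00 t : Z t = 0.
  have [y yY yZ] := solve t; apply: (A_eq0 c0 Acoer).
  rewrite -yZ (_ : y = 0) ?linear0 ?oppr0//.
  by apply: jinj; rewrite yY linear0; exact: (form_eq0 c0 Acoer).
exact: wint_eq0_ae.
Qed.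

End Homogeneous.

(** * Mild solutions *)

Lemma comp_continuous (T U W : topologicalType) (f : T -> U) (g : U -> W) :
  continuous f -> continuous g -> continuous (fun t => g (f t)).
Proof. by move=> cf cg t; exact: continuous_comp (cf t) (cg (f t)). Qed.

Lemma graph_norm_continuous {R : realType} {H V : hilbertType R} (j P : {linear V -> H}) :
  graph_norm_equiv j P -> continuous P.
Proof.
move=> [k [K [_ _ hK]]]; apply: (@lipschitz_linear_continuous _ _ _ P K) => v.
have /andP[_] := hK v; apply: le_trans; rewrite /graph_norm.
rewrite -[X in X <= _]ger0_norm// -sqrtr_sqr ler_wsqrtr// lerDr.
exact: sqr_ge0.
Qed.

Section Mild.
Context {R : realType} {H V : hilbertType R}.
Local Notation mu := (@lebesgue_measure R).
Local Notation intg D f := (mu.-integrable D (EFin \o f)).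
Hypothesis sH : separable H.
Variables (j P : {linear V -> H}) (A : {linear H -> H}) (c C : R) (S : R -> H -> H).
Hypothesis cj : continuous j.
Hypothesis bA : bounded_op A.
Hypothesis sA : symmetric_op A.
Hypothesis c0 : 0 < c.
Hypothesis cC : c <= C.
Hypothesis Acoer : forall x : H, c * '[x, x] <= '[A x, x] <= C * '[x, x].
Hypothesis gneP : graph_norm_equiv j P.
Hypothesis SB : forall t x y, S t (x - y) = S t x - S t y.
Hypothesis SZ : forall t k x, S t (k *: x) = k *: S t x.
Hypothesis Sform : forall t x y, '[A (S t x), S t y] = '[A x, y].
Hypothesis Sadj : forall t x y, '[A (S t x), y] = '[A x, S (- t) y].
Hypothesis Scont : forall x, continuous (fun t => S t x).
Local Notation Ai := (Ainv sA c0 Acoer).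
Local Notation Gv := (generator P sA c0 Acoer).
Hypothesis Sder : forall v (t : R), is_derive t 1 (fun t => S t (j v)) (S t (Gv v)).

Let rho := C / c.

Let rho1 : 1 <= rho. Proof. by rewrite /rho ler_pdivlMr ?mul1r. Qed.

Let SD t x y : S t (x + y) = S t x + S t y.
Proof. by have := SB t x (-1 *: y); rewrite SZ !scaleN1r !opprK. Qed.

Let rho0 : 0 <= rho. Proof. exact: le_trans rho1. Qed.

Let SN t x : S t (- x) = - S t x.
Proof. by rewrite -scaleN1r SZ scaleN1r. Qed.

Let S_le t x : `|S t x| <= rho * `|x|.
Proof.
rewrite -[rho]mul1r; apply: (form_norm_le c0 cC Acoer) => //.
by rewrite Sform mul1r.
Qed.

(** Joint continuity of [(t, x) |-> S t x], from strong continuity and the bound [rho] uniform in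
    time. *)
Let cvg_S (T : Type) (F : set_system T) {FF : Filter F} (r : T -> R) (x : T -> H) r0 x0 :
  r @ F --> r0 -> x @ F --> x0 -> S (r s) (x s) @[s --> F] --> S r0 x0.
Proof.
move=> hr hx.
have h1 : S (r s) (x s - x0) @[s --> F] --> (0 : H).
  apply/cvgr0Pnorm_le => e e0.
  have r0' : 0 < rho by exact: lt_le_trans rho1.
  have /cvgr_dist_le/(_ (e / rho) (divr_gt0 e0 r0')) := hx.
  apply: filterS => s hs; apply: le_trans (S_le _ _) _.
  by rewrite mulrC -ler_pdivlMr// distrC.
have h2 : S (r s) x0 @[s --> F] --> S r0 x0.
  exact: (cvg_comp _ _ hr (@Scont x0 r0)).
rewrite (_ : (fun s => S (r s) (x s)) = fun s => S (r s) (x s - x0) + S (r s) x0).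
  by rewrite -[X in _ --> X]add0r; exact: cvgD.
by apply/funext => s; rewrite SB subrK.
Qed.

Let continuous_S (x : R -> H) : continuous x -> continuous (fun t => S t (x t)).
Proof. by move=> cx t; apply: cvg_S; [exact: cvg_id|exact: cx]. Qed.

Let continuous_SN (x : R -> H) : continuous x -> continuous (fun t => S (- t) (x t)).
Proof. by move=> cx t; apply: cvg_S; [apply: cvgN; exact: cvg_id|exact: cx]. Qed.

Let continuous_Ai : continuous Ai.
Proof.
move=> y; apply/cvgrPdist_le => e e0.
have ec : 0 < e * c by rewrite mulr_gt0.
have /cvgrPdist_le/(_ _ ec) := @cvg_id _ (nbhs y).
apply: filterS => z hz; rewrite -AinvB.
apply: le_trans (Ainv_le _ _ _ _) _.
by rewrite mulrC ler_pdivrMr.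
Qed.

Let is_derive_SN (x : R -> H) (t : R) (x' y : H) : is_derive t 1 x x' ->
  is_derive t 1 (fun s => S (- s) (x t)) y ->
  is_derive t 1 (fun s => S (- s) (x s)) (S (- t) x' + y).
Proof.
move=> /is_derive_cvgP dx /is_derive_cvgP dy; apply/is_derive_cvgP.
have hN : - (h + t) @[h --> (0 : R)^'] --> - t.
  apply: cvgN; rewrite -[X in _ --> X]add0r; apply: cvgD; last exact: cvg_cst.
  exact: cvg_within.
rewrite (_ : (fun h => _) = fun h => S (- (h + t)) (h^-1 *: (x (h + t) - x t)) +
    h^-1 *: (S (- (h + t)) (x t) - S (- t) (x t))).
  by apply: cvgD => //; exact: cvg_S.
by apply/funext => h; rewrite SZ SB -scalerDr addrA subrK.
Qed.

Definition mild (g : R -> H) t := S t (wint `]-oo, t] (fun s => S (- s) (Ai (g s)))).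

Let pastL1_SA g : pastL1 g -> pastL1 (fun s => S (- s) (Ai (g s))).
Proof.
move=> [mg ig].
have mk : wmeas (fun s : R => S (- s) (Ai (g s))).
  (* Writing the test vector as [A z] lets the form adjoint move [S (- s)] onto [z], whose orbit is
     continuous. *)
  move=> x; have [z <-] := A_surj sA c0 Acoer x.
  under eq_fun do rewrite -Sadj.
  apply: wmeas_inner => //.
    by apply: wmeas_continuous; apply: comp_continuous; [exact: Scont|exact: continuous_form].
  apply: (@wmeas_operator _ _ _ _ (fun=> Ai) g) => //.
    by move=> _ u v; rewrite Ainv_sym.
  by move=> u; exact: wmeas_cst.
split=> // t; apply: (@intg_le _ _ _ (fun s => rho * c^-1 * `|g s|)) => //.
- exact: wmeas_norm.
- move=> s _; rewrite normr_id; apply: le_trans (S_le _ _) _.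
  by rewrite -mulrA ler_wpM2l//; exact: Ainv_le.
- exact: intgZ.
Qed.

(** One factor [rho] for each of [S t] and [S (- s)], and [1 / c] for the inverse of [A]. *)
Definition kappa := rho ^+ 2 * c^-1.

Lemma mild_continuous g : pastL1 g -> continuous (mild g).
Proof. by move=> pg; apply: continuous_S; apply: continuous_wint; exact: pastL1_SA. Qed.

Lemma mild_le g t : pastL1 g -> `|mild g t| <= kappa * \int[mu]_(s in `]-oo, t]) `|g s|.
Proof.
move=> pg; have [mk ik] := pastL1_SA pg; have [mg ig] := pg.
apply: le_trans (S_le _ _) _.
rewrite (_ : kappa * _ = rho * (rho * c^-1 * \int[mu]_(s in `]-oo, t]) `|g s|)); last first.
  by rewrite /kappa; ring.
rewrite ler_wpM2l//; apply: le_trans; first exact: norm_wint_le.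
rewrite -RintegralZl//; apply: le_Rintegral => //; first exact: intgZ.
move=> s _; apply: le_trans (S_le _ _) _; rewrite -mulrA ler_wpM2l//.
exact: Ainv_le.
Qed.

Lemma mildB g h t : pastL1 g -> pastL1 h ->
  mild (fun s => g s - h s) t = mild g t - mild h t.
Proof.
move=> pg ph; rewrite /mild -SB; congr (S t _).
have [mg ig] := pastL1_SA pg; have [mh ih] := pastL1_SA ph.
by rewrite -wintB//; congr wint; apply/funext => s; rewrite AinvB SB.
Qed.

(** The isometry [S t] is moved off the solution: it is then paired with
    [K = A S(-t) (j phi' + A^-1 P phi)], which is the derivative of [F = A S(-t) j phi]. One
    integration by parts and the isometry property finish. *)
Lemma mild_weak g (phi : R -> V) : pastL1 g -> test_function phi ->
  \int[mu]_t '[mild g t, A (j (derive1 phi t)) + P (phi t)] = - \int[mu]_t '[g t, j (phi t)].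
Proof.
move=> pg /test_functionP[b [b0 cphi cdphi dphi phi0]].
have cA := continuous_form bA.
pose F t := A (S (- t) (j (phi t))).
pose K t := A (S (- t) (j (derive1 phi t) + Ai (P (phi t)))).
have dF (t : R) : is_derive t 1 F (K t).
  apply: (is_derive_lip (L := A)) => //; rewrite SD.
  apply: (@is_derive_SN (j \o phi)); first exact: (is_derive_lip cj).
  have := is_derive_opparg (Sder (phi t) (- t)).
  by rewrite SN opprK.
have cK : continuous K.
  apply: comp_continuous cA; apply: continuous_SN => s; apply: cvgD.
    exact: (comp_continuous cdphi cj).
  exact: (comp_continuous (comp_continuous cphi (graph_norm_continuous gneP)) continuous_Ai).
have S0 t : S t 0 = 0 by rewrite -[0 in LHS](subrr 0) SB subrr.
have Ai0 : Ai 0 = 0 by rewrite -[0 in LHS](subrr 0) AinvB subrr.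
have F0 t : b <= `|t| -> F t = 0.
  by move=> /phi0[h _]; rewrite /F h linear0 S0 linear0.
have K0 t : b <= `|t| -> K t = 0.
  by move=> /phi0[h h']; rewrite /K h h' !linear0 Ai0 addr0 S0 linear0.
transitivity (\int[mu]_t '[wint `]-oo, t] (fun s => S (- s) (Ai (g s))), K t]).
  apply: eq_Rintegral => t _.
  by rewrite /mild /K -{1}(AinvP sA c0 Acoer (P (phi t))) -(linearD A) -!sA Sadj.
rewrite (wint_by_parts sH (pastL1_SA pg) dF cK F0 K0); congr (- _).
by apply: eq_Rintegral => t _; rewrite /F -sA Sform AinvP.
Qed.

End Mild.

(** * The memory operator *)

(** Tonelli for the positive and negative parts; [fine] is measurable, so infinite values do no
    harm. *)
Lemma measurable_Rintegral {R : realType} (F : R * R -> R) : measurable_fun setT F ->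
  measurable_fun setT (fun t => \int[@lebesgue_measure R]_s F (t, s)).
Proof.
move=> mF; pose mu := @lebesgue_measure R.
have mE : measurable_fun setT (EFin \o F) by exact/measurable_EFinP.
have h (G : R * R -> \bar R) : (forall p, 0 <= G p)%E -> measurable_fun setT G ->
    measurable_fun setT (fun t => \int[mu]_s G (t, s))%E.
  by move=> G0 mG; exact: (@measurable_fun_fubini_tonelli_F _ _ _ _ _ mu G).
have : measurable_fun setT (fine \o (fun t => (\int[mu]_s ((EFin \o F)^\+ (t, s)) -
    \int[mu]_s ((EFin \o F)^\- (t, s)))%E)).
  apply: measurableT_comp => //; apply: emeasurable_funB; apply: h => //.
  - exact: measurable_funepos.
  - exact: measurable_funeneg.
rewrite (_ : fine \o _ = fun t => \int[mu]_s F (t, s))//.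
apply/funext => t; rewrite /= /Rintegral; congr fine.
have E := @integralE _ _ _ mu setT (fun s => (F (t, s))%:E).
by rewrite E; congr (_ - _)%E; apply: eq_integral => s _; rewrite ?funeposE ?funenegE.
Qed.

Section Memory.
Context {R : realType} {H : hilbertType R}.
Local Notation mu := (@lebesgue_measure R).
Local Notation intg D f := (mu.-integrable D (EFin \o f)).
Hypothesis sH : separable H.

Lemma wmeas_wint (K : R * R -> H) : wmeas K ->
  (forall t, intg setT (fun s => `|K (t, s)|)) ->
  wmeas (fun t => wint setT (fun s => K (t, s))).
Proof.
move=> mK iK x; have mKt t : wmeas (fun s => K (t, s)).
  by apply: (@wmeas_comp _ _ _ _ _ _ (pair t) K) => //; exact: pair1_measurable.
under eq_fun do rewrite wintP//.
exact: (@measurable_Rintegral _ (fun p => '[x, K p])).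
Qed.

Lemma opnorm_lip (L M : {linear H -> H}) : bounded_op L -> bounded_op M ->
  bounded_op (L \- M) /\ opnorm L <= opnorm M + opnorm (L \- M).
Proof.
move=> bL bM.
have bLM : bounded_op (L \- M).
  have [K K0 hK] := bounded_nearP bL; have [K' K0' hK'] := bounded_nearP bM.
  apply/linear_boundedP; near=> r => x /=.
  apply: le_trans (ler_normB _ _) _; apply: le_trans (lerD (hK x) (hK' x)) _.
  by rewrite -mulrDl ler_wpM2r.
split=> //; apply: opnorm_le; first by rewrite addr_ge0// opnorm_ge0.
move=> x; rewrite mulrDl -[L x](subrK (M x)) addrC.
apply: le_trans (ler_normD _ _) _; apply: lerD; first exact: le_opnorm.
exact: (@le_opnorm _ _ (L \- M)).
Unshelve. all: by end_near. Qed.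

Variable Q : R -> {linear H -> H}.
Hypothesis hQ : forall t, bounded_op (Q t) /\ symmetric_op (Q t).
Hypothesis Q1 : op_L1 Q.
Hypothesis Qc : op_continuous_on `[0, +oo[ Q.
Hypothesis Q0 : forall t x, t < 0 -> Q t x = 0.

(** The even extension is continuous on the whole line, while [opnorm (Q r)] may jump at 0. *)
Let q (r : R) := opnorm (Q `|r|).

Let Qabs_cvg (t : R) : opnorm (Q `|s : R| \- Q `|t|) @[s --> t] --> (0 : R).
Proof.
have at0 : `[0, +oo[%classic `|t| by rewrite /= in_itv/= andbT.
have hn : `|s : R| @[s --> t] --> within `[0, +oo[ (nbhs `|t|).
  move=> P wP; have : \forall s \near t, (fun y => `[0, +oo[%classic y -> P y) `|s|.
    exact: (@norm_continuous R R t _ wP).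
  by apply: filterS => s; apply; rewrite /= in_itv/= normr_ge0.
exact: (@cvg_comp _ _ _ (fun s : R => `|s|) (fun r => opnorm (Q r \- Q `|t|)) _ _ _ hn (Qc at0)).
Qed.

Let q_cont : continuous q.
Proof.
move=> t; apply/cvgrPdist_le => e e0.
have /cvgrPdist_le/(_ e e0) := Qabs_cvg t; apply: filterS => s.
rewrite sub0r normrN => /(le_trans (ler_norm _)) hs.
have [bs _] := hQ `|s|; have [bt _] := hQ `|t|.
have [_ h1] := opnorm_lip bs bt; have [_ h2] := opnorm_lip bt bs.
rewrite ler_norml /q; apply/andP; split; first lra.
suff : opnorm (Q `|t| \- Q `|s|) <= opnorm (Q `|s| \- Q `|t|) by lra.
have [b _] := opnorm_lip bs bt.
apply: opnorm_le; first exact: (@opnorm_ge0 _ _ (Q `|s| \- Q `|t|)).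
by move=> x; rewrite /= -normrN opprB; exact: (@le_opnorm _ _ (Q `|s| \- Q `|t|)).
Qed.

Let Q_le r x : `|Q r x| <= q r * `|x|.
Proof.
have [r0|r0] := ltP r 0.
  by rewrite Q0// normr0 mulr_ge0// opnorm_ge0//; have [] := hQ `|r|.
by rewrite /q ger0_norm// le_opnorm//; have [] := hQ r.
Qed.

Let q_ge0 r : 0 <= q r. Proof. by rewrite opnorm_ge0//; have [] := hQ `|r|. Qed.

Let Qabs_continuous (psi : R -> H) t : continuous psi -> continuous (fun s => Q `|s - t| (psi s)).
Proof.
move=> cpsi s; apply/cvgrPdist_le => e e0.
have h : opnorm (Q `|r - t| \- Q `|s - t|) * `|psi s| + q (r - t) * `|psi s - psi r|
    @[r --> s] --> 0 * `|psi s| + q (s - t) * (0 : R).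
  apply: cvgD; apply: cvgM.
  - apply: (cvg_comp (fun r => r - t) (fun r => opnorm (Q `|r| \- Q `|s - t|)) _ (Qabs_cvg (s - t))).
    by apply: cvgB; [exact: cvg_id|exact: cvg_cst].
  - exact: cvg_cst.
  - apply: (@comp_continuous R R R (fun r => r - t) q _ q_cont) => r.
    by apply: cvgB; [exact: cvg_id|exact: cvg_cst].
  - apply/norm_cvg0P; rewrite -[X in _ --> X](subrr (psi s)).
    by apply: cvgB; [exact: cvg_cst|exact: cpsi].
move: h; rewrite mul0r mulr0 addr0 => /cvgrPdist_le/(_ e e0); apply: filterS => r.
rewrite sub0r normrN => /(le_trans (ler_norm _)); apply: le_trans.
have -> : Q `|s - t| (psi s) - Q `|r - t| (psi r) =
   - (Q `|r - t| \- Q `|s - t|) (psi s) + Q `|r - t| (psi s - psi r).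
  by rewrite /= opprB linearB addrA subrK.
apply: le_trans (ler_normD _ _) _; rewrite normrN; apply: lerD.
  have [bs _] := hQ `|s - t|; have [br _] := hQ `|r - t|.
  have [b _] := opnorm_lip br bs.
  exact: (@le_opnorm _ _ (Q `|r - t| \- Q `|s - t|)).
by apply: le_opnorm; have [] := hQ `|r - t|.
Qed.

(** For nonnegative lags [Q] agrees with its even extension, continuous at each fixed vector, and it
    vanishes for negative ones; symmetry handles the dependence of [u] on the parameter. *)
Lemma wmeas_kernel {d} {T : measurableType d} (f : T -> R) (u : T -> H) :
  measurable_fun setT f -> wmeas u -> wmeas (fun p => Q (f p) (u p)).
Proof.
move=> mf mw; apply: (@wmeas_operator _ _ _ _ (fun p => Q (f p)) u) => //.
  by move=> p x y; have [_ h] := hQ (f p); rewrite h.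
move=> x; apply: (@wmeas_comp _ _ _ _ _ _ f (fun r => Q r x)) => //.
rewrite (_ : (fun r => _) = fun r => if 0 <= r then Q `|r| x else 0).
  apply: wmeas_if; [exact: measurable_fun_ler| |exact: wmeas_cst].
  have := @Qabs_continuous (fun=> x) 0 (@cst_continuous _ _ _); under eq_fun do rewrite subr0.
  exact: wmeas_continuous.
by apply/funext => r; case: leP => [/ger0_norm ->//|r0]; rewrite Q0.
Qed.

Let wmeas_section (u : R -> H) t : wmeas u -> wmeas (fun s : R => Q (t - s) (u s)).
Proof. by apply: wmeas_kernel; exact: measurable_funB. Qed.

(** The substitution [s |-> t - s] is carried out on primitives, by the fundamental theorem of
    calculus; the result is part of the full norm integral. *)
Let q_mass a t : a <= t -> \int[mu]_(s in `[a, t]) q (t - s) <= op_L1norm Q.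
Proof.
move=> at_.
have -> : \int[mu]_(s in `[a, t]) q (t - s) = primitive q (t - a) - primitive q 0.
  transitivity (- primitive q (t - t) - - primitive q (t - a)); last by rewrite subrr; ring.
  apply: (@Rintegral_FTC _ (fun s => q (t - s)) (fun s => - primitive q (t - s))) => //.
  - by apply: comp_continuous q_cont => s; apply: cvgB; [exact: cvg_cst|exact: cvg_id].
  - move=> s; rewrite -[q (t - s)]opprK; apply: is_deriveN.
    have -> : (fun s => primitive q (t - s)) = (fun r => primitive q (r - - t)) \o -%R.
      by apply/funext => r /=; rewrite opprK addrC.
    apply: is_derive_opparg; apply: is_derive_subarg.
    by rewrite opprK addrC; exact: is_derive_primitive.
have <- : \int[mu]_(s in `[0, t - a]) q s = primitive q (t - a) - primitive q 0.
  by apply: Rintegral_FTC; [rewrite subr_ge0| |exact: is_derive_primitive].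
have E : forall r, 0 <= r -> q r = opnorm (Q r) by move=> r r0; rewrite /q ger0_norm.
rewrite Rintegral_mkcond /op_L1norm; apply: le_Rintegral => //.
- by apply: intg_restrict => //; exact: intg_continuous.
- move=> r _; rewrite patchE; case: ifPn => [|_].
    by rewrite inE/= in_itv/= => /andP[r0 _]; rewrite E.
  by rewrite opnorm_ge0//; have [] := hQ r.
Qed.

Definition memory (u : R -> H) t := wint setT (fun s => Q (t - s) (u s)).

Let Qadj_wmeas (psi : R -> H) s : wmeas psi -> wmeas (fun t : R => Q (t - s) (psi t)).
Proof. by apply: wmeas_kernel; exact: measurable_funB. Qed.

(** The integrand is bounded, compactly supported and continuous except possibly at [t = s], where
    the kernel may jump, so [bochnerE] applies. *)
Lemma memory_adjointE (psi : R -> H) (b : R) s : continuous psi ->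
  (forall t, b <= `|t| -> psi t = 0) ->
  intg setT (fun t => `|Q (t - s) (psi t)|) /\
  memory_adjoint Q psi s = wint setT (fun t => Q (t - s) (psi t)).
Proof.
move=> cpsi psi0.
have cF := @Qabs_continuous psi s cpsi.
have [|M M0 hM] := continuous_bounded_supp (b := b) cF.
  by move=> t /psi0 ->; rewrite linear0.
have FM t : `|Q (t - s) (psi t)| <= M.
  have [ts|ts] := ltP (t - s) 0; first by rewrite Q0// normr0.
  by have := hM t; rewrite (ger0_norm ts).
have F0 t : t < - b \/ b < t -> Q (t - s) (psi t) = 0.
  move=> h; rewrite psi0 ?linear0//.
  case: h => h; first by have := ler_norm (- t); rewrite normrN; lra.
  by rewrite (le_trans (ltW h))// ler_norm.
have mF : wmeas (fun t : R => Q (t - s) (psi t)) by apply: Qadj_wmeas; exact: wmeas_continuous.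
have iF : intg setT (fun t => `|Q (t - s) (psi t)|).
  apply: (@intg_le _ _ _ ((cst M) \_ `[- b, b])) => //; first exact: wmeas_norm.
    move=> t _; rewrite normr_id patchE; case: ifPn => [_|]; first exact: FM.
    rewrite notin_setE/= in_itv/= => /negP; rewrite negb_and -!ltNge => /orP h.
    by rewrite F0 ?normr0.
  by apply: intg_restrict => //; apply: intg_continuous; exact: cst_continuous.
split=> //; apply: (bochnerE sH mF iF FM F0).
exists [set s]; split=> //; first exact: lebesgue_measure_set1.
move=> t /= tF; apply: contra_notP tF => /eqP ts.
have transfer (G : R -> H) : continuous G -> (\near t, G t = Q (t - s) (psi t)) ->
    {for t, continuous (fun t => Q (t - s) (psi t))}.
  move=> cG E; rewrite /prop_for /continuous_at -(nbhs_singleton E).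
  exact: cvg_trans (near_eq_cvg E) (cG t).
move: ts; rewrite neq_lt => /orP[ts|st].
  apply: (transfer (fun=> 0)); first exact: cst_continuous.
  by apply: filterS (lt_nbhsl ts) => r rs; rewrite Q0// subr_lt0.
apply: (transfer _ cF); apply: filterS (lt_nbhsr st) => r rs.
by rewrite gtr0_norm// subr_gt0.
Qed.

Lemma wmeas_memory_adjoint (psi : R -> H) (b : R) : continuous psi ->
  (forall t, b <= `|t| -> psi t = 0) -> wmeas (memory_adjoint Q psi).
Proof.
move=> cpsi psi0.
rewrite (_ : memory_adjoint Q psi = fun s => wint setT (fun t => Q (t - s) (psi t))); last first.
  by apply/funext => s; have [] := memory_adjointE s cpsi psi0.
apply: (wmeas_wint (K := fun p => Q (p.2 - p.1) (psi p.2))).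
  apply: wmeas_kernel; first exact: measurable_funB.
  by apply: wmeas_comp => //; exact: wmeas_continuous.
by move=> s; have [] := memory_adjointE s cpsi psi0.
Qed.

Section PastInput.
Variables (u : R -> H) (T0 : R).
Hypothesis pu : pastL1 u.
Hypothesis u0 : forall t, t < T0 -> u t = 0.

(** Since [u] vanishes before [T0], only lags in [[0, T - T0]] matter, and there the continuous
    function [q] is bounded. *)
Let bound T : exists2 M : R, 0 <= M & forall t s, t <= T ->
  `|Q (t - s) (u s)| <= M * ((fun s => `|u s|) \_ `]-oo, t]) s.
Proof.
have [M M0 hM] := continuous_bounded (T - T0) q_cont.
exists M => // t s tT; rewrite patchE; case: ifPn => st.
  apply: le_trans (Q_le _ _) _; have [sT|sT] := ltP s T0; first by rewrite u0// normr0 !mulr0.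
  rewrite ler_wpM2r//; apply: le_trans (ler_norm _) _; apply: hM.
  move: st; rewrite inE/= in_itv/= => st.
  by rewrite ger0_norm ?subr_ge0//; lra.
move: st; rewrite notin_setE/= in_itv/= => /negP; rewrite -ltNge => st.
by rewrite Q0 ?normr0 ?mulr0// subr_lt0.
Qed.

Lemma memory_intg t : intg setT (fun s => `|Q (t - s) (u s)|).
Proof.
have [M M0 hM] := bound t; have [mu_ iu] := pu.
apply: (@intg_le _ _ _ (fun s => M * ((fun s => `|u s|) \_ `]-oo, t]) s)) => //.
- by apply: wmeas_norm => //; exact: wmeas_section.
- by move=> s _; rewrite normr_id; exact: hM.
- by apply: intgZ => //; exact: intg_restrict.
Qed.

Lemma memory0 t : t < T0 -> memory u t = 0.
Proof.
move=> tT; apply: wint_null => // s _; have [sT|sT] := ltP s T0; first by rewrite u0// linear0.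
by rewrite Q0// subr_lt0; exact: lt_le_trans sT.
Qed.

Lemma memory_pastL1 : pastL1 (memory u).
Proof.
have [mu_ iu] := pu.
apply: (@pastL1_cut _ _ _ _ T0) => //; last 2 first.
- exact: memory0.
- move=> T; have [M M0 hM] := bound T.
  exists (M * \int[mu]_(s in `]-oo, T]) `|u s|) => t /andP[_ tT].
  apply: le_trans; first by apply: norm_wint_le => //; [exact: wmeas_section|exact: memory_intg].
  have iR : intg setT ((fun s => `|u s|) \_ `]-oo, T]) by exact: intg_restrict.
  rewrite [in leRHS]Rintegral_mkcond -RintegralZl//.
  apply: le_Rintegral => //; [exact: memory_intg|exact: intgZ|].
  move=> s _; apply: le_trans (hM _ _ tT) _; rewrite ler_wpM2l// !patchE.
  case: ifPn => [|_]; last by case: ifP => _; [exact: normr_ge0|exact: lexx].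
  rewrite inE/= in_itv/= => st; by rewrite mem_set//= in_itv/= (le_trans st).
apply: (wmeas_wint (K := fun p => Q (p.1 - p.2) (u p.2))); last first.
  exact: memory_intg.
apply: wmeas_kernel; first exact: measurable_funB.
exact: wmeas_comp.
Qed.

(** The exponential weight increases, so its value at [t] dominates all earlier ones and factors out
    of the integral, leaving the mass of [q]. *)
Lemma memory_le (M l T t : R) : 0 <= M -> 0 <= l ->
  (forall s, T0 <= s <= T -> `|u s| <= M * expR (l * (s - T0))) -> T0 <= t <= T ->
  `|memory u t| <= op_L1norm Q * (M * expR (l * (t - T0))).
Proof.
move=> M0 l0 hu /andP[Tt tT]; have [mu_ iu] := pu.
set E := M * expR _; have E0 : 0 <= E by rewrite mulr_ge0// expR_ge0.
apply: le_trans; first by apply: norm_wint_le => //; [exact: wmeas_section|exact: memory_intg].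
have cq : continuous (fun s => q (t - s)).
  by apply: comp_continuous q_cont => s; apply: cvgB; [exact: cvg_cst|exact: cvg_id].
apply: (@le_trans _ _ (\int[mu]_(s in `[T0, t]) (E * q (t - s)))).
  rewrite [leRHS]Rintegral_mkcond; apply: le_Rintegral => //; first exact: memory_intg.
    by apply: intg_restrict => //; apply: intgZ => //; exact: intg_continuous.
  move=> s _; rewrite patchE; case: ifPn => [|].
    rewrite inE/= in_itv/= => /andP[Ts st]; apply: le_trans (Q_le _ _) _.
    rewrite mulrC ler_wpM2r//; apply: le_trans (hu _ _) _; first by rewrite Ts (le_trans st).
    by rewrite ler_wpM2l// ler_expR ler_wpM2l// lerD2r.
  rewrite notin_setE/= in_itv/= => /negP; rewrite negb_and -!ltNge => /orP[h|h].
    by rewrite u0// linear0 normr0.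
  by rewrite Q0 ?normr0// subr_lt0.
rewrite RintegralZl//; last exact: intg_continuous.
by rewrite mulrC ler_wpM2r// q_mass.
Qed.

(** Symmetry of [Q (t - s)] puts the kernel on [u], and Fubini exchanges the integrals; the majorant
    is [|u s|] cut off after [b] times [M |psi t|]. *)
Lemma memory_pairing (psi : R -> H) (b : R) : continuous psi ->
  (forall t, b <= `|t| -> psi t = 0) ->
  intg setT (fun s => '[u s, memory_adjoint Q psi s]) /\
  \int[mu]_s '[u s, memory_adjoint Q psi s] = \int[mu]_t '[memory u t, psi t].
Proof.
move=> cpsi psi0; have [mw iu] := pu; have [M M0 hM] := bound b.
have mpsi := wmeas_continuous cpsi.
pose F s t := '[Q (t - s) (u s), psi t].
have FE s : '[u s, memory_adjoint Q psi s] = \int[mu]_t F s t.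
  have [iK ->] := memory_adjointE s cpsi psi0; rewrite wintP//; last exact: Qadj_wmeas.
  by apply: eq_Rintegral => t _; rewrite /F; have [_ h] := hQ (t - s); rewrite h.
have mF : measurable_fun setT (fun p : R * R => F p.1 p.2).
  apply: (@wmeas_inner _ _ _ _ (fun p : R * R => Q (p.2 - p.1) (u p.1)) (psi \o snd)) => //.
    by apply: wmeas_kernel; [exact: measurable_funB|exact: (@wmeas_comp _ _ _ _ _ _ fst u)].
  exact: wmeas_comp.
pose a := (fun s => `|u s|) \_ `]-oo, b].
have ia : intg setT a by exact: intg_restrict.
have ip : intg setT (fun t => M * `|psi t|).
  apply: intgZ => //; have [N N0 hN] := continuous_bounded_supp cpsi psi0.
  apply: (@intg_le _ _ _ ((cst N) \_ `[- b, b])) => //; first exact: wmeas_norm.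
    move=> t _; rewrite normr_id patchE; case: ifPn => [_|]; first exact: hN.
    rewrite notin_setE/= in_itv/= => /negP; rewrite negb_and -!ltNge => h.
    rewrite psi0 ?normr0//; case/orP: h => h.
      by have := ler_norm (- t); rewrite normrN; lra.
    by rewrite (le_trans (ltW h))// ler_norm.
  by apply: intg_restrict => //; apply: intg_continuous; exact: cst_continuous.
have a0 s : 0 <= a s by rewrite /a patchE; case: ifP => _; [exact: normr_ge0|exact: lexx].
have Fle s t : `|F s t| <= a s * (M * `|psi t|).
  have [tb|bt] := leP t b; last first.
    rewrite /F psi0 ?inner0r ?normr0 ?mulr0//.
    by rewrite (le_trans (ltW bt))// ler_norm.
  apply: le_trans (abs_inner_le _ _) _; rewrite mulrA ler_wpM2r//.
  apply: le_trans (hM _ _ tb) _; rewrite mulrC ler_wpM2r// /a !patchE.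
  case: ifPn => [|_]; last by case: ifP => _; [exact: normr_ge0|exact: lexx].
  by rewrite inE/= in_itv/= => st; rewrite mem_set//= in_itv/= (le_trans st).
have iFs s : intg setT (F s).
  apply: (@intg_le _ _ _ (fun t => a s * (M * `|psi t|))) => //.
    exact: (measurableT_comp mF (pair1_measurable s)).
  exact: intgZ.
split.
  apply: (@intg_le _ _ _ (fun s => (\int[mu]_t (M * `|psi t|)) * a s)) => //.
  - under eq_fun do rewrite FE.
    exact: (@measurable_Rintegral _ (fun p => F p.1 p.2)).
  - move=> s _; rewrite FE mulrC -RintegralZl//; apply: le_Rintegral_norm => //.
    exact: intgZ.
  - exact: intgZ.
under eq_Rintegral do rewrite FE.
rewrite (@Rintegral_fubini _ F a (fun t => M * `|psi t|))//.
apply: eq_Rintegral => t _; rewrite innerC wintP//; last 2 first.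
- exact: wmeas_section.
- exact: memory_intg.
by apply: eq_Rintegral => s _; rewrite innerC.
Qed.

End PastInput.

Lemma memoryB (u v : R -> H) (T0 : R) t : pastL1 u -> pastL1 v ->
  (forall t, t < T0 -> u t = 0) -> (forall t, t < T0 -> v t = 0) ->
  memory (fun s => u s - v s) t = memory u t - memory v t.
Proof.
move=> pu pv u0 v0; have [mw _] := pu; have [mv _] := pv.
rewrite /memory -wintB//.
- by congr wint; apply/funext => s; rewrite linearB.
- exact: wmeas_section.
- exact: wmeas_section.
- exact: (memory_intg pu u0).
- exact: (memory_intg pv v0).
Qed.

Lemma memory_ae_eq (u v : R -> H) t : wmeas u -> wmeas v ->
  {ae mu, forall s, u s = v s} -> memory u t = memory v t.
Proof.
move=> mw mv uv; apply: wint_ae_eq => //; [exact: wmeas_section|exact: wmeas_section|].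
by apply: ae_sub uv => s ->.
Qed.

End Memory.

(** * Well-posedness *)

Section CausalFunctions.
Context {R : realType} {H : hilbertType R}.
Local Notation mu := (@lebesgue_measure R).
Local Notation intg D f := (mu.-integrable D (EFin \o f)).
Hypothesis sH : separable H.
Implicit Types f u : R -> H.

Lemma pastL1D f u : pastL1 f -> pastL1 u -> pastL1 (fun t => f t + u t).
Proof.
move=> [mf if_] [mw iu]; have mfu := wmeasD mf mw; split=> // t.
apply: (@intg_le _ _ _ (fun t => `|f t| + `|u t|)) => //; first exact: wmeas_norm.
- by move=> s _; rewrite normr_id; exact: ler_normD.
- exact: intgD.
Qed.

Lemma pastL1B f u : pastL1 f -> pastL1 u -> pastL1 (fun t => f t - u t).
Proof.
move=> [mf if_] [mw iu]; have mfu := wmeasB mf mw; split=> // t.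
apply: (@intg_le _ _ _ (fun t => `|f t| + `|u t|)) => //; first exact: wmeas_norm.
- by move=> s _; rewrite normr_id; exact: ler_normB.
- exact: intgD.
Qed.

Lemma pastL1_op (L : {linear H -> H}) f : bounded_op L -> pastL1 f -> pastL1 (fun t => L (f t)).
Proof.
move=> bL [mf if_]; have mL := wmeas_bounded bL mf; split=> // t.
apply: (@intg_le _ _ _ (fun t => opnorm L * `|f t|)) => //; first exact: wmeas_norm.
- by move=> s _; rewrite normr_id; exact: le_opnorm.
- exact: intgZ.
Qed.

(** Lindelof: the complement of [esupp f] is covered by countably many balls with rational centres
    and radii [1 / (k + 1)] on which [f] vanishes almost everywhere. *)
Lemma ae_esupp f (T0 : R) : esupp f `<=` `[T0, +oo[ -> {ae mu, forall t, t < T0 -> f t = 0}.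
Proof.
move=> sf; pose good c r := {ae mu, forall s : R, ball c r s -> f s = 0}.
pose B n : set R := if @unpickle (rat * nat)%type n is Some (x, k) then
  if `[< good (ratr x : R) k.+1%:R^-1 >] then ball (ratr x : R) k.+1%:R^-1 else set0 else set0.
have aB n : {ae mu, forall t, B n t -> f t = 0}.
  rewrite /B; case: unpickle => [[x k]|]; last exact: aeW.
  by case: asboolP => // _; exact: aeW.
apply: ae_sub (ae_all aB) => t Bt tT.
have /existsNP[e /not_implyP[e0 /contrapT ef]] : ~ esupp f t.
  by move=> /sf; rewrite /= in_itv/= andbT leNgt tT.
have [k hk] : exists k : nat, k.+1%:R^-1 < e / 2.
  have e2 : 0 < e / 2 by rewrite divr_gt0.
  by have [k _ hk] := near_infty_natSinv_lt (PosNum e2); exists k; exact: (hk k (leqnn k)).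
have kpos : 0 < k.+1%:R^-1 :> R by rewrite invr_gt0.
have [x] : exists x : rat, ratr x \in `]t - k.+1%:R^-1, t + k.+1%:R^-1[.
  by apply: rat_in_itvoo; rewrite ltrBlDr -addrA ltrDl addr_gt0.
rewrite in_itv/= => /andP[x1 x2].
have xt : ball (ratr x : R) k.+1%:R^-1 t.
  by rewrite -ball_normE /= ltr_norml; move: (k.+1%:R^-1) x1 x2 => r; lra.
apply: (Bt (pickle (x, k))); rewrite /B pickleK; case: asboolP => // gx; exfalso; apply: gx.
apply: ae_sub ef => s h sx; apply: h; move: sx xt; rewrite -!ball_normE /= => h1 h2.
have := ler_distD (ratr x) t s; rewrite (distrC t (ratr x)); move: (k.+1%:R^-1) hk h1 h2 => r; lra.
Qed.

Lemma esupp_ae f (T0 : R) : {ae mu, forall t, t < T0 -> f t = 0} -> esupp f `<=` `[T0, +oo[.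
Proof.
move=> f0 t /= ht; rewrite in_itv/= andbT leNgt; apply/negP => tT.
apply: (ht (T0 - t)); first by rewrite subr_gt0.
apply: ae_sub f0 => s h; rewrite -ball_normE /= => st; apply: h.
have := ler_norm (- (t - s)); rewrite normrN; lra.
Qed.

(** Supports only control functions almost everywhere; this selects a representative that vanishes
    at every time before [T0]. *)
Definition restrict_from (T0 : R) f t := if T0 <= t then f t else 0.

Lemma restrict_from_lt T0 f t : t < T0 -> restrict_from T0 f t = 0.
Proof. by rewrite /restrict_from leNgt => ->. Qed.

Lemma restrict_from_ge T0 f t : T0 <= t -> restrict_from T0 f t = f t.
Proof. by rewrite /restrict_from => ->. Qed.

Lemma wmeas_restrict_from T0 f : wmeas f -> wmeas (restrict_from T0 f).
Proof. by move=> mf; apply: wmeas_if => //; exact: measurable_fun_ler. Qed.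

Lemma L2loc_itv T0 f t : L2loc f -> intg `[T0, t] (fun s => `|f s| ^+ 2).
Proof.
move=> [/borel_wmeas mf hf]; apply/integrableP; split.
  apply/measurable_EFinP; apply: measurable_funX.
  exact: (@measurable_funTS _ _ _ _ _ (fun s => `|f s|) (wmeas_norm sH mf)).
under eq_integral do rewrite /= ger0_norm ?exprn_ge0//.
by apply: hf; exact: segment_compact.
Qed.

Lemma L2loc_pastL1 T0 f : L2loc f -> pastL1 (restrict_from T0 f).
Proof.
move=> hf; have [/borel_wmeas mf _] := hf.
have mr := wmeas_restrict_from T0 mf; split=> // t.
(* The inequality [|f| <= 1 + |f|^2] makes local square integrability yield integrability. *)
have i1 : intg `[T0, t] (fun s => 1 + `|f s| ^+ 2).
  by apply: intgD => //; [apply: intg_continuous; exact: cst_continuous|exact: L2loc_itv].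
apply: (@intg_le _ _ _ ((fun s => 1 + `|f s| ^+ 2) \_ `[T0, t])) => //.
- exact: wmeas_norm.
- move=> s; rewrite /= in_itv/= => st; rewrite normr_id patchE.
  have [sT|sT] := ltP s T0.
    rewrite restrict_from_lt// normr0; case: ifP => _; [by rewrite addr_ge0// exprn_ge0|exact: lexx].
  rewrite mem_set/= ?in_itv/= ?sT// restrict_from_ge//.
  by have := sqr_ge0 (`|f s| - 1); rewrite sqrrB1 -mulr_natl; have := normr_ge0 (f s); lra.
- by apply: (@integrableS _ _ _ mu setT) => //; exact: intg_restrict.
Qed.

Lemma continuous_L2plus u (T0 : R) : continuous u -> (forall t, t < T0 -> u t = 0) -> L2plus u.
Proof.
move=> cu u0; have mw := wmeas_continuous cu.
have c2 : continuous (fun t => `|u t| ^+ 2).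
  by under eq_fun do rewrite -inner_norm; exact: continuous_inner.
have fin (D : set R) : intg D (fun t => `|u t| ^+ 2) -> (\int[mu]_(t in D) (`|u t| ^+ 2)%:E < +oo)%E.
  by move=> /integrableP[_]; under eq_integral do rewrite /= ger0_norm ?exprn_ge0//.
split.
  split=> [|K cK]; first exact: wmeas_borel.
  by apply: fin; apply: continuous_compact_integrable => //; exact: continuous_subspaceT.
move=> T; apply: fin; apply: (@intg_le _ _ _ ((fun s => `|u s| ^+ 2) \_ `[T0, T])) => //.
- by apply: continuous_measurable_fun.
- move=> s; rewrite /= in_itv/= => st; rewrite ger0_norm ?exprn_ge0// patchE.
  have [sT|sT] := ltP s T0; first by rewrite u0// normr0 expr0n; case: ifP.
  by rewrite mem_set/= ?in_itv/= ?sT.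
- by apply: (@integrableS _ _ _ mu setT) => //; apply: intg_restrict => //; exact: intg_continuous.
Qed.

(** Cauchy-Schwarz by integrating [2 k |f| <= k^2 + |f|^2] and choosing [k = I / (t - T0)]; the case
    [t = T0] is separate. *)
Lemma sqr_Rintegral_le f (T0 t : R) : L2loc f -> T0 <= t ->
  (\int[mu]_(s in `]-oo, t]) `|restrict_from T0 f s|) ^+ 2 <=
  (t - T0) * \int[mu]_(s in `[T0, t]) `|f s| ^+ 2.
Proof.
move=> hf Tt; have [mr ir] := L2loc_pastL1 T0 hf.
have i2 := L2loc_itv T0 t hf.
have i1 : intg `[T0, t] (fun s => `|restrict_from T0 f s|).
  by apply: integrableS (ir t) => // s /=; rewrite !in_itv/= => /andP[].
have -> : \int[mu]_(s in `]-oo, t]) `|restrict_from T0 f s| =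
    \int[mu]_(s in `[T0, t]) `|restrict_from T0 f s|.
  rewrite [LHS]Rintegral_mkcond [RHS]Rintegral_mkcond; apply: eq_Rintegral => s _.
  rewrite !patchE; have [sT|sT] := ltP s T0.
    by rewrite restrict_from_lt// normr0; case: ifP; case: ifP.
  by congr (if _ then _ else _); apply/idP/idP; rewrite !inE/= !in_itv/= sT.
set I := \int[mu]_(s in _) _; set J := \int[mu]_(s in _) _.
have I0 : 0 <= I by exact: Rintegral_ge0.
have J0 : 0 <= J by apply: Rintegral_ge0 => s _; rewrite exprn_ge0.
have key k : 2 * k * I <= k ^+ 2 * (t - T0) + J.
  have icst : intg `[T0, t] (fun=> k ^+ 2) by apply: intg_continuous; exact: cst_continuous.
  have -> : k ^+ 2 * (t - T0) = \int[mu]_(s in `[T0, t]) (k ^+ 2).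
    rewrite Rintegral_cst//= lebesgue_measure_itv/= lte_fin; case: ltP => //= tT.
    by rewrite (_ : t = T0) ?subrr//; lra.
  rewrite /I /J -RintegralZl// -RintegralD//; apply: le_Rintegral => //.
  - exact: intgZ.
  - exact: intgD.
  move=> s; rewrite /= in_itv/= => /andP[sT _]; rewrite restrict_from_ge//.
  by have := sqr_ge0 (k - `|f s|); rewrite sqrrB -mulr_natl; lra.
have [L0|L0] := ltP 0 (t - T0).
  have := key (I / (t - T0)); have L1 : t - T0 != 0 by rewrite gt_eqF.
  rewrite (_ : _ ^+ 2 * _ = I ^+ 2 / (t - T0)); last by field.
  rewrite (_ : 2 * _ * I = 2 * (I ^+ 2 / (t - T0))); last by field.
  move=> h; have : I ^+ 2 / (t - T0) <= J by lra.
  by rewrite ler_pdivrMr// mulrC.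
have tT : T0 = t by lra.
rewrite /I -tT set_itv1 Rintegral_set1 expr0n/= mulr_ge0//; lra.
Qed.

End CausalFunctions.

Section WellPosedness.
Context {R : realType} {H V : hilbertType R}.
Local Notation mu := (@lebesgue_measure R).
Local Notation intg D f := (mu.-integrable D (EFin \o f)).
Hypothesis sH : separable H.
Variables (j P : {linear V -> H}) (A B : {linear H -> H}) (Q : R -> {linear H -> H}).
Variables (c C : R) (S : R -> H -> H).
Hypothesis jinj : injective j.
Hypothesis cj : continuous j.
Hypothesis jdense : dense (range j).
Hypothesis bA : bounded_op A.
Hypothesis sA : symmetric_op A.
Hypothesis c0 : 0 < c.
Hypothesis cC : c <= C.
Hypothesis Acoer : forall x : H, c * '[x, x] <= '[A x, x] <= C * '[x, x].
Hypothesis bB : bounded_op B.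
Hypothesis hQ : forall t, bounded_op (Q t) /\ symmetric_op (Q t).
Hypothesis Q1 : op_L1 Q.
Hypothesis Qc : op_continuous_on `[0, +oo[ Q.
Hypothesis Q0 : forall t x, t < 0 -> Q t x = 0.
Hypothesis skewP : skew_adjoint j P.
Hypothesis gneP : graph_norm_equiv j P.
Hypothesis SB : forall t x y, S t (x - y) = S t x - S t y.
Hypothesis SZ : forall t k x, S t (k *: x) = k *: S t x.
Hypothesis Sform : forall t x y, '[A (S t x), S t y] = '[A x, y].
Hypothesis Sadj : forall t x y, '[A (S t x), y] = '[A x, S (- t) y].
Hypothesis Scont : forall x, continuous (fun t => S t x).
Hypothesis Sder : forall v (t : R),
  is_derive t 1 (fun t => S t (j v)) (S t (generator P sA c0 Acoer v)).

Local Notation mildS := (mild S sA c0 Acoer).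
Local Notation kap := (kappa c C).

Definition feedback (u : R -> H) t := B (u t) + memory Q u t.

Lemma intg_test (k : R -> H) (phi : R -> V) : pastL1 k -> test_function phi ->
  intg setT (fun t => '[k t, j (phi t)]).
Proof.
move=> pk /test_functionP[b [b0 cphi _ _ phi0]].
have cjphi := comp_continuous cphi cj.
have [|M _ hM] := continuous_bounded_supp (b := b) cjphi.
  by move=> t /phi0[-> _]; rewrite linear0.
apply: (intg_pairing sH pk (wmeas_continuous cjphi) hM (b := b)) => t bt.
have [|-> _] := phi0 t; last by rewrite linear0.
by rewrite (le_trans (ltW bt))// ler_norm.
Qed.

Lemma continuous_principal (phi : R -> V) : test_function phi ->
  continuous (fun t => A (j (derive1 phi t)) + P (phi t)).
Proof.
move=> /test_functionP[b [_ cphi cdphi _ _]] t.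
apply: cvgD; last exact: (comp_continuous cphi (graph_norm_continuous gneP)).
exact: (comp_continuous (comp_continuous cdphi cj) (continuous_form bA)).
Qed.

Lemma wmeas_test_form (phi : R -> V) : test_function phi ->
  wmeas (fun t => A (j (derive1 phi t)) + P (phi t) - adjoint B (j (phi t))
             - memory_adjoint Q (j \o phi) t).
Proof.
move=> tphi; have [b [_ cphi _ _ phi0]] := test_functionP tphi.
have cjphi : continuous (j \o phi) by exact: comp_continuous cphi cj.
apply: wmeasB; last first.
  apply: (@wmeas_memory_adjoint _ _ sH Q hQ Qc Q0 _ b) => // t /phi0[h _].
  by rewrite /= h linear0.
apply: wmeasB; first exact: wmeas_continuous (continuous_principal tphi).
by move=> x; under eq_fun do rewrite adjointP//; exact: wmeas_continuous cjphi (B x).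
Qed.

Section PastInput.
Variables (u : R -> H) (T0 : R).
Hypothesis pu : pastL1 u.
Hypothesis u0 : forall t, t < T0 -> u t = 0.

Lemma feedback_pastL1 : pastL1 (feedback u).
Proof.
by apply: pastL1D => //; [exact: pastL1_op|exact: (memory_pastL1 sH hQ Qc Q0 pu u0)].
Qed.

Lemma feedback0 t : t < T0 -> feedback u t = 0.
Proof. by move=> tT; rewrite /feedback u0// linear0 add0r (memory0 Q0 u0). Qed.

Lemma feedback_le (M l T t : R) : 0 <= M -> 0 <= l ->
  (forall s, T0 <= s <= T -> `|u s| <= M * expR (l * (s - T0))) -> T0 <= t <= T ->
  `|feedback u t| <= (opnorm B + op_L1norm Q) * (M * expR (l * (t - T0))).
Proof.
move=> M0 l0 hu tT; rewrite mulrDl; apply: le_trans (ler_normD _ _) _; apply: lerD.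
  apply: le_trans (le_opnorm _ bB) _; rewrite ler_wpM2l ?opnorm_ge0//; exact: hu.
exact: (memory_le sH hQ Q1 Qc Q0 pu u0 M0 l0 hu tT).
Qed.

(** Both adjoints are moved back onto [u], so that the weak equation becomes that of [A u' + P u]
    with the feedback as a source. *)
Lemma weak_form_feedback (phi : R -> V) : test_function phi ->
  [/\ intg setT (fun t => '[u t, A (j (derive1 phi t)) + P (phi t)]),
      intg setT (fun t => '[u t, A (j (derive1 phi t)) + P (phi t) - adjoint B (j (phi t))
             - memory_adjoint Q (j \o phi) t]) &
      \int[mu]_t '[u t, A (j (derive1 phi t)) + P (phi t) - adjoint B (j (phi t))
             - memory_adjoint Q (j \o phi) t] =
      \int[mu]_t '[u t, A (j (derive1 phi t)) + P (phi t)] -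
      \int[mu]_t '[feedback u t, j (phi t)]].
Proof.
move=> tphi; have [b [b0 cphi cdphi dphi phi0]] := test_functionP tphi.
have cjphi : continuous (j \o phi) by exact: comp_continuous cphi cj.
have jphi0 t : b <= `|t| -> (j \o phi) t = 0 by move=> /phi0[h _]; rewrite /= h linear0.
have cG := continuous_principal tphi.
have G0 t : b <= `|t| -> A (j (derive1 phi t)) + P (phi t) = 0.
  by move=> /phi0[h h']; rewrite h h' !linear0 addr0.
have i1 : intg setT (fun t => '[u t, A (j (derive1 phi t)) + P (phi t)]).
  have [M _ hM] := continuous_bounded_supp cG G0.
  apply: (intg_pairing sH pu (wmeas_continuous cG) hM (b := b)) => t bt.
  by apply: G0; rewrite (le_trans (ltW bt))// ler_norm.
have i2 := intg_test (pastL1_op sH bB pu) tphi.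
have i3 := intg_test (memory_pastL1 sH hQ Qc Q0 pu u0) tphi.
have [i4 e4] := memory_pairing sH hQ Qc Q0 pu u0 cjphi jphi0.
have E t : '[u t, A (j (derive1 phi t)) + P (phi t) - adjoint B (j (phi t))
             - memory_adjoint Q (j \o phi) t] =
    '[u t, A (j (derive1 phi t)) + P (phi t)] - '[B (u t), j (phi t)] -
    '[u t, memory_adjoint Q (j \o phi) t].
  by rewrite innerBr innerBr adjointP.
split=> //.
  under [X in EFin \o X]eq_fun do rewrite E.
  by apply: intgB => //; exact: intgB.
under eq_Rintegral do rewrite E.
rewrite RintegralB//; last exact: intgB.
rewrite RintegralB// e4 -addrA -opprD -RintegralD//; congr (_ - _).
by apply: eq_Rintegral => t _; rewrite /feedback innerDl.
Qed.

End PastInput.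

Lemma feedback_cst0 s : feedback (fun=> 0) s = 0.
Proof.
have lt_s : s < s + 1 by rewrite ltrDl.
exact: (@feedback0 (fun=> 0) (s + 1) (fun _ _ => erefl) s lt_s).
Qed.

Let kap0 : 0 <= kap.
Proof.
rewrite /kappa mulr_ge0 ?invr_ge0 ?(ltW c0)// exprn_ge0// divr_ge0 ?(ltW c0)//.
exact: le_trans (ltW c0) cC.
Qed.

Lemma mild0 g (T0 t : R) : (forall s, s < T0 -> g s = 0) -> t < T0 -> mildS g t = 0.
Proof.
move=> g0 tT; have S0 s : S s 0 = 0 by rewrite -[0 in LHS](subrr 0) SB subrr.
rewrite /mild wint_null// => s; rewrite /= in_itv/= => st.
rewrite g0; last exact: le_lt_trans tT.
by rewrite -[0 in LHS](subrr 0) AinvB subrr S0.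
Qed.

(** Integrating the exponential weight gains a factor [1 / l], from which the contraction comes. *)
Lemma mild_exp_le g (T0 T D l t : R) : pastL1 g -> (forall s, s < T0 -> g s = 0) ->
  0 < l -> 0 <= D -> (forall s, T0 <= s <= T -> `|g s| <= D * expR (l * (s - T0))) ->
  t <= T -> `|mildS g t| <= kap * D / l * expR (l * (t - T0)).
Proof.
move=> pg g0 l0 D0 gD tT; have [tT0|tT0] := ltP t T0.
  rewrite (mild0 g0)// normr0 mulr_ge0 ?expR_ge0// divr_ge0 ?(ltW l0)//.
  by rewrite mulr_ge0.
have [mg ig] := pg.
apply: le_trans; first exact: mild_le.
rewrite (_ : kap * D / l * _ = kap * (D / l * expR (l * (t - T0)))); last by ring.
rewrite ler_wpM2l//.
have ce : continuous (fun s : R => expR (l * (s - T0))).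
  apply: (@comp_continuous R R R (fun s => l * (s - T0)) expR); last exact: continuous_expR.
  by move=> s; apply: cvgMr; apply: cvgB; [exact: cvg_id|exact: cvg_cst].
have de (s : R) : is_derive s 1 (fun s => l^-1 * expR (l * (s - T0))) (expR (l * (s - T0))).
  have d1 : is_derive s 1 (fun s => l * (s - T0)) l.
    by have := is_deriveZ l (is_deriveB (is_derive_id s 1) (is_derive_cst T0 s 1)); rewrite subr0 scaler1.
  have := is_deriveZ l^-1 (@is_derive1_comp _ expR (fun s => l * (s - T0)) s _ _ (is_derive_expR _) d1).
  by rewrite /GRing.scale/= mulrCA mulVf ?mulr1// gt_eqF.
have ie := intg_continuous T0 t ce.
apply: (@le_trans _ _ (\int[mu]_(s in `[T0, t]) (D * expR (l * (s - T0))))).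
  rewrite [leLHS]Rintegral_mkcond [leRHS]Rintegral_mkcond; apply: le_Rintegral => //.
  - exact: intg_restrict.
  - by apply: intg_restrict => //; exact: intgZ.
  move=> s _; rewrite !patchE; have [sT|sT] := ltP s T0.
    rewrite g0// normr0; case: ifP => _; (case: ifP => _; last exact: lexx);
      by rewrite mulr_ge0// expR_ge0.
  case: ifPn => [|_]; last first.
    by case: ifP => _; [rewrite mulr_ge0// expR_ge0|exact: lexx].
  rewrite inE/= in_itv/= => st; rewrite mem_set/= ?in_itv/= ?sT// gD// sT.
  exact: le_trans st tT.
rewrite RintegralZl// (Rintegral_FTC tT0 ce de) -mulrA ler_wpM2l//.
by rewrite lerBlDr lerDl mulr_ge0 ?expR_ge0// invr_ge0 ltW.
Qed.

(** Chosen so that [kappa (|B| + |Q|) / rate <= 1/2] with operator and [L^1] norms; the added 1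
    keeps it positive. *)
Definition rate : R := 2 * kap * (opnorm B + op_L1norm Q) + 1.

Let norms0 : 0 <= opnorm B + op_L1norm Q.
Proof.
rewrite addr_ge0 ?opnorm_ge0// /op_L1norm; apply: Rintegral_ge0 => t _.
by apply: opnorm_ge0; have [] := hQ t.
Qed.

Let rate0 : 0 < rate.
Proof. by rewrite /rate ltr_wpDl// mulr_ge0// mulr_ge0. Qed.

Section FixedPoint.
Variables (T0 : R) (f : R -> H).
Hypothesis pf : pastL1 f.
Hypothesis f0 : forall t, t < T0 -> f t = 0.

Let w t := expR (rate * (t - T0)).

(** The fixed point theorem wants a map on all continuous functions, while the feedback needs a
    vanishing past. Fixed points vanish before [T0] and are unaffected by the cut. *)
Let cut (u : R -> H) := restrict_from T0 u.

Let cut_past u : continuous u -> pastL1 (cut u).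
Proof.
move=> cu; apply: (@pastL1_cut _ _ sH _ T0).
- by apply: wmeas_restrict_from; exact: wmeas_continuous.
- by move=> t; exact: restrict_from_lt.
- move=> t; have [M M0 hM] := continuous_bounded (Num.max `|T0| `|t|) cu.
  exists M => s /andP[Ts st]; rewrite /cut restrict_from_ge//; apply: hM; rewrite ler_norml.
  have := ler_norm t; have := ler_norm (- T0); rewrite normrN => h1 h2.
  apply/andP; split; last by rewrite le_max (le_trans st h2) orbT.
  rewrite lerNl le_max; apply/orP; left; lra.
Qed.

Let cut0 u t : t < T0 -> cut u t = 0. Proof. exact: restrict_from_lt. Qed.

Definition mild_map (u : R -> H) := mildS (fun s => f s - feedback (cut u) s).

Let rhs_past u : continuous u -> pastL1 (fun s => f s - feedback (cut u) s).
Proof. by move=> cu; apply: pastL1B => //; apply: feedback_pastL1 (cut0 u); exact: cut_past. Qed.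

Let rhs0 u t : t < T0 -> f t - feedback (cut u) t = 0.
Proof. by move=> tT; rewrite f0// (feedback0 (cut0 u))// subrr. Qed.

Let Phi_cont u : continuous u -> continuous (mild_map u).
Proof. by move=> cu; apply: mild_continuous => //; exact: rhs_past. Qed.

Lemma mild_map0 u t : t < T0 -> mild_map u t = 0.
Proof. exact: mild0 (rhs0 u). Qed.

Let feedbackB u v t : continuous u -> continuous v ->
  feedback (cut u) t - feedback (cut v) t = feedback (cut (fun s => u s - v s)) t.
Proof.
move=> cu cv; have cutB : cut (fun s => u s - v s) = (fun s => cut u s - cut v s).
  by apply/funext => s; rewrite /cut /restrict_from; case: ifP => //; rewrite subr0.
rewrite /feedback cutB (memoryB sH hQ Qc Q0 t (cut_past cu) (cut_past cv) (cut0 u) (cut0 v)).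
by rewrite linearB; rewrite opprD addrACA.
Qed.

Let Phi_contr T u v (M : R) : continuous u -> continuous v -> 0 <= M ->
  (forall t, t <= T -> `|u t - v t| <= M * w t) ->
  forall t, t <= T -> `|mild_map u t - mild_map v t| <= M / 2 * w t.
Proof.
move=> cu cv M0 uv t tT.
rewrite /mild_map -(mildB sH bA sA c0 cC Acoer SB Sform Sadj Scont t (rhs_past cu) (rhs_past cv)).
have cuv : continuous (fun s => u s - v s) by move=> s; apply: cvgB; [exact: cu|exact: cv].
have := @mild_exp_le (fun s => f s - feedback (cut u) s - (f s - feedback (cut v) s)) T0 T
  ((opnorm B + op_L1norm Q) * M) rate t.
move=> /(_ (pastL1B sH (rhs_past cu) (rhs_past cv))) h.
apply: le_trans (h _ rate0 _ _ tT) _.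
- by move=> s sT; rewrite !rhs0// subrr.
- by rewrite mulr_ge0.
- move=> s sT; rewrite (_ : _ - _ = - (feedback (cut u) s - feedback (cut v) s)); last first.
    by rewrite !opprB addrC addrA subrK.
  rewrite normrN (feedbackB _ cu cv) -mulrA.
  apply: (feedback_le (cut_past cuv) (cut0 _) M0 (ltW rate0) _ sT) => r /andP[r1 r2].
  by rewrite /cut restrict_from_ge// uv.
rewrite ler_wpM2r ?expR_ge0// ler_pdivrMr// /rate.
have := mulr_ge0 (mulr_ge0 kap0 norms0) M0; lra.
Qed.

Lemma mild_exists : exists u : R -> H, [/\ continuous u, mild_map u = u &
  forall t, T0 <= t -> `|u t| <= 2 * (kap * (\int[mu]_(s in `]-oo, t]) `|f s|)) * w t].
Proof.
have Icover t : exists T : R, nbhs (t : R) [set s | s <= T].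
  by exists (t + 1); apply: lt_le_nbhsl; rewrite ltrDl.
have wI T : exists W : R, forall t, t <= T -> w t <= W.
  by exists (w T) => t tT; rewrite ler_expR ler_wpM2l ?(ltW rate0)// lerD2r.
have w0 t : 0 <= w t by exact: expR_ge0.
have bound T t : t <= T -> `|mild_map (cst 0) t| <= kap * (\int[mu]_(s in `]-oo, T]) `|f s|) * w t.
  move=> tT; have [tT0|tT0] := ltP t T0.
    by rewrite mild_map0// normr0 mulr_ge0// mulr_ge0// Rintegral_ge0.
  have fb0 s : feedback (cut (cst 0)) s = 0.
    have -> : cut (cst 0) = fun=> 0 by apply/funext => r; rewrite /cut /restrict_from; case: ifP.
    exact: feedback_cst0.
  have -> : mild_map (cst 0) t = mildS f t.
    by rewrite /mild_map; congr mild; apply/funext => s; rewrite fb0 subr0.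
  have [mf if_] := pf.
  apply: le_trans; first exact: mild_le.
  rewrite -mulrA ler_wpM2l//; apply: (@le_trans _ _ (\int[mu]_(s in `]-oo, T]) `|f s|)).
    by rewrite -subr_ge0 Rintegral_Ny_sub// Rintegral_ge0.
  by rewrite ler_peMr ?Rintegral_ge0// -expR0 ler_expR mulr_ge0 ?(ltW rate0)// subr_ge0.
have intf0 T : 0 <= kap * (\int[mu]_(s in `]-oo, T]) `|f s|) by rewrite mulr_ge0// Rintegral_ge0.
have [||||||u [cu fu hu]] := @volterra_exists R H mild_map (fun T => [set s | s <= T]) w.
- exact: Icover.
- exact: w0.
- exact: wI.
- exact: Phi_cont.
- exact: Phi_contr.
- by move=> T; exists (kap * (\int[mu]_(s in `]-oo, T]) `|f s|)) => //; exact: bound.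
exists u; split=> // t _.
(* Taking the set of times up to [t] itself makes the integral of the data stop at [t]. *)
by apply: (hu t) => //=; exact: bound.
Qed.

(** Both functions vanish before [T0], and the weight is at least 1 afterwards, so their weighted
    distance up to any time is finite, as [volterra_unique] requires. *)
Lemma mild_unique (u v : R -> H) : continuous u -> continuous v ->
  mild_map u = u -> mild_map v = v -> u = v.
Proof.
move=> cu cv fu fv; apply/funext => t; have [tT|tT] := ltP t T0.
  by rewrite -fu -fv !mild_map0.
have cuv : continuous (fun s => u s - v s) by move=> s; apply: cvgB; [exact: cu|exact: cv].
have [M M0 hM] := continuous_bounded (Num.max `|T0| `|t|) cuv.
apply: (@volterra_unique R H mild_map (fun T => [set s | s <= T]) w Phi_contr u v t M) => //=.
move=> s st; have [sT|sT] := ltP s T0.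
    by rewrite -fu -fv !mild_map0// subrr normr0 mulr_ge0// expR_ge0.
  have w1 : 1 <= w s by rewrite -expR0 ler_expR mulr_ge0 ?(ltW rate0)// subr_ge0.
  apply: (@le_trans _ _ M); last by rewrite ler_peMr.
  apply: hM; rewrite ler_norml.
  have := ler_norm t; have := ler_norm (- T0); rewrite normrN => h1 h2.
  apply/andP; split; last by rewrite le_max (le_trans st h2) orbT.
  rewrite lerNl le_max; apply/orP; left; lra.
Qed.

Lemma mild_map_weak u (phi : R -> V) : continuous u -> mild_map u = u -> test_function phi ->
  \int[mu]_t '[u t, A (j (derive1 phi t)) + P (phi t) - adjoint B (j (phi t))
             - memory_adjoint Q (j \o phi) t] = - \int[mu]_t '[f t, j (phi t)].
Proof.
move=> cu fu tphi.
have u0 t : t < T0 -> u t = 0 by move=> tT; rewrite -fu mild_map0.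
have cutu : cut u = u.
  by apply/funext => t; rewrite /cut /restrict_from; case: leP => // /u0.
have pu : pastL1 u by exact: pastL1_continuous cu u0.
have [_ _ ->] := weak_form_feedback pu u0 tphi.
have := mild_weak sH cj bA cC gneP SB SZ Sform Sadj Scont Sder (rhs_past cu) tphi.
rewrite -/(mild_map u) fu cutu => ->.
have i1 := intg_test pf tphi; have i2 := intg_test (feedback_pastL1 pu u0) tphi.
rewrite -opprD -RintegralD//; last first.
  by apply: intg_test => //; have := rhs_past cu; rewrite cutu.
congr (- _); apply: eq_Rintegral => t _.
by rewrite -innerDl subrK.
Qed.

End FixedPoint.

Lemma mild_ae_eq g h t : pastL1 g -> pastL1 h -> {ae mu, forall s, g s = h s} ->
  mildS g t = mildS h t.
Proof.
move=> pg ph gh; apply/eqP; rewrite -subr_eq0 -normr_le0.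
rewrite -(mildB sH bA sA c0 cC Acoer SB Sform Sadj Scont t pg ph).
have pgh := pastL1B sH pg ph; have [mgh _] := pgh.
apply: le_trans; first exact: mild_le.
rewrite (@Rintegral_ae_eq _ _ _ (fun=> 0))//.
- by rewrite Rintegral_null// mulr0.
- exact: wmeas_norm.
- by apply: ae_sub gh => s -> _; rewrite subrr normr0.
Qed.

(* With [z] the mild solution driven by the feedback of [x], the difference [x - z] solves
   the homogeneous equation; hence [x = z] almost everywhere and [z] is a fixed point. *)
Lemma weak_unique (x : R -> H) (T1 : R) : pastL1 x -> (forall t, t < T1 -> x t = 0) ->
  (forall phi : R -> V, test_function phi ->
    \int[mu]_t '[x t, A (j (derive1 phi t)) + P (phi t) - adjoint B (j (phi t))
             - memory_adjoint Q (j \o phi) t] = 0) ->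
  {ae mu, forall t, x t = 0}.
Proof.
move=> px x0 hx; have [mx _] := px.
have p0 : pastL1 (fun=> 0 : H).
  by apply: (@pastL1_continuous _ _ sH _ T1) => //; exact: cst_continuous.
have pfx := feedback_pastL1 px x0.
pose g s := 0 - feedback x s.
have pg : pastL1 g by exact: pastL1B.
have g0 s : s < T1 -> g s = 0 by move=> sT; rewrite /g (feedback0 x0)// subrr.
pose z := mildS g.
have cz : continuous z by exact: mild_continuous.
have z0 t : t < T1 -> z t = 0 by exact: mild0.
have pz : pastL1 z by exact: pastL1_continuous cz z0.
have [mz _] := pz.
have xz : {ae mu, forall t, x t - z t = 0}.
  apply: (homogeneous_unique sH jinj bA sA c0 Acoer skewP (pastL1B sH px pz) (T1 := T1)).
    by apply: aeW => t tT; rewrite x0// z0// subrr.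
  move=> phi tphi; under eq_Rintegral do rewrite innerBl.
  have [i1 _ e1] := weak_form_feedback px x0 tphi.
  have [i2 _ _] := weak_form_feedback pz z0 tphi.
  rewrite RintegralB//; move: e1; rewrite hx// => /esym/eqP; rewrite subr_eq0 => /eqP ->.
  rewrite (mild_weak sH cj bA cC gneP SB SZ Sform Sadj Scont Sder pg tphi) opprK.
  rewrite -RintegralD//; last 2 first.
  - exact: intg_test.
  - exact: intg_test.
  by apply: Rintegral_null => // t _; rewrite -innerDl /g sub0r subrr inner0l.
have {}xz : {ae mu, forall t, x t = z t}.
  by apply: ae_sub xz => t /eqP; rewrite subr_eq0 => /eqP.
have cutz : restrict_from T1 z = z.
  by apply/funext => t; rewrite /restrict_from; case: leP => // /z0.
(* Replacing [x] by [z] inside the feedback changes the source only on a null set, which the mild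
   solution does not see. *)
have fz : mild_map T1 (fun=> 0) z = z.
  apply/funext => t; rewrite /mild_map cutz; apply: mild_ae_eq => //.
    by apply: pastL1B => //; exact: feedback_pastL1 pz z0.
  have xz' := xz; apply: ae_sub xz' => s xs; rewrite /g /feedback xs.
  congr (_ - (_ + _)); apply: memory_ae_eq => //.
  by apply: ae_sub xz => r ->.
have f0 : mild_map T1 (fun=> 0) (cst 0) = cst 0.
  apply/funext => t; apply: (@mild0 _ (t + 1)); last by rewrite ltrDl.
  move=> s _; have -> : restrict_from T1 (cst 0) = (fun=> 0 : H).
    by apply/funext => r; rewrite /restrict_from; case: ifP.
  by rewrite feedback_cst0 subr0.
have zz := mild_unique p0 (fun _ _ => erefl) cz (@cst_continuous _ _ _) fz f0.
by apply: ae_sub xz => t ->; rewrite zz.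
Qed.

End WellPosedness.

Theorem theorem5 (R : realType) :
  exists C : R -> R -> R -> R -> R -> R -> R,
  forall (H V : hilbertType R) (j : {linear V -> H})
    (A B : {linear H -> H}) (P : {linear V -> H}) (Q : R -> {linear H -> H})
    (c_low c_up : R),
  separable H -> separable V ->
  injective j -> continuous j -> dense (range j) ->
  bounded_op A -> symmetric_op A -> 0 < c_low -> c_low <= c_up ->
  (forall x : H, c_low * '[x, x] <= '[A x, x] <= c_up * '[x, x]) ->
  bounded_op B ->
  (forall t, bounded_op (Q t) /\ symmetric_op (Q t)) ->
  op_L1 Q -> op_continuous_on `[0, +oo[ Q ->
  (forall t x, t < 0 -> Q t x = 0) ->
  skew_adjoint j P -> graph_norm_equiv j P ->
  forall (f : R -> H) (T0 : R),
  L2loc f -> causal f -> esupp f `<=` `[T0, +oo[ ->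
  exists u : R -> H,
    [/\ [/\ continuous u, weak_solution j P A B Q f u, causal u &
            esupp u `<=` `[T0, +oo[],
        (forall v : R -> H, weak_solution j P A B Q f v -> causal v ->
           {ae lebesgue_measure, forall t, v t = u t}) &
        forall T : R, T0 <= T ->
          let K := C T0 T c_low c_up (opnorm B) (op_L1norm Q) in
          0 <= K /\
          forall t : R, t <= T ->
            ((`|u t| ^+ 2)%:E <=
             K%:E * \int[lebesgue_measure]_(s in `]-oo, t])
                      (`|f s| ^+ 2)%:E)%E].
Proof.
(* The square of the bound [2 kappa e^(rate (t - T0)) \int |f|], with Cauchy-Schwarz in time
   contributing the length [T - T0]. *)
exists (fun T0 T c C b q => 4 * kappa c C ^+ 2 * (T - T0) *
  expR (2 * ((2 * kappa c C * (b + q) + 1) * (T - T0)))).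
move=> H V j A B P Q c C sH _ jinj cj jdense bA sA c0 cC Acoer bB hQ Q1 Qc Q0 skewP gneP f T0 hf _ sf.
have [S [[SB SZ] Sform Sadj Scont Sder]] := unitary_group jinj bA sA c0 cC Acoer jdense skewP gneP.
pose mu := @lebesgue_measure R.
pose fc := restrict_from T0 f.
have fc0 t : t < T0 -> fc t = 0 by exact: restrict_from_lt.
have pf : pastL1 fc by exact: L2loc_pastL1.
have f0 := ae_esupp sf.
have fcf : {ae mu, forall t, fc t = f t}.
  by apply: ae_sub f0 => t h; rewrite /fc /restrict_from; case: leP => // /h.
have [u [cu fu hu]] := mild_exists sH bA sA c0 cC Acoer bB hQ Q1 Qc Q0 SB Sform Sadj Scont pf fc0.
have u0 t : t < T0 -> u t = 0.
  by move=> tT; rewrite -fu; exact: (mild_map0 B sA c0 Acoer Q0 SB fc0 u tT).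
have pu : pastL1 u by exact: pastL1_continuous cu u0.
have su : esupp u `<=` `[T0, +oo[ by apply: esupp_ae; apply: aeW => t; exact: u0.
have [/borel_wmeas mf _] := hf.
have [mfc _] := pf.
have wu : weak_solution j P A B Q f u.
  split; first exact: continuous_L2plus cu u0.
  move=> phi tphi.
  rewrite (mild_map_weak sH cj bA cC bB hQ Qc Q0 gneP SB SZ Sform Sadj Scont Sder pf fc0 cu fu tphi).
  have [b [_ cphi _ _ _]] := test_functionP tphi.
  have mphi : wmeas (fun t => j (phi t)) by exact: wmeas_continuous (comp_continuous cphi cj).
  congr (- _); apply: Rintegral_ae_eq => //; first exact: wmeas_inner.
    exact: wmeas_inner.
  by apply: ae_sub fcf => t ->.
exists u; split.
- by split=> //; exists T0.
- move=> v [[[bv v2] _] wv] [T sv].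
  (* A competing causal solution may start before [T0]; both functions vanish before the smaller of
     the two times. *)
  pose T1 := Num.min T T0.
  pose vc := restrict_from T1 v.
  have hv : L2loc v by [].
  have mv := borel_wmeas bv.
  have pv : pastL1 vc by exact: L2loc_pastL1.
  have v0 t : t < T1 -> vc t = 0 by exact: restrict_from_lt.
  have vcv : {ae mu, forall t, vc t = v t}.
    apply: ae_sub (ae_esupp sv) => t h; rewrite /vc /restrict_from; case: leP => // tT.
    by rewrite h// (lt_le_trans tT)// ge_min lexx.
  have u1 t : t < T1 -> u t = 0.
    by move=> tT; rewrite u0// (lt_le_trans tT)// ge_min lexx orbT.
  suff w0 : {ae mu, forall t, vc t - u t = 0}.
    apply: ae_sub (ae_and vcv w0) => t [<- /eqP].
    by rewrite subr_eq0 => /eqP.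
  apply: (weak_unique sH jinj cj bA cC bB hQ Q1 Qc Q0 skewP gneP SB SZ Sform Sadj Scont Sder
    (pastL1B sH pv pu) (T1 := T1)).
    by move=> t tT; rewrite v0// u1// subrr.
  move=> phi tphi; under eq_Rintegral do rewrite innerBl.
  have [_ i1 _] := weak_form_feedback sH cj bA bB hQ Qc Q0 gneP pv v0 tphi.
  have [_ i2 _] := weak_form_feedback sH cj bA bB hQ Qc Q0 gneP pu u0 tphi.
  rewrite RintegralB// (wu.2 _ tphi) -(wv _ tphi); apply/eqP; rewrite subr_eq0; apply/eqP.
  have mI := wmeas_test_form sH cj bA bB hQ Qc Q0 gneP tphi.
  apply: Rintegral_ae_eq => //; [apply: wmeas_inner => //; exact: wmeas_restrict_from|exact: wmeas_inner|].
  by apply: ae_sub vcv => t ->.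
- move=> T T0T /=.
  pose k := kappa c C; pose r := 2 * k * (opnorm B + op_L1norm Q) + 1.
  have k0 : 0 <= k.
    rewrite /k /kappa mulr_ge0 ?invr_ge0 ?(ltW c0)// exprn_ge0// divr_ge0 ?(ltW c0)//.
    exact: le_trans (ltW c0) cC.
  have r0 : 0 <= r.
    rewrite /r addr_ge0// mulr_ge0//; first by rewrite mulr_ge0.
    rewrite addr_ge0 ?opnorm_ge0// /op_L1norm.
    by apply: Rintegral_ge0 => t _; apply: opnorm_ge0; have [] := hQ t.
  have D0 t : T0 <= t -> 0 <= 4 * k ^+ 2 * (t - T0) * expR (2 * (r * (t - T0))).
    move=> Tt; rewrite mulr_ge0 ?expR_ge0// mulr_ge0 ?subr_ge0//.
    by rewrite mulr_ge0// exprn_ge0.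
  split=> [|t tT]; first exact: D0.
  have [tT0|Tt] := ltP t T0.
    rewrite u0// normr0 expr0n/= mule_ge0 ?lee_fin ?D0//.
    by apply: integral_ge0 => s _; rewrite lee_fin exprn_ge0.
  have i2 := L2loc_itv sH T0 t hf.
  pose J := \int[mu]_(s in `[T0, t]) (`|f s| ^+ 2).
  (* The integral over the whole past remains an extended real; the finite integral over [[T0, t]]
     is a lower bound for it, and only this is needed. *)
  have JE : (J%:E <= \int[mu]_(s in `]-oo, t]) (`|f s| ^+ 2)%:E)%E.
    rewrite /J /Rintegral fineK; last by apply: integrable_fin_num => //; exact: i2.
    apply: ge0_subset_integral => //.
    - apply/measurable_EFinP; apply: measurable_funX.
      exact: (@measurable_funTS _ _ _ _ _ (fun s => `|f s|) (wmeas_norm sH mf)).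
    - by move=> s /=; rewrite !in_itv/= => /andP[].
  apply: (@le_trans _ _ ((4 * k ^+ 2 * (T - T0) * expR (2 * (r * (T - T0))))%:E * J%:E)%E); last first.
    by apply: lee_wpmul2l; rewrite ?lee_fin ?D0.
  have J0 : 0 <= J by apply: Rintegral_ge0 => s _; rewrite exprn_ge0.
  rewrite -EFinM lee_fin.
  apply: (@le_trans _ _ (4 * k ^+ 2 * (t - T0) * expR (2 * (r * (t - T0))) * J)); last first.
    rewrite ler_wpM2r// ler_pM ?expR_ge0//.
    - by rewrite mulr_ge0 ?subr_ge0// mulr_ge0// exprn_ge0.
    - by rewrite ler_wpM2l ?lerD2r// mulr_ge0// exprn_ge0.
    - by rewrite ler_expR ler_wpM2l// ler_wpM2l// lerD2r.
  have I2 := sqr_Rintegral_le sH hf Tt.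
  have ut := hu t Tt; set I := \int[mu]_(s in _) _ in I2 ut.
  have I0 : 0 <= I by exact: Rintegral_ge0.
  apply: (@le_trans _ _ ((2 * (k * I) * expR (r * (t - T0))) ^+ 2)).
    by rewrite ler_pXn2r ?nnegrE// mulr_ge0 ?expR_ge0// mulr_ge0// mulr_ge0.
  rewrite (_ : 2 * (r * (t - T0)) = r * (t - T0) + r * (t - T0)); last by ring.
  rewrite expRD; move: (expR_ge0 (r * (t - T0))); move: (expR _) => e e0.
  rewrite (_ : _ ^+ 2 = 4 * k ^+ 2 * e ^+ 2 * I ^+ 2); last by ring.
  rewrite (_ : _ * J = 4 * k ^+ 2 * e ^+ 2 * ((t - T0) * J)); last by ring.
  apply: ler_wpM2l I2.
  by apply: mulr_ge0; [apply: mulr_ge0 => //|]; exact: exprn_ge0.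
Qed.
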